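(* Let $n\ge 3$, let $F$ be an algebraically closed field of characteristic zero, and let $H$ be a group. Then the following are equivalent: (1) $H\equiv \mathrm{GL}_n(F)$; (2) $H\cong (H'\times Z(H))/\mu_n$, where $H'\cong \mathrm{SL}_n(L)$ for some field $L\equiv F$, $Z(H)\equiv\mathbb{C}^\times$, and $\mu_n=\ker\phi$ for the homomorphism $\phi:H'\times Z(H)\to H$, $(h,z)\mapsto hz$.
   Context: $\equiv$ denotes elementary equivalence (language of groups for groups, language of rings for fields). $H'=[H,H]$ is the derived subgroup of $H$ and $Z(H)$ its center. *)

(* Defs.v *)
From HB Require Import structures.
From mathcomp Require Import all_boot all_algebra.
From mathcomp Require Import boolp.

Set Implicit Arguments.
Unset Strict Implicit.
Unset Printing Implicit Defensive.

Import GRing.Theory.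
Import Algebra.

Local Open Scope group_scope.
Local Open Scope quotient_scope.

(* First-order formulas with equality over a language without relation symbols:
   [T] is the type of terms of the language, with variables named by naturals. *)
Inductive formula (T : Type) : Type :=
| Falsum
| Equals of T & T
| Conj of formula T & formula T
| Disj of formula T & formula T
| Impl of formula T & formula T
| Forall of nat & formula T
| Exists of nat & formula T.
Arguments Falsum {T}.

Fixpoint free_vars T (tv : T -> seq nat) (f : formula T) : seq nat :=
  match f with
  | Falsum => [::]
  | Equals t u => tv t ++ tv u
  | Conj f g | Disj f g | Impl f g => free_vars tv f ++ free_vars tv g
  | Forall i f | Exists i f => [seq j <- free_vars tv f | j != i]
  end.

Definition sentence T (tv : T -> seq nat) (f : formula T) : Prop :=
  free_vars tv f = [::].

Fixpoint holds T M (ev : (nat -> M) -> T -> M) (e : nat -> M) (f : formula T) :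
    Prop :=
  match f with
  | Falsum => False
  | Equals t u => ev e t = ev e u
  | Conj f g => holds ev e f /\ holds ev e g
  | Disj f g => holds ev e f \/ holds ev e g
  | Impl f g => holds ev e f -> holds ev e g
  | Forall i f => forall x : M, holds ev [eta e with i |-> x] f
  | Exists i f => exists x : M, holds ev [eta e with i |-> x] f
  end.

(* On a nonempty structure the truth value of a sentence does not depend on the
   valuation, so quantifying over all valuations is harmless. *)
Definition elem_equiv T (tv : T -> seq nat)
    M (evM : (nat -> M) -> T -> M) N (evN : (nat -> N) -> T -> N) : Prop :=
  forall f : formula T, sentence tv f ->
    (forall e, holds evM e f) <-> (forall e, holds evN e f).

Inductive group_term : Type :=
| GVar of nat
| GOne
| GMul of group_term & group_term
| GInv of group_term.

Fixpoint group_term_vars (t : group_term) : seq nat :=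
  match t with
  | GVar i => [:: i]
  | GOne => [::]
  | GMul t u => group_term_vars t ++ group_term_vars u
  | GInv t => group_term_vars t
  end.

Fixpoint group_eval (G : groupType) (e : nat -> G) (t : group_term) : G :=
  match t with
  | GVar i => e i
  | GOne => 1
  | GMul t u => group_eval e t * group_eval e u
  | GInv t => (group_eval e t)^-1
  end.

Inductive ring_term : Type :=
| RVar of nat
| RZero
| ROne
| RAdd of ring_term & ring_term
| ROpp of ring_term
| RMul of ring_term & ring_term.

Fixpoint ring_term_vars (t : ring_term) : seq nat :=
  match t with
  | RVar i => [:: i]
  | RZero | ROne => [::]
  | RAdd t u | RMul t u => ring_term_vars t ++ ring_term_vars u
  | ROpp t => ring_term_vars t
  end.

Fixpoint ring_eval (R : nzRingType) (e : nat -> R) (t : ring_term) : R :=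
  match t with
  | RVar i => e i
  | RZero => 0%R
  | ROne => 1%R
  | RAdd t u => (ring_eval e t + ring_eval e u)%R
  | ROpp t => (- ring_eval e t)%R
  | RMul t u => (ring_eval e t * ring_eval e u)%R
  end.

Definition group_elem_equiv (G H : groupType) : Prop :=
  elem_equiv group_term_vars (@group_eval G) (@group_eval H).

Definition ring_elem_equiv (R S : nzRingType) : Prop :=
  elem_equiv ring_term_vars (@ring_eval R) (@ring_eval S).

Notation "G ≡g H" := (group_elem_equiv G H) (at level 70).
Notation "R ≡r S" := (ring_elem_equiv R S) (at level 70).

Definition group_iso (G H : groupType) : Prop :=
  exists f : {multiplicative G -> H}, bijective f.

Notation "G ≅ H" := (group_iso G H) (at level 70).

Definition GL (n : nat) (K : fieldType) : Type := {A : 'M[K]_n | A \in unitmx}.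

Section GLGroup.
Variables (n : nat) (K : fieldType).
Implicit Types A B : GL n K.

HB.instance Definition _ := Choice.on (GL n K).

Fact GL_one_subproof : (1%:M : 'M[K]_n)%R \in unitmx. Proof. exact: unitmx1. Qed.
Fact GL_mul_subproof A B : (val A *m val B)%R \in unitmx.
Proof. by rewrite unitmx_mul (valP A) (valP B). Qed.
Fact GL_inv_subproof A : invmx (val A) \in unitmx.
Proof. by rewrite unitmx_inv (valP A). Qed.

Definition GL_one : GL n K := Sub 1%:M%R GL_one_subproof.
Definition GL_mul A B : GL n K := Sub (val A *m val B)%R (GL_mul_subproof A B).
Definition GL_inv A : GL n K := Sub (invmx (val A)) (GL_inv_subproof A).

Fact GL_mulA : associative GL_mul.
Proof. by move=> A B C; apply: val_inj; rewrite /= mulmxA. Qed.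
Fact GL_mul1g : left_id GL_one GL_mul.
Proof. by move=> A; apply: val_inj; rewrite /= mul1mx. Qed.
Fact GL_mulg1 : right_id GL_one GL_mul.
Proof. by move=> A; apply: val_inj; rewrite /= mulmx1. Qed.
Fact GL_mulVg : left_inverse GL_one GL_inv GL_mul.
Proof. by move=> A; apply: val_inj; rewrite /= mulVmx ?(valP A). Qed.
Fact GL_mulgV : right_inverse GL_one GL_inv GL_mul.
Proof. by move=> A; apply: val_inj; rewrite /= mulmxV ?(valP A). Qed.

HB.instance Definition _ := isGroup.Build (GL n K)
  GL_mulA GL_mul1g GL_mulg1 GL_mulVg GL_mulgV.
End GLGroup.

Section SLGroup.
Variables (n : nat) (K : fieldType).

Definition SL_pred : {pred GL n K} := fun A => (\det (val A) == 1)%R.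

Definition SL : Type := {A : GL n K | A \in SL_pred}.

Fact SL_closed : group_closed SL_pred.
Proof.
split=> [|A B]; rewrite !unfold_in /SL_pred /= ?det1 // => /eqP dA /eqP dB.
by rewrite det_mulmx det_inv dA dB invr1 mulr1.
Qed.

HB.instance Definition _ := SubChoice.on SL.
HB.instance Definition _ := SubChoice_isSubGroup.Build _ SL_pred SL SL_closed.
End SLGroup.

Definition units (R : unitRingType) : Type := {x : R | x \is a GRing.unit}.

Section UnitGroup.
Variable R : unitRingType.
Implicit Types x y : units R.

HB.instance Definition _ := Choice.on (units R).

Fact units_mul_subproof x y : (val x * val y)%R \is a GRing.unit.
Proof. by rewrite unitrMl (valP x, valP y). Qed.
Fact units_inv_subproof x : ((val x)^-1)%R \is a GRing.unit.
Proof. by rewrite unitrV (valP x). Qed.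

Definition units_one : units R := Sub 1%R (unitr1 R).
Definition units_mul x y : units R := Sub (val x * val y)%R (units_mul_subproof x y).
Definition units_inv x : units R := Sub (val x)^-1%R (units_inv_subproof x).

Fact units_mulA : associative units_mul.
Proof. by move=> x y z; apply: val_inj; rewrite /= mulrA. Qed.
Fact units_mul1g : left_id units_one units_mul.
Proof. by move=> x; apply: val_inj; rewrite /= mul1r. Qed.
Fact units_mulg1 : right_id units_one units_mul.
Proof. by move=> x; apply: val_inj; rewrite /= mulr1. Qed.
Fact units_mulVg : left_inverse units_one units_inv units_mul.
Proof. by move=> x; apply: val_inj; rewrite /= mulVr ?(valP x). Qed.
Fact units_mulgV : right_inverse units_one units_inv units_mul.
Proof. by move=> x; apply: val_inj; rewrite /= mulrV ?(valP x). Qed.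

HB.instance Definition _ := isGroup.Build (units R)
  units_mulA units_mul1g units_mulg1 units_mulVg units_mulgV.
End UnitGroup.

Section DerivedCenter.
Variable H : groupType.

Definition derived_pred : {pred H} := fun x =>
  `[< forall S : {pred H}, group_closed S ->
        (forall y z : H, [~ y, z] \in S) -> x \in S >].

Definition derived : Type := {x : H | x \in derived_pred}.

Fact derived_closed : group_closed derived_pred.
Proof.
split=> [|x y /asboolP dx /asboolP dy]; apply/asboolP => S cS S_comm.
  exact: (fst cS).
by apply: (snd cS); [exact: dx | exact: dy].
Qed.

HB.instance Definition _ := SubChoice.on derived.
HB.instance Definition _ :=
  SubChoice_isSubGroup.Build H derived_pred derived derived_closed.

Definition center_pred : {pred H} := fun x => `[< forall y : H, commute x y >].

Definition center : Type := {x : H | x \in center_pred}.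

Fact center_closed : group_closed center_pred.
Proof.
split=> [|x y /asboolP cx /asboolP cy]; apply/asboolP => z.
  by rewrite /commute mul1g mulg1.
apply: commute_sym; apply: commuteM; first exact/commute_sym/cx.
exact/commuteV/commute_sym/cy.
Qed.

HB.instance Definition _ := SubChoice.on center.
HB.instance Definition _ :=
  SubChoice_isSubGroup.Build H center_pred center center_closed.

End DerivedCenter.

(* mathcomp.fingroup only covers subgroups and quotients of finite groups. *)
Record normalSubgroup (G : groupType) := NormalSubgroup {
  nsub :> {pred G};
  nsub_closed : group_closed nsub;
  nsub_conj : forall x y : G, x \in nsub -> x ^ y \in nsub
}.

Section Quotient.
Variables (G : groupType) (N : normalSubgroup G).

Definition coset_rel : rel G := fun x y => x^-1 * y \in (N : {pred G}).

Lemma coset_rel_refl : reflexive coset_rel.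
Proof. by move=> x; rewrite /coset_rel mulVg (fst (nsub_closed N)). Qed.

Lemma coset_rel_sym : symmetric coset_rel.
Proof.
suff imp x y : coset_rel x y -> coset_rel y x by move=> x y; apply/idP/idP; apply: imp.
move=> /(group_closedV (nsub_closed N)).
by rewrite /coset_rel invgM invgK.
Qed.

Lemma coset_rel_trans : transitive coset_rel.
Proof.
move=> y x z xy yz; rewrite /coset_rel.
have := group_closedM (nsub_closed N) xy yz.
by rewrite -mulgA mulVKg.
Qed.

Canonical coset_equiv :=
  EquivRel coset_rel coset_rel_refl coset_rel_sym coset_rel_trans.

Definition quotient_group : Type := {eq_quot coset_rel}.

HB.instance Definition _ := Choice.on quotient_group.
HB.instance Definition _ := EqQuotient.on quotient_group.

Definition quotient_one : quotient_group := \pi_quotient_group 1.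
Definition quotient_mul (a b : quotient_group) : quotient_group :=
  \pi_quotient_group (repr a * repr b).
Definition quotient_inv (a : quotient_group) : quotient_group :=
  \pi_quotient_group (repr a)^-1.

Lemma quotient_mulE (x y : G) :
  quotient_mul (\pi_quotient_group x) (\pi_quotient_group y) =
  \pi_quotient_group (x * y).
Proof.
apply/eqmodP; rewrite /= /coset_rel.
have rx : coset_rel (repr (\pi_quotient_group x)) x by apply/eqmodP; rewrite reprK.
have ry : coset_rel (repr (\pi_quotient_group y)) y by apply/eqmodP; rewrite reprK.
move: rx ry; set a := repr _; set b := repr _ => rx ry.
have -> : (a * b)^-1 * (x * y) = (a^-1 * x) ^ b * (b^-1 * y).
  by rewrite /conjg invgM !mulgA mulgK.
by apply: (group_closedM (nsub_closed N)) => //; apply: nsub_conj.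
Qed.

Fact quotient_mulA : associative quotient_mul.
Proof.
elim/quotW=> x; elim/quotW=> y; elim/quotW=> z.
by rewrite (quotient_mulE y z) (quotient_mulE x (y * z)) (quotient_mulE x y)
  (quotient_mulE (x * y) z) mulgA.
Qed.
Fact quotient_mul1g : left_id quotient_one quotient_mul.
Proof. by elim/quotW=> x; rewrite (quotient_mulE 1 x) mul1g. Qed.
Fact quotient_mulg1 : right_id quotient_one quotient_mul.
Proof. by elim/quotW=> x; rewrite (quotient_mulE x 1) mulg1. Qed.
Fact quotient_mulVg : left_inverse quotient_one quotient_inv quotient_mul.
Proof.
move=> a; rewrite -[X in quotient_mul _ X]reprK.
by rewrite (quotient_mulE (repr a)^-1 (repr a)) mulVg.
Qed.
Fact quotient_mulgV : right_inverse quotient_one quotient_inv quotient_mul.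
Proof.
move=> a; rewrite -[X in quotient_mul X _]reprK.
by rewrite (quotient_mulE (repr a) (repr a)^-1) mulgV.
Qed.

HB.instance Definition _ := isGroup.Build quotient_group
  quotient_mulA quotient_mul1g quotient_mulg1 quotient_mulVg quotient_mulgV.

End Quotient.

Section Kernel.
Variables (G H : groupType) (f : {multiplicative G -> H}).

Definition ker_pred : {pred G} := fun x => f x == 1.

Let morph1 : f 1 = 1.
Proof. by apply: (@mulgI _ (f 1)); rewrite -gmulfM !mulg1. Qed.

Let morphV x : f x^-1 = (f x)^-1.
Proof. by apply: (@mulgI _ (f x)); rewrite -gmulfM !mulgV. Qed.

Fact ker_closed : group_closed ker_pred.
Proof.
split=> [|x y]; rewrite !unfold_in /ker_pred ?morph1 // => /eqP fx /eqP fy.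
by rewrite gmulfM morphV fx fy divgg.
Qed.

Fact ker_conj (x y : G) : x \in ker_pred -> x ^ y \in ker_pred.
Proof.
rewrite !unfold_in /ker_pred => /eqP fx.
by rewrite /conjg !gmulfM morphV fx mul1g mulVg.
Qed.

Definition kernel : normalSubgroup G := NormalSubgroup ker_closed ker_conj.
End Kernel.

Section DerivedCenterProduct.
Variable H : groupType.

Definition mul_derived_center (p : derived H * center H) : H :=
  val p.1 * val p.2.

Fact mul_derived_center_is_multiplicative :
  {morph mul_derived_center : p q / p * q}.
Proof.
move=> [x z] [y w]; rewrite /mul_derived_center /= -!mulgA; congr (_ * _).
have /asboolP cz := valP z.
by rewrite !mulgA; congr (_ * _); apply: commute_sym; apply: cz.
Qed.

HB.instance Definition _ := isMultiplicative.Build (derived H * center H)%type H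
  mul_derived_center mul_derived_center_is_multiplicative.

End DerivedCenterProduct.

(* Main.v *)
Require Import Defs.
From HB Require Import structures.
From mathcomp Require Import all_boot all_order all_algebra.
From mathcomp Require Import perm separable cyclic cyclotomic boolp zify ring.

(* (1) => (2): an interpretation in the style of Mal'cev.  In GL_n(F) choose a transvection
   x = 1 + E_02 and elements s, t conjugating it to 1 + E_01 and 1 + E_12.  The root subgroup
   of x is { g in C(C(x)) : [g^s, x^t] = g }, and it becomes a field isomorphic to F if the
   addition is the group law and the multiplication is (a, b) |-> [a^s, b^t].  The first-order
   condition [frame] on (x, s, t) guarantees that *every* triple satisfying it in GL_n(F)
   yields a copy of F; hence a frame of H yields a field L elementarily equivalent to F.
   Matrices of determinant 1 are products of transvections in a fixed pattern, so a single
   sentence expresses that these products multiply in H as the matrices over L do, that they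
   contain all commutators, and that together with the center they generate H.

   (2) => (1): H is the product of its center and of H' = SL_n(L), because SL_n(L) is perfect,
   and GL_n(L) = GL_n(F) in the sense of elementary equivalence, because GL_n is interpreted in
   the field.  So it remains to compare two central products of SL_n(L) with abelian groups
   which are divisible and have cyclic m-torsion of order m for all m.  This is a back and
   forth argument: the components in SL_n(L) are kept, while the components in the abelian
   groups satisfy the same linear relations with small coefficients, up to torsion. *)

Set Implicit Arguments.
Unset Strict Implicit.
Unset Printing Implicit Defensive.

Import Order.TTheory GRing.Theory Num.Theory.

(** * Elementary equivalence and definability *)

(** A sentence cannot name a standard transvection, so frames are quantified and a frame of [GL n F]
    in arbitrary position must be brought under control. That every noncentral element of C(C(x)) is
    conjugate to [x] up to the center forces [x] to be a(1 + M) with M^2 = 0, and conjugacy of [x]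
    with its square forces a = 1. Characteristic zero then turns the group commutator relation into
    AB = BA + M for matrices. The rank of M is left open: the double centralizer still yields only
    the elements 1 + cM up to scalars. In the converse, the isomorphism of (2) is abstract and not
    assumed to be induced by multiplication, so H = H' Z(H) has to be extracted from the perfectness
    of H'. Moreover L is merely elementarily equivalent to F; roots in L are obtained by
    transferring properties of centers. In the back and forth, torsion must be matched compatibly
    with the amalgamated cyclic groups. Hence generators of the M-torsion lying over the amalgamated
    elements are fixed at the start, with M a multiple of all small orders, and their coefficients
    in linear relations stay unbounded. *)

Section Transfer.
Variables (T : Type) (tv : T -> seq nat).

Lemma free_vars_foldr_Forall (s : seq nat) (f : formula T) :
  free_vars tv (foldr (@Forall T) f s) =
  [seq j <- free_vars tv f | j \notin s].
Proof.
elim: s => [|i s IH] /=; first by rewrite filter_predT.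
rewrite IH -filter_predI; apply: eq_filter => j /=.
by rewrite inE negb_or.
Qed.

Variables (M : Type) (ev : (nat -> M) -> T -> M).

Lemma eta_with_id (e : nat -> M) i : ([eta e with i |-> e i] : nat -> M) = e.
Proof. by apply/funext => j /=; case: eqP => [->|]. Qed.

Lemma holds_foldr_Forall (s : seq nat) (f : formula T) :
  (forall e, holds ev e (foldr (@Forall T) f s)) <-> (forall e, holds ev e f).
Proof.
elim: s => [|i s IH] //=; rewrite -IH; split=> H e; last by move=> x; apply: H.
by rewrite -(eta_with_id e i); apply: H.
Qed.
End Transfer.

(** Validity at all valuations is the truth of the universal closure. This allows formulas with free
    parameters, such as the members of a frame, to be transferred directly. *)
Lemma elem_equivP T (tv : T -> seq nat)
    M (evM : (nat -> M) -> T -> M) N (evN : (nat -> N) -> T -> N) :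
  elem_equiv tv evM evN -> forall f : formula T,
  (forall e, holds evM e f) <-> (forall e, holds evN e f).
Proof.
move=> equivMN f.
rewrite -(holds_foldr_Forall evM (free_vars tv f)).
rewrite -(holds_foldr_Forall evN (free_vars tv f)).
apply: equivMN; rewrite /sentence free_vars_foldr_Forall.
by apply/eqP; rewrite -[_ == _]negbK -has_filter -all_predC; apply/allP => j /= ->.
Qed.

Lemma holds_eq_in T (tv : T -> seq nat) M (ev : (nat -> M) -> T -> M) :
  (forall e1 e2 t, {in tv t, e1 =1 e2} -> ev e1 t = ev e2 t) ->
  forall f e1 e2, {in free_vars tv f, e1 =1 e2} ->
  holds ev e1 f <-> holds ev e2 f.
Proof.
move=> ev_eq; elim=> //= [t u|f IHf g IHg|f IHf g IHg|f IHf g IHg|i f IHf|i f IHf] e1 e2 e12.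
- rewrite (ev_eq e1 e2 t) 1?(ev_eq e1 e2 u) // => j jt; apply: e12;
    by rewrite mem_cat jt ?orbT.
- rewrite (IHf e1 e2) 1?(IHg e1 e2) // => j jf; apply: e12;
    by rewrite mem_cat jf ?orbT.
- rewrite (IHf e1 e2) 1?(IHg e1 e2) // => j jf; apply: e12;
    by rewrite mem_cat jf ?orbT.
- rewrite (IHf e1 e2) 1?(IHg e1 e2) // => j jf; apply: e12;
    by rewrite mem_cat jf ?orbT.
- split=> H x; move: (H x); apply IHf => j jf /=; case: eqP => // /eqP ji;
    by rewrite e12 // mem_filter ji.
- split=> -[x H]; exists x; move: H; apply IHf => j jf /=; case: eqP => // /eqP ji;
    by rewrite e12 // mem_filter ji.
Qed.

Lemma group_eval_eq_in (G : groupType) (e1 e2 : nat -> G) t :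
  {in group_term_vars t, e1 =1 e2} -> group_eval e1 t = group_eval e2 t.
Proof.
elim: t => [i|//|t IHt u IHu|t IHt] /= e12; last by rewrite IHt.
  by apply: e12; rewrite inE.
by rewrite IHt 1?IHu // => j jt; apply: e12; rewrite mem_cat jt ?orbT.
Qed.

Lemma group_elem_equiv_sym (G H : groupType) : G ≡g H -> H ≡g G.
Proof. by move=> GH f sf; split=> /GH; apply. Qed.

Lemma group_elem_equiv_trans (G H K : groupType) : G ≡g H -> H ≡g K -> G ≡g K.
Proof.
move=> GH HK f sf; have := GH f sf; have := HK f sf; tauto.
Qed.

(** * Uniformly definable properties of groups *)

(* A context is a functor of "tuples of group elements" whose components are stored in the
   variables [0 .. ctx_size - 1] of a valuation. *)
Record context := Context {
  ctx_size : nat;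
  ctx_type :> groupType -> Type;
  ctx_read : forall G : groupType, (nat -> G) -> ctx_type G;
  ctx_read_eq : forall (G : groupType) (e1 e2 : nat -> G),
    (forall i, (i < ctx_size)%N -> e1 i = e2 i) -> ctx_read e1 = ctx_read e2
}.
Arguments ctx_read : clear implicits.

Program Definition empty_ctx : context :=
  @Context 0 (fun=> unit) (fun _ _ => tt) _.

Program Definition ctx_add (C : context) (I : finType) : context :=
  @Context (ctx_size C + #|I|) (fun G => (C G * (I -> G))%type)
    (fun G e => (ctx_read C G e, fun i => e (ctx_size C + enum_rank i)%N)) _.
Next Obligation.
congr pair; first by apply: ctx_read_eq => i iC; apply: H; rewrite ltn_addr.
by apply/funext => i; apply: H; rewrite ltn_add2l.
Qed.

(** The formula is chosen before the group: this uniformity is what permits transfer between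
    elementarily equivalent groups. *)
Definition definable (C : context) (P : forall G : groupType, C G -> Prop) : Prop :=
  exists f, forall (G : groupType) (e : nat -> G),
    holds (@group_eval G) e f <-> P G (ctx_read C G e).

Definition definable_term (C : context) (t : forall G : groupType, C G -> G) : Prop :=
  exists u, forall (G : groupType) (e : nat -> G), group_eval e u = t G (ctx_read C G e).

Definition update (M : Type) (e : nat -> M) (s : nat) n (v : nat -> M) : nat -> M :=
  fun i => if (s <= i < s + n)%N then v (i - s)%N else e i.

Lemma block_surj (I : finType) (M : Type) (x : M) (w : I -> M) :
  exists v : nat -> M, (fun i : I => v (enum_rank i)) = w.
Proof.
exists (fun k => if insub k is Some j then w (enum_val (j : 'I_#|I|)) else x).
by apply/funext => i; rewrite valK enum_rankK.
Qed.

Lemma update0 (M : Type) (e : nat -> M) s v : update e s 0 v = e.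
Proof. by apply/funext=> i; rewrite /update addn0 ltnNge andbN. Qed.

Lemma updateS (M : Type) (e : nat -> M) s n v :
  update e s n.+1 v = update [eta e with s |-> v 0%N] s.+1 n (fun i => v i.+1).
Proof.
apply/funext => i; rewrite /update /=.
have [-> | ne] := eqVneq i s.
  by rewrite leqnn subnn ltnn addnS ltnS leq_addr.
rewrite addSnnS; have -> : (s <= i)%N = (s < i)%N by rewrite ltn_neqAle eq_sym ne.
by case: ltnP => //= si; rewrite -(subnSK si).
Qed.

Lemma holds_Forall_block T M (ev : (nat -> M) -> T -> M) s n f e :
  holds ev e (foldr (@Forall T) f (iota s n)) <->
  forall v, holds ev (update e s n v) f.
Proof.
elim: n s e => [|n IH] s e /=.
  by split=> [H v|/(_ e)]; rewrite update0.
split=> [H v|H x]; first by rewrite updateS; apply IH.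
by apply/IH => v; have := H (fun i => if i is j.+1 then v j else x); rewrite updateS.
Qed.

Lemma holds_Exists_block T M (ev : (nat -> M) -> T -> M) s n f e :
  holds ev e (foldr (@Exists T) f (iota s n)) <->
  exists v, holds ev (update e s n v) f.
Proof.
elim: n s e => [|n IH] s e /=.
  by split=> [H|[v]]; [exists e | ]; rewrite update0.
split=> [[x /IH[v H]]|[v]].
  by exists (fun i => if i is j.+1 then v j else x); rewrite updateS.
by rewrite updateS => H; exists (v 0%N); apply/IH; eexists; exact: H.
Qed.

Section Closure.
Variable C : context.
Implicit Types P Q : forall G : groupType, C G -> Prop.
Implicit Types t u : forall G : groupType, C G -> G.

Lemma definable_ext P Q : (forall G c, P G c <-> Q G c) -> definable P -> definable Q.
Proof. by move=> PQ [f Pf]; exists f => G e; rewrite Pf. Qed.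

Lemma definable_and P Q : definable P -> definable Q ->
  definable (fun G c => P G c /\ Q G c).
Proof.
move=> [f Pf] [g Qg]; exists (Conj f g) => G e /=.
by rewrite Pf Qg.
Qed.

Lemma definable_impl P Q : definable P -> definable Q ->
  definable (fun G c => P G c -> Q G c).
Proof.
move=> [f Pf] [g Qg]; exists (Impl f g) => G e /=.
by rewrite Pf Qg.
Qed.

Lemma definable_False : definable (C := C) (fun _ _ => False).
Proof. by exists Falsum. Qed.

Lemma definable_not P : definable P -> definable (fun G c => ~ P G c).
Proof. by move=> dP; apply: definable_impl dP definable_False. Qed.

Lemma definable_iff P Q : definable P -> definable Q ->
  definable (fun G c => P G c <-> Q G c).
Proof. by move=> dP dQ; apply: definable_and; apply: definable_impl. Qed.

Lemma definable_eq t u : definable_term t -> definable_term u ->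
  definable (fun G c => t G c = u G c).
Proof.
move=> [f tf] [g ug]; exists (Equals f g) => G e /=.
by rewrite tf ug.
Qed.

(** Side conditions that do not mention the group, such as bounds on exponents, are decided
    classically outside the language. *)
Lemma definable_const (p : Prop) : definable (C := C) (fun _ _ => p).
Proof.
have [hp|np] := pselect p.
  by exists (Impl Falsum Falsum) => G e /=; split.
by exists Falsum.
Qed.

Lemma definable_forall_in (I : eqType) (r : seq I) (P : I -> forall G, C G -> Prop) :
  (forall i, definable (P i)) -> definable (fun G c => forall i, i \in r -> P i G c).
Proof.
move=> dP; elim: r => [|i r [g IH]]; first by exists (Impl Falsum Falsum) => G e /=; split.
have [f Pf] := dP i; exists (Conj f g) => G e /=; rewrite Pf IH.
split=> [[Pi Pr] j|Pr]; first by rewrite inE => /predU1P[->|/Pr].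
by split=> [|j jr]; apply: Pr; rewrite inE ?eqxx ?jr ?orbT.
Qed.

Lemma definable_forall_fin (I : finType) (P : I -> forall G, C G -> Prop) :
  (forall i, definable (P i)) -> definable (fun G c => forall i, P i G c).
Proof.
move=> /(@definable_forall_in _ (enum I))[f Pf]; exists f => G e; rewrite Pf.
by split=> H i; [apply: H; rewrite mem_enum | move=> _; apply: H].
Qed.

Lemma definable_exists_in (I : eqType) (r : seq I) (P : I -> forall G, C G -> Prop) :
  (forall i, definable (P i)) -> definable (fun G c => exists2 i, i \in r & P i G c).
Proof.
move=> dP; elim: r => [|i r [g IH]]; first by exists Falsum => G e /=; split=> // -[].
have [f Pf] := dP i; exists (Disj f g) => G e /=; rewrite Pf IH.
split=> [[Pi|[j jr Pj]]|[j]]; first by exists i; rewrite // inE eqxx.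
  by exists j; rewrite // inE jr orbT.
by rewrite inE => /predU1P[->|jr] Pj; [left | right; exists j].
Qed.

Lemma definable_exists_fin (I : finType) (P : I -> forall G, C G -> Prop) :
  (forall i, definable (P i)) -> definable (fun G c => exists i, P i G c).
Proof.
move=> /(@definable_exists_in _ (enum I))[f Pf]; exists f => G e; rewrite Pf.
by split=> -[i]; [exists i | exists i; rewrite ?mem_enum].
Qed.

Lemma ctx_read_add (I : finType) (G : groupType) (e : nat -> G) v :
  ctx_read (ctx_add C I) G (update e (ctx_size C) #|I| v) =
  (ctx_read C G e, fun i => v (enum_rank i)).
Proof.
congr pair.
  by apply: ctx_read_eq => i iC; rewrite /update leqNgt iC.
by apply/funext => i; rewrite /update leq_addr ltn_add2l ltn_ord /= addKn.
Qed.

Lemma definable_forall (I : finType) (P : forall G, C G -> (I -> G) -> Prop) :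
  definable (C := ctx_add C I) (fun G c => P G c.1 c.2) ->
  definable (fun G c => forall v, P G c v).
Proof.
move=> [f Pf]; exists (foldr (@Forall _) f (iota (ctx_size C) #|I|)) => G e.
rewrite holds_Forall_block; split=> [H w|H v].
  by have [v <-] := block_surj 1%g w; have /Pf := H v; rewrite ctx_read_add.
by apply/Pf; rewrite ctx_read_add; apply: H.
Qed.

Lemma definable_exists (I : finType) (P : forall G, C G -> (I -> G) -> Prop) :
  definable (C := ctx_add C I) (fun G c => P G c.1 c.2) ->
  definable (fun G c => exists v, P G c v).
Proof.
move=> [f Pf]; exists (foldr (@Exists _) f (iota (ctx_size C) #|I|)) => G e.
rewrite holds_Exists_block; split=> [[v /Pf]|[w Pw]].
  by rewrite ctx_read_add; eexists; eassumption.
by have [v vw] := block_surj 1%g w; exists v; apply/Pf; rewrite ctx_read_add vw.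
Qed.

Lemma definable_forall1 (P : forall G, C G -> G -> Prop) :
  definable (C := ctx_add C unit) (fun G c => P G c.1 (c.2 tt)) ->
  definable (fun G c => forall x, P G c x).
Proof.
move=> /(@definable_forall _ (fun G c v => P G c (v tt)))[f Pf].
by exists f => G e; rewrite Pf; split=> [H x|H v //]; apply: (H (fun=> x)).
Qed.

Lemma definable_exists1 (P : forall G, C G -> G -> Prop) :
  definable (C := ctx_add C unit) (fun G c => P G c.1 (c.2 tt)) ->
  definable (fun G c => exists x, P G c x).
Proof.
move=> /(@definable_exists _ (fun G c v => P G c (v tt)))[f Pf].
by exists f => G e; rewrite Pf; split=> [[v H]|[x H]]; [exists (v tt) | exists (fun=> x)].
Qed.

Lemma definable_term1 : definable_term (C := C) (fun G c => 1%g).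
Proof. by exists GOne. Qed.

Lemma definable_termM t u : definable_term t -> definable_term u ->
  definable_term (fun G c => (t G c * u G c)%g).
Proof. by move=> [f tf] [g ug]; exists (GMul f g) => G e /=; rewrite tf ug. Qed.

Lemma definable_termV t : definable_term t -> definable_term (fun G c => (t G c)^-1%g).
Proof. by move=> [f tf]; exists (GInv f) => G e /=; rewrite tf. Qed.

Lemma definable_termJ t u : definable_term t -> definable_term u ->
  definable_term (fun G c => (t G c ^ u G c)%g).
Proof.
by move=> dt du; do ?[exact: dt | exact: du | apply: definable_termM | apply: definable_termV].
Qed.

Lemma definable_termR t u : definable_term t -> definable_term u ->
  definable_term (fun G c => [~ t G c, u G c]%g).
Proof.
move=> dt du; apply: definable_termM; first exact: definable_termV.
exact: definable_termJ.
Qed.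

Lemma definable_termX t n : definable_term t -> definable_term (fun G c => (t G c ^+ n)%g).
Proof.
move=> dt; elim: n => [|n [f IH]]; first exact: definable_term1.
have [g tg] := dt; exists (GMul g f) => G e /=.
by rewrite IH tg expgS.
Qed.

Lemma definable_term_prod (I : Type) (r : seq I) (p : pred I) (t : I -> forall G, C G -> G) :
  (forall i, definable_term (t i)) ->
  definable_term (fun G c => \prod_(i <- r | p i) t i G c)%g.
Proof.
move=> dt; elim: r => [|i r [g IH]]; first by exists GOne => G e; rewrite big_nil.
have [f tf] := dt i; exists (if p i then GMul f g else g) => G e; rewrite big_cons.
by case: (p i); rewrite /= ?tf IH.
Qed.

Lemma definable_weaken (I : finType) t :
  definable_term t -> definable_term (C := ctx_add C I) (fun G c => t G c.1).
Proof. by move=> [f tf]; exists f. Qed.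

Lemma definable_var (I : finType) (i : I) :
  definable_term (C := ctx_add C I) (fun G c => c.2 i).
Proof. by exists (GVar (ctx_size C + enum_rank i)). Qed.

End Closure.

Section Variables.
Variables (C : context) (I I1 I2 I3 I4 I5 I6 : finType) (i : I).
Let C0 := ctx_add C I.
Let C1 := ctx_add C0 I1.
Let C2 := ctx_add C1 I2.
Let C3 := ctx_add C2 I3.
Let C4 := ctx_add C3 I4.
Let C5 := ctx_add C4 I5.
Let C6 := ctx_add C5 I6.

Lemma definable_var1 : definable_term (C := C1) (fun G c => c.1.2 i).
Proof. exact: (definable_weaken _ (definable_var C i)). Qed.

Lemma definable_var2 : definable_term (C := C2) (fun G c => c.1.1.2 i).
Proof. exact: (definable_weaken _ definable_var1). Qed.

Lemma definable_var3 : definable_term (C := C3) (fun G c => c.1.1.1.2 i).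
Proof. exact: (definable_weaken _ definable_var2). Qed.

Lemma definable_var4 : definable_term (C := C4) (fun G c => c.1.1.1.1.2 i).
Proof. exact: (definable_weaken _ definable_var3). Qed.

Lemma definable_var5 : definable_term (C := C5) (fun G c => c.1.1.1.1.1.2 i).
Proof. exact: (definable_weaken _ definable_var4). Qed.

Lemma definable_var6 : definable_term (C := C6) (fun G c => c.1.1.1.1.1.1.2 i).
Proof. exact: (definable_weaken _ definable_var5). Qed.
End Variables.

Ltac definable_step :=
  first
  [ assumption | exact: definable_var | exact: definable_var1 | exact: definable_var2
  | exact: definable_var3 | exact: definable_var4 | exact: definable_var5
  | exact: definable_var6
  | exact: definable_term1
  | apply: definable_termR | apply: definable_termJ | apply: definable_termX
  | apply: definable_termM | apply: definable_termV
  | apply: definable_and | apply: definable_iff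
  | apply: definable_impl | apply: definable_not
  | apply: definable_forall1 | apply: definable_exists1
  | apply: definable_forall | apply: definable_exists
  | apply: definable_forall_fin => ? | apply: definable_exists_fin => ?
  | apply: definable_eq | exact: definable_const ].

Ltac prove_definable := repeat definable_step.

Lemma definable_transfer (G H : groupType) (P : forall G : groupType, Prop) :
  G ≡g H -> definable (C := empty_ctx) (fun G _ => P G) -> P G -> P H.
Proof.
move=> GH [f Pf] PG; have /(elem_equivP GH) allf : forall e, holds (@group_eval G) e f.
  by move=> e; apply/Pf.
by have /Pf := allf (fun=> 1%g).
Qed.

(** * Abelian groups with divisible cyclic torsion *)

Section Extension.
Local Open Scope ring_scope.
Variables (V A1 A2 : zmodType) (f1 : {additive V -> A1}) (f2 : {additive V -> A2}).
Variable B : nat -> V -> Prop.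
Hypothesis B_le : forall m n v, (m <= n)%N -> B m v -> B n v.
Hypothesis B_add : forall m n u v, B m u -> B n v -> B (m + n) (u + v).
Hypothesis B_opp : forall m v, B m v -> B m (- v).
Hypothesis B_mul : forall m v k, B m v -> B (k * m) (v *+ k).
Variable N : nat.
Hypothesis f1_tors : forall k a, (0 < k <= N)%N -> a *+ k = 0 -> exists2 v, B 0 v & f1 v = a.
Hypothesis A2_div : forall k (a : A2), (0 < k)%N -> exists b, b *+ k = a.
Hypothesis A2_inf : forall X : seq A2, exists y, y \notin X.
Hypothesis f2_fin : exists X : seq A2, forall v, B N v -> f2 v \in X.

(* [bound (N - k)] bounds the relations [k c = f1 v] that are taken into account: remainders
   of such a relation modulo one with a larger [k] stay below the bound for the smaller one. *)
Fixpoint bound (j : nat) : nat :=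
  if j is i.+1 then (N * (N + N * bound i) + N * bound i + N + bound i)%N else N.

(** The summands bound [w *+ h] and [v0] in the proof of [extend], where the kernels of [f1] and
    [f2] are compared on the difference of these two. *)
Definition extension_bound : nat := (N * bound N + bound N)%N.

Lemma bound_mono i j : (i <= j)%N -> (bound i <= bound j)%N.
Proof.
move/subnK <-; elim: (j - i)%N => // k; rewrite addSn /=; lia.
Qed.

Lemma boundS i j : (i < j)%N -> (N * (N + N * bound i) + N * bound i + N <= bound j)%N.
Proof. by move/bound_mono; apply: leq_trans; rewrite /= leq_addr. Qed.

(** If some small positive multiple of [c] is an admissible value of [f1], take the least such
    multiple [k] and let [d] be a [k]-th part of the corresponding value of [f2]; divisibility
    provides it. Otherwise [c] is independent at this level, and [d] only has to avoid finitely many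
    values. *)
Lemma extend (c : A1) :
  (forall v, B extension_bound v -> f1 v = 0 <-> f2 v = 0) ->
  exists d : A2, forall v k, B N v -> (k <= N)%N ->
    f1 v + c *+ k = 0 <-> f2 v + d *+ k = 0.
Proof.
move=> f12.
pose rel k := (0 < k <= N)%N /\ exists2 v, B (bound (N - k)) v & f1 v = c *+ k.
have [[k0 k0P]|norel] := pselect (exists k, rel k).
- have /ex_minnP[k /asboolP[/andP[k_gt0 kN] [v0 Bv0 v0c]] kmin] : exists k, `[< rel k >].
    by exists k0; apply/asboolP.
  have {}kmin j : rel j -> (k <= j)%N by move=> /asboolP; apply: kmin.
  have [d dv0] := A2_div (f2 v0) k_gt0; exists d => v k' Bv k'N.
  rewrite (divn_eq k' k); set q := (k' %/ k)%N; set r := (k' %% k)%N.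
  have rk : (r < k)%N by rewrite ltn_mod.
  have qN : (q <= N)%N by rewrite (leq_trans (leq_div _ _)).
  have rN : (r <= N)%N by lia.
  pose u := v + v0 *+ q.
  have Bu : B (N + N * bound (N - k)) u.
    by apply: B_add => //; apply: B_le (B_mul q Bv0); rewrite leq_mul2r qN orbT.
  have bNk : (N - k < N)%N by lia.
  have := boundS bNk; rewrite -/(bound _) => b1.
  have -> : f1 v + c *+ (q * k + r) = f1 u + c *+ r.
    by rewrite [f1 u]raddfD raddfMn v0c mulrnDr -mulrnA mulnC addrA.
  have -> : f2 v + d *+ (q * k + r) = f2 u + d *+ r.
    by rewrite [f2 u]raddfD raddfMn -dv0 mulrnDr -mulrnA mulnC addrA.
  have [->|r_gt0] := posnP r.
    rewrite !mulr0n !addr0; apply: f12; apply: B_le Bu; rewrite /extension_bound; nia.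
  split=> /eqP; rewrite addrC addr_eq0 => /eqP re; exfalso.
    suff /kmin : rel r by rewrite leqNgt rk.
    split; first by rewrite r_gt0.
    exists (- u); last by rewrite raddfN.
    apply/B_opp/B_le/Bu; have := @boundS (N - k) (N - r); nia.
  (* Relations of [d] with multipliers [k] and [r] combine to one with their gcd [g], which is less
     than [k]. It is carried back to [c], against the minimality of [k]. *)
  have [a ak] := Bezoutl r k_gt0.
  set g := gcdn k r => /dvdnP[b gb].
  have g_gt0 : (0 < g)%N by rewrite gcdn_gt0 k_gt0.
  have gr : (g <= r)%N by rewrite dvdn_leq ?dvdn_gcdr.
  have br : (b <= r)%N by rewrite -(leq_pmul2r k_gt0); nia.
  pose w := v0 *+ b + u *+ a.
  have dg : d *+ g = f2 w.
    apply: (@addIr _ (d *+ (a * r))); rewrite -mulrnDr gb mulnC mulrnA dv0.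
    by rewrite [f2 w]raddfD !raddfMn mulnC mulrnA re mulNrn addrK.
  have Bw : B (N * bound (N - k) + N * (N + N * bound (N - k))) w.
    apply: B_add; [apply: B_le (B_mul b Bv0) | apply: B_le (B_mul a Bu)].
      by rewrite leq_mul2r (leq_trans br rN) orbT.
    by rewrite leq_mul2r (leq_trans (ltnW ak) kN) orbT.
  have /dvdnP[h kh] : (g %| k)%N by rewrite dvdn_gcdl.
  have h_gt0 : (0 < h)%N by move: k_gt0; rewrite kh muln_gt0 => /andP[].
  have hN : (h <= N)%N by nia.
  (* Since [k = h * g], the images of [w *+ h] and [v0] under [f2] agree, hence also under [f1]. So
     [c *+ g - f1 w] is killed by [h], and as torsion it is the image of some [v1] at bound 0. *)
  have f1w : f1 (w *+ h - v0) = 0.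
    apply/f12.
      apply: (@B_le (N * bound N + bound N)) => //; apply: B_add.
        by apply: B_le (B_mul h Bw); nia.
      by apply/B_opp/B_le/Bv0; apply: bound_mono; lia.
    by rewrite raddfB raddfMn -dg -dv0 -mulrnA mulnC -kh subrr.
  have [|| v1 Bv1 fv1] := @f1_tors h (c *+ g - f1 w); first by rewrite h_gt0.
    rewrite mulrnBl -mulrnA mulnC -kh -v0c; apply/eqP; rewrite subr_eq0 eq_sym.
    by rewrite -raddfMn -subr_eq0 -raddfB f1w.
  suff /kmin : rel g by rewrite leqNgt (leq_ltn_trans gr rk).
  split; first by rewrite g_gt0; lia.
  exists (w + v1); last by rewrite raddfD fv1 addrC subrK.
  apply: B_le (B_add Bw Bv1); have := @boundS (N - k) (N - g); nia.
- have [X Xf2] := f2_fin.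
  (* A relation of [d] with multiplier [k <= N] would make [d *+ N!] the multiple by [N! / k] of
     some [- f2 v], a member of this finite list. *)
  have [y /negP yX] := A2_inf [seq (- x) *+ j | x <- X, j <- iota 0 (N`!).+1].
  have [d dy] := A2_div y (fact_gt0 N); exists d => v k Bv kN.
  have [->|k_gt0] := posnP k.
    rewrite !mulr0n !addr0; apply: f12; apply: B_le Bv.
    by have := bound_mono (leq0n N); rewrite /extension_bound /=; lia.
  split=> /eqP; rewrite addrC addr_eq0 => /eqP re; exfalso.
    apply: norel; exists k; split; first by rewrite k_gt0.
    exists (- v); last by rewrite raddfN.
    by apply/B_opp/B_le/Bv/(bound_mono (leq0n (N - k))).
  apply: yX; apply/allpairsP; exists (f2 v, (N`! %/ k)%N); split.
  - exact: Xf2.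
  - by rewrite mem_iota /= add0n ltnS leq_div.
  - by rewrite -re -mulrnA mulnC divnK ?dy // dvdn_fact ?k_gt0.
Qed.
End Extension.

Section Torsion.
Local Open Scope ring_scope.

Definition has_order (A : zmodType) (m : nat) (t : A) : Prop :=
  forall k : nat, t *+ k = 0 <-> (m %| k)%N.

Definition generates_torsion (A : zmodType) (m : nat) (t : A) : Prop :=
  has_order m t /\ forall a, a *+ m = 0 -> exists k, a = t *+ k.

Record divisible_cyclic_torsion (A : zmodType) : Prop := DivisibleCyclicTorsion {
  dct_div : forall m (a : A), (0 < m)%N -> exists b, b *+ m = a;
  dct_gen : forall m, (0 < m)%N -> exists t : A, generates_torsion m t
}.

(** Units modulo [n] lift to units modulo a multiple [m]: by the Chinese remainder theorem take [u]
    on the part of [m] supported at the primes of [n], and 1 on the rest. Adding [m] to the solution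
    makes it positive. *)
Lemma coprime_lift n m u : (0 < m)%N -> (n %| m)%N -> coprime n u ->
  exists v, [/\ (0 < v)%N, coprime m v & v = u %[mod n]].
Proof.
move=> m_gt0 nm cnu; have n_gt0 := dvdn_gt0 m_gt0 nm.
pose m1 := (m`_\pi(n))%N; pose m2 := (m`_\pi(n)^')%N.
have m12 : (m1 * m2)%N = m by rewrite partnC.
have n_m1 : (n %| m1)%N.
  by have := partn_dvd \pi(n) m_gt0 nm; rewrite part_pnat_id ?pnat_pi.
have c12 : coprime m1 m2 by apply: coprime_partC.
pose v := (chinese m1 m2 u 1 + m)%N.
have v_gt0 : (0 < v)%N by rewrite addn_gt0 m_gt0 orbT.
have vn : v = u %[mod n].
  rewrite -(modn_dvdm v n_m1) /v -[in LHS]m12 -modnDmr modnMr addn0.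
  by rewrite (chinese_modl c12) modn_dvdm.
have cnv : coprime n v by rewrite coprime_sym -coprime_modl vn coprime_modl coprime_sym.
exists v; split=> //; rewrite -{1}m12 coprimeMl; apply/andP; split.
  by apply: (@pnat_coprime \pi(n)); [exact: part_pnat | rewrite -coprime_pi'].
rewrite coprime_sym -coprime_modl /v -[in X in (_ + X)%N]m12 -modnDmr modnMl addn0.
by rewrite (chinese_modr c12) coprime_modl coprime1n.
Qed.

(** For any generator [t0] of the [m]-torsion, [s] is [t0] times [h * u] with [u] prime to [n].
    Replacing [u] by a lift prime to [m] corrects [t0] to a generator lying over [s]; this aligns
    the torsion of two groups with their amalgamated elements. *)
Lemma generates_torsion_lift (A : zmodType) n m (s : A) : divisible_cyclic_torsion A ->
  (0 < m)%N -> (n %| m)%N -> has_order n s ->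
  exists2 t, generates_torsion m t & t *+ (m %/ n) = s.
Proof.
move=> A_good m_gt0 nm s_ord; have n_gt0 := dvdn_gt0 m_gt0 nm.
have /dvdnP[h mE] := nm; have h_gt0 : (0 < h)%N by move: m_gt0; rewrite mE muln_gt0 => /andP[].
have -> : (m %/ n)%N = h by rewrite mE mulnK.
have [t0 [t0_ord t0_gen]] := dct_gen A_good m_gt0.
have [|k sk] := t0_gen s; first by apply/s_ord.
have /dvdnP[u kE] : (h %| k)%N.
  by rewrite -(dvdn_pmul2r n_gt0) -mE; apply/t0_ord; rewrite mulrnA -sk; apply/s_ord.
have cnu : coprime n u.
  set g := gcdn n u; have g_gt0 : (0 < g)%N by rewrite gcdn_gt0 n_gt0.
  have /dvdnP[n' nE] : (g %| n)%N := dvdn_gcdl n u.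
  have /dvdnP[u' uE] : (g %| u)%N := dvdn_gcdr n u.
  have n'_gt0 : (0 < n')%N by move: n_gt0; rewrite nE muln_gt0 => /andP[].
  have /s_ord : s *+ n' = 0.
    rewrite sk -mulrnA; apply/t0_ord; rewrite mE kE uE nE; apply/dvdnP; exists u'.
    lia.
  move=> /(dvdn_leq n'_gt0); rewrite {1}nE => g1.
  by rewrite /coprime -/g; nia.
have [v [v_gt0 cmv vu]] := coprime_lift m_gt0 nm cnu.
exists (t0 *+ v); last first.
  rewrite -mulrnA sk kE; have [w [w' vw]] : exists w w', (v + w * n = u + w' * n)%N.
    exists (u %/ n)%N, (v %/ n)%N.
    move: (divn_eq v n) (divn_eq u n) vu.
    by move: (v %/ n)%N (u %/ n)%N (v %% n)%N (u %% n)%N; lia.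
  have t0m j : t0 *+ (j * n * h) = 0 by apply/t0_ord; rewrite mE -mulnA [(n * h)%N]mulnC dvdn_mull.
  by rewrite -[LHS]addr0 -(t0m w) -mulrnDr -mulnDl vw mulnDl mulrnDr t0m addr0.
split=> [j|a /t0_gen[j ->]].
  by rewrite -mulrnA -(Gauss_dvdr j cmv); apply: t0_ord.
have cvm : coprime v m by rewrite coprime_sym.
case/(coprimeP _ v_gt0): cvm => -[x y] /= xy.
exists (x * j)%N; rewrite -mulrnA mulnA [(v * x)%N]mulnC.
have -> : (x * v = 1 + y * m)%N by lia.
rewrite mulnDl mul1n mulrnDr -[LHS]addr0; congr (_ + _).
by apply/esym/t0_ord; rewrite mulnAC dvdn_mull.
Qed.
End Torsion.

(** * Linear relations with small coefficients, up to torsion *)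

Section LinearCombination.
Local Open Scope ring_scope.
Variable K : nat.
Notation vect := (int * {ffun 'I_K -> int})%type.

Definition lincomb (A : zmodType) (t : A) (a : nat -> A) (v : vect) : A :=
  t *~ v.1 + \sum_(i < K) a i *~ v.2 i.

Fact lincomb_zmod_morphism (A : zmodType) (t : A) a : zmod_morphism (lincomb t a).
Proof.
move=> u v; rewrite /lincomb /= mulrzBr opprD addrACA -sumrB; congr (_ + _).
by apply: eq_bigr => i _; rewrite !ffunE mulrzBr.
Qed.

HB.instance Definition _ (A : zmodType) (t : A) (a : nat -> A) :=
  GRing.isZmodMorphism.Build vect A (lincomb t a) (lincomb_zmod_morphism t a).

(** The coefficient [v.1] of the torsion generator is unrestricted: it matters only modulo the
    order, so bounded vectors still take finitely many values, while all small torsion is reached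
    already at bound 0. *)
Definition bounded (N : nat) (v : vect) : Prop := forall i, (`|v.2 i| <= N)%N.

Lemma bounded_le m n v : (m <= n)%N -> bounded m v -> bounded n v.
Proof. by move=> mn bv i; apply: leq_trans mn. Qed.

Lemma absz_addr_le (x y : int) m n : (`|x| <= m)%N -> (`|y| <= n)%N -> (`|(x + y)%R| <= m + n)%N.
Proof. lia. Qed.

Lemma bounded_add m n u v : bounded m u -> bounded n v -> bounded (m + n) (u + v).
Proof. by move=> bu bv i; rewrite /= ffunE; apply: absz_addr_le (bu i) (bv i). Qed.

Lemma bounded_opp m v : bounded m v -> bounded m (- v).
Proof. by move=> bv i; rewrite /= ffunE abszN. Qed.

Lemma bounded_mul m v k : bounded m v -> bounded (k * m) (v *+ k).
Proof.
move=> bv; elim: k => [|k IH]; first by rewrite mulr0n => i; rewrite /= ffunE.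
by rewrite mulrS mulSn; apply: bounded_add.
Qed.

Definition same_relations (A1 A2 : zmodType) (t1 : A1) (t2 : A2) N a1 a2 : Prop :=
  forall v, bounded N v -> lincomb t1 a1 v = 0 <-> lincomb t2 a2 v = 0.

Lemma dct_infinite (A : zmodType) : divisible_cyclic_torsion A ->
  forall X : seq A, exists y, y \notin X.
Proof.
move=> A_good X; have [t [t_ord _]] := dct_gen A_good (ltn0Sn (size X)).
apply: contrapT => noy; have allX y : y \in X.
  by apply/negPn/negP => yX; apply: noy; exists y.
have: uniq [seq t *+ k | k <- iota 0 (size X).+1].
  rewrite map_inj_in_uniq ?iota_uniq // => i j; rewrite !mem_iota !add0n /=.
  wlog ij : i j / (i <= j)%N.
    by move=> IH; case/orP: (leq_total i j) => ? iX jX e; [|symmetry]; apply: IH.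
  move=> iX jX tij; have /t_ord : t *+ (j - i) = 0 by rewrite mulrnBr // tij subrr.
  have [ji|ji] := posnP (j - i)%N; first by move=> _; lia.
  by move=> /(dvdn_leq ji); lia.
move=> /uniq_leq_size/(_ (fun y _ => allX y)); rewrite size_map size_iota.
by rewrite ltnn.
Qed.

Lemma lincomb_update (A : zmodType) (t : A) a (j : 'I_K) c v :
  lincomb t [eta a with val j |-> c] v =
  lincomb t a (v.1, [ffun i => if i == j then 0 else v.2 i]) + c *~ v.2 j.
Proof.
rewrite /lincomb /= -addrA; congr (_ + _).
rewrite (bigD1 j) // [in RHS](bigD1 j) //= eqxx ffunE eqxx mulr0z add0r addrC.
congr (_ + _); apply: eq_bigr => i ij.
by rewrite ffunE (negPf ij) (inj_eq val_inj) (negPf ij).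
Qed.

Lemma bounded_lincomb_fin (A : zmodType) M (t : A) a N : (0 < M)%N -> has_order M t ->
  exists X : seq A, forall v, bounded N v -> lincomb t a v \in X.
Proof.
move=> M_gt0 t_ord.
pose w (p : 'I_M * {ffun 'I_K -> 'I_(N + N).+1}) : vect :=
  ((p.1 : nat)%:Z, [ffun i => (p.2 i : nat)%:Z - N%:Z]).
exists [seq lincomb t a (w p) | p : 'I_M * {ffun 'I_K -> 'I_(N + N).+1}] => -[k v] bv.
have M0 : M%:Z != 0 by lia.
have kM : (`|(k %% M)%Z| < M)%N.
  by have := modz_ge0 k M0; have := ltz_pmod k (_ : 0 < M%:Z); lia.
apply/mapP; exists (Ordinal kM, [ffun i => inord `|v i + N|]); rewrite ?mem_enum //.
rewrite /lincomb /=; congr (_ + _).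
  rewrite gez0_abs ?modz_ge0 // [in LHS](divz_eq k M) mulrzDr.
  have tM : t *~ M = 0 by rewrite -pmulrn; apply/t_ord.
  by rewrite mulrC mulrzA tM mul0rz add0r.
apply: eq_bigr => i _; rewrite !ffunE inordK.
  by have := bv i; rewrite /= => ?; congr (_ *~ _); lia.
by have := bv i; rewrite /= ; lia.
Qed.

Lemma dvd_torsion (A : zmodType) M (t : A) N : (forall k, (0 < k <= N)%N -> (k %| M)%N) ->
  generates_torsion M t ->
  forall k a, (0 < k <= N)%N -> a *+ k = 0 -> exists n, a = t *+ n.
Proof.
move=> NM [_ t_gen] k a kN ak; apply: t_gen.
have /dvdnP[q ->] : (k %| M)%N by apply: NM.
by rewrite mulnC mulrnA ak mul0rn.
Qed.

Lemma same_relations_extend (A1 A2 : zmodType) (t1 : A1) (t2 : A2) M N a1 a2 :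
  divisible_cyclic_torsion A2 -> (0 < M)%N -> (forall k, (0 < k <= N)%N -> (k %| M)%N) ->
  generates_torsion M t1 -> generates_torsion M t2 ->
  same_relations t1 t2 (extension_bound N) a1 a2 ->
  forall j (c : A1), (j < K)%N -> exists d : A2,
  same_relations t1 t2 N [eta a1 with j |-> c] [eta a2 with j |-> d].
Proof.
move=> A2_good M_gt0 NM t1_gen t2_gen a12 j c jK.
have [||||d dP] := @extend vect A1 A2 (lincomb t1 a1) (lincomb t2 a2) bounded
  bounded_le bounded_add bounded_opp bounded_mul N _ _ _ _ c a12.
- move=> k a kN /(dvd_torsion NM t1_gen kN)[n ->]; exists (n%:Z, 0).
    by move=> i; rewrite /= ffunE.
  by rewrite /= /lincomb big1 ?addr0 // => i _; rewrite ffunE.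
- exact: dct_div.
- exact: dct_infinite.
- by apply: bounded_lincomb_fin (proj1 t2_gen).
pose jo := Ordinal jK; exists d.
(* [extend] treats natural multiples of [c]; a negative coefficient is handled by negating the whole
   relation. *)
have main (v : vect) : 0 <= v.2 jo -> bounded N v ->
    lincomb t1 [eta a1 with j |-> c] v = 0 <-> lincomb t2 [eta a2 with j |-> d] v = 0.
  move=> v0 bv; rewrite (lincomb_update t1 a1 jo) (lincomb_update t2 a2 jo).
  have -> : v.2 jo = (`|v.2 jo|)%N :> int by rewrite gez0_abs.
  apply: dP; last exact: bv.
  by move=> i; rewrite /= ffunE; case: ifP.
move=> v bv; have [v0|v0] : 0 <= v.2 jo \/ v.2 jo < 0 by lia.
  exact: main.
have [|H1 H2] := main (- v) _ (bounded_opp bv); first by rewrite /= ffunE oppr_ge0 ltW.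
rewrite !raddfN in H1 H2; split=> /eqP; rewrite -oppr_eq0 => /eqP ?; apply/eqP;
  rewrite -oppr_eq0; apply/eqP; [exact: H1 | exact: H2].
Qed.
End LinearCombination.

(** * Elementary equivalence of central products *)

Section CentralProduct.
Local Open Scope group_scope.

(* [H] is a central product of [S] and the additively written group [A], amalgamated along
   the cyclic groups generated by [z] and [c]. *)
Record central_product (S : groupType) (z : S) (n : nat) (A : zmodType) (H : groupType)
    (f : S -> H) (g : A -> H) (c : A) : Prop := CentralProduct {
  cp_mul : {morph f : x y / x * y};
  cp_add : {morph g : a b / (a + b)%R >-> a * b};
  cp_comm : forall x a, commute (f x) (g a);
  cp_surj : forall h, exists x a, h = f x * g a;
  cp_order : has_order n c;
  cp_ker : forall x a, f x * g a = 1 <-> exists k, x = z ^+ k /\ a = (- (c *+ k))%R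
}.

Fixpoint max_var_term (t : group_term) : nat :=
  match t with
  | GVar i => i.+1
  | GOne => 0
  | GMul t u => maxn (max_var_term t) (max_var_term u)
  | GInv t => max_var_term t
  end.

Fixpoint max_var (f : formula group_term) : nat :=
  match f with
  | Falsum => 0
  | Equals t u => maxn (max_var_term t) (max_var_term u)
  | Conj f g | Disj f g | Impl f g => maxn (max_var f) (max_var g)
  | Forall i f | Exists i f => maxn i.+1 (max_var f)
  end.

Fixpoint exponent (t : group_term) (i : nat) : int :=
  match t with
  | GVar j => (i == j)%:Z
  | GOne => 0
  | GMul t u => exponent t i + exponent u i
  | GInv t => - exponent t i
  end%R.

Fixpoint term_size (t : group_term) : nat :=
  match t with
  | GVar _ => 1
  | GOne => 0
  | GMul t u => term_size t + term_size u
  | GInv t => term_size t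
  end.

Lemma exponent_le t i : (`|exponent t i| <= term_size t)%N.
Proof. by elim: t => [j||t IHt u IHu|t IHt] /=; try case: eqP => //; lia. Qed.

Section OneSide.
Variables (S : groupType) (z : S) (n : nat) (A : zmodType) (H : groupType).
Variables (f : S -> H) (g : A -> H) (c : A).
Hypothesis cp : central_product z n f g c.
Let fM := cp_mul cp.
Let gD := cp_add cp.

Lemma cp_one : f 1 = 1.
Proof. by apply: (mulgI (f 1)); rewrite -fM !mulg1. Qed.

Lemma cp_zero : g 0%R = 1.
Proof. by apply: (mulgI (g 0%R)); rewrite -gD addr0 mulg1. Qed.

Lemma cp_inv x : f x^-1 = (f x)^-1.
Proof. by apply: (mulgI (f x)); rewrite -fM !mulgV cp_one. Qed.

Lemma cp_opp a : g (- a)%R = (g a)^-1.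
Proof. by apply: (mulgI (g a)); rewrite -gD subrr mulgV cp_zero. Qed.

Lemma cp_mulE x a y b : (f x * g a) * (f y * g b) = f (x * y) * g (a + b)%R.
Proof.
rewrite fM gD !mulgA; congr (_ * _); rewrite -!mulgA; congr (_ * _).
exact/commute_sym/(cp_comm cp).
Qed.

Lemma cp_invE x a : (f x * g a)^-1 = f x^-1 * g (- a)%R.
Proof. by rewrite invgM -cp_inv -cp_opp -(cp_comm cp). Qed.

Lemma cp_eval K (e : nat -> H) (s : nat -> S) (a : nat -> A) :
  (forall i, (i < K)%N -> e i = f (s i) * g (a i)) ->
  forall t, (max_var_term t <= K)%N ->
  group_eval e t = f (group_eval s t) * g (\sum_(i < K) a i *~ exponent t i)%R.
Proof.
move=> eE; elim=> [j||t IHt u IHu|t IHt] /=.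
- move=> jK; rewrite eE //; congr (_ * g _).
  rewrite (bigD1 (Ordinal jK)) //= eqxx mulr1z big1 ?addr0 // => i.
  by rewrite -val_eqE /= => /negPf->; rewrite mulr0z.
- by rewrite cp_one big1 ?cp_zero ?mulg1 // => i _; rewrite mulr0z.
- rewrite geq_max => /andP[/IHt-> /IHu->]; rewrite cp_mulE -big_split /=.
  by congr (_ * g _); apply: eq_bigr => i _; rewrite mulrzDr.
- move=> /IHt->; rewrite cp_invE; congr (_ * g _).
  by rewrite -sumrN; apply: eq_bigr => i _; rewrite mulrNz.
Qed.

(** Because [g] has central image, an equation splits into one in [S], up to a power of [z], and a
    linear relation in [A] whose coefficients are differences of exponents. The power of [z] is
    absorbed by a multiple of the torsion generator [d]. *)
Lemma cp_eq K (M : nat) (d : A) (e : nat -> H) (s : nat -> S) (a : nat -> A) :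
  generates_torsion M d -> (d *+ (M %/ n))%R = c ->
  (forall i, (i < K)%N -> e i = f (s i) * g (a i)) ->
  forall t u, (max_var_term t <= K)%N -> (max_var_term u <= K)%N ->
  group_eval e t = group_eval e u <->
  exists k : nat, group_eval s t * (group_eval s u)^-1 = z ^+ k /\
    lincomb d a ((k * (M %/ n))%:Z, [ffun i : 'I_K => exponent t i - exponent u i])%R = 0%R.
Proof.
move=> d_gen dc eE t u tK uK; rewrite (cp_eval eE tK) (cp_eval eE uK).
set p := group_eval s t; set q := group_eval s u.
set a1 := (\sum_(i < K) _)%R; set a2 := (\sum_(i < K) _)%R.
have -> : f p * g a1 = f q * g a2 <-> f (p * q^-1) * g (a1 - a2)%R = 1.
  rewrite -cp_mulE -cp_invE; split=> [->|/divg1_eq //]; exact: mulgV.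
rewrite (cp_ker cp).
have kE k : lincomb d a ((k * (M %/ n))%:Z, [ffun i : 'I_K => exponent t i - exponent u i])%R
    = ((a1 - a2) + c *+ k)%R.
  rewrite /lincomb /= addrC; congr (_ + _)%R.
    by rewrite -sumrB; apply: eq_bigr => i _; rewrite ffunE mulrzBr.
  by rewrite -dc -pmulrn -mulrnA mulnC.
split=> -[k [-> ak]]; exists k; split=> //.
  by rewrite kE ak addNr.
by move/eqP: ak; rewrite kE addr_eq0 => /eqP.
Qed.
End OneSide.

Section Forth.
Variables (S : groupType) (K n : nat).
Variables (A1 : zmodType) (H1 : groupType) (f1 : S -> H1) (g1 : A1 -> H1) (c1 : A1).
Variables (A2 : zmodType) (H2 : groupType) (f2 : S -> H2) (g2 : A2 -> H2) (c2 : A2).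

(** As [c1] and [c2] are the same multiple of [d1] and [d2], matching these generators also respects
    the amalgamation. *)
Record torsion_level (N M : nat) (d1 : A1) (d2 : A2) : Prop := TorsionLevel {
  tl_pos : (0 < M)%N;
  tl_dvd : forall k, (0 < k <= N)%N -> (k %| M)%N;
  tl_gen1 : generates_torsion M d1;
  tl_gen2 : generates_torsion M d2;
  tl_eq1 : (d1 *+ (M %/ n))%R = c1;
  tl_eq2 : (d2 *+ (M %/ n))%R = c2
}.

Definition indistinguishable N d1 d2 (e1 : nat -> H1) (e2 : nat -> H2) : Prop :=
  exists s a1 a2,
  [/\ forall i, (i < K)%N -> e1 i = f1 (s i) * g1 (a1 i),
      forall i, (i < K)%N -> e2 i = f2 (s i) * g2 (a2 i)
    & same_relations K d1 d2 N a1 a2].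

Lemma torsion_level_le N N' M d1 d2 : (N <= N')%N ->
  torsion_level N' M d1 d2 -> torsion_level N M d1 d2.
Proof.
move=> NN' [? NM *]; split=> // k /andP[k0 kN].
by rewrite NM // k0 (leq_trans kN).
Qed.

Lemma indistinguishable_le N N' d1 d2 e1 e2 : (N <= N')%N ->
  indistinguishable N' d1 d2 e1 e2 -> indistinguishable N d1 d2 e1 e2.
Proof.
move=> NN' [s [a1 [a2 [e1E e2E a12]]]]; exists s, a1, a2; split=> // v bv.
exact/a12/(bounded_le NN').
Qed.

Lemma extension_bound_ge N : (N <= extension_bound N)%N.
Proof. by rewrite (leq_trans (bound_mono N (leq0n N))) // leq_addl. Qed.

Hypothesis f1g1_surj : forall h, exists x a, h = f1 x * g1 a.
Hypothesis A2_good : divisible_cyclic_torsion A2.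

Lemma forth N M d1 d2 e1 e2 : torsion_level N M d1 d2 ->
  indistinguishable (extension_bound N) d1 d2 e1 e2 ->
  forall j x, (j < K)%N -> exists y,
  indistinguishable N d1 d2 [eta e1 with j |-> x] [eta e2 with j |-> y].
Proof.
move=> [M_gt0 NM gen1 gen2 _ _] [s [a1 [a2 [e1E e2E a12]]]] j x jK.
have [r [a xE]] := f1g1_surj x.
have [b ab] := same_relations_extend A2_good M_gt0 NM gen1 gen2 a12 a jK.
exists (f2 r * g2 b), [eta s with j |-> r], [eta a1 with j |-> a], [eta a2 with j |-> b].
by split=> // i iK /=; case: eqP => // _; [exact: e1E | exact: e2E].
Qed.
End Forth.

Lemma torsion_level_sym n A1 c1 A2 c2 N M d1 d2 :
  @torsion_level n A1 c1 A2 c2 N M d1 d2 -> @torsion_level n A2 c2 A1 c1 N M d2 d1.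
Proof. by case. Qed.

Lemma indistinguishable_sym S K A1 H1 f1 g1 A2 H2 f2 g2 N d1 d2 e1 e2 :
  @indistinguishable S K A1 H1 f1 g1 A2 H2 f2 g2 N d1 d2 e1 e2 ->
  @indistinguishable S K A2 H2 f2 g2 A1 H1 f1 g1 N d2 d1 e2 e1.
Proof.
case=> s [a1 [a2 [e1E e2E a12]]]; exists s, a2, a1; split=> // v bv.
by split=> /a12; apply.
Qed.

Section TwoSides.
Variables (S : groupType) (z : S) (n : nat).
Variables (A1 : zmodType) (H1 : groupType) (f1 : S -> H1) (g1 : A1 -> H1) (c1 : A1).
Variables (A2 : zmodType) (H2 : groupType) (f2 : S -> H2) (g2 : A2 -> H2) (c2 : A2).
Hypothesis n_gt0 : (0 < n)%N.
Hypotheses (cp1 : central_product z n f1 g1 c1) (cp2 : central_product z n f2 g2 c2).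
Hypotheses (A1_good : divisible_cyclic_torsion A1) (A2_good : divisible_cyclic_torsion A2).

(** The bound [N] depends on the formula alone: term sizes suffice for an equation, and a quantifier
    replaces [N] by [extension_bound N]. Therefore the torsion level [M] may be chosen
    afterwards. *)
Lemma indistinguishable_holds K (f : formula group_term) : (max_var f <= K)%N ->
  exists N, forall M d1 d2 e1 e2, torsion_level n c1 c2 N M d1 d2 ->
  indistinguishable K f1 g1 f2 g2 N d1 d2 e1 e2 ->
  holds (@group_eval H1) e1 f <-> holds (@group_eval H2) e2 f.
Proof.
have split_max N1 N2 M d1 d2 e1 e2 : torsion_level n c1 c2 (maxn N1 N2) M d1 d2 ->
    indistinguishable K f1 g1 f2 g2 (maxn N1 N2) d1 d2 e1 e2 ->
    [/\ torsion_level n c1 c2 N1 M d1 d2, indistinguishable K f1 g1 f2 g2 N1 d1 d2 e1 e2,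
      torsion_level n c1 c2 N2 M d1 d2 & indistinguishable K f1 g1 f2 g2 N2 d1 d2 e1 e2].
  have [m1 m2] := (leq_maxl N1 N2, leq_maxr N1 N2).
  move=> tl ind; split; [exact: torsion_level_le tl | exact: indistinguishable_le ind |
    exact: torsion_level_le tl | exact: indistinguishable_le ind].
elim: f => [|t u|p IHp q IHq|p IHp q IHq|p IHp q IHq|j p IHp|j p IHp] /=.
- by move=> _; exists 0.
- rewrite geq_max => /andP[tK uK]; exists (term_size t + term_size u)%N.
  move=> M d1 d2 e1 e2 [_ _ gen1 gen2 dc1 dc2] [s [a1 [a2 [e1E e2E a12]]]].
  rewrite (cp_eq cp1 gen1 dc1 e1E tK uK) (cp_eq cp2 gen2 dc2 e2E tK uK).
  have tu k : bounded (term_size t + term_size u)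
      ((k * (M %/ n))%:Z, [ffun i : 'I_K => exponent t i - exponent u i])%R.
    move=> i /=; rewrite ffunE; apply: absz_addr_le; rewrite ?abszN; exact: exponent_le.
  by split=> -[k [pk ak]]; exists k; split=> //; apply/a12.
1-3: rewrite geq_max => /andP[/IHp[N1 HN1] /IHq[N2 HN2]]; exists (maxn N1 N2);
  move=> M d1 d2 e1 e2 tl /(split_max _ _ _ _ _ _ _ tl)[tl1 /(HN1 _ _ _ _ _ tl1) ?];
  move=> tl2 /(HN2 _ _ _ _ _ tl2) ?; tauto.
- rewrite geq_max => /andP[jK /IHp[N HN]]; exists (extension_bound N).
  move=> M d1 d2 e1 e2 tl ind.
  have {}tl := torsion_level_le (extension_bound_ge N) tl.
  split=> H x.
    have [y xy] := forth (cp_surj cp2) A1_good (torsion_level_sym tl)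
      (indistinguishable_sym ind) x jK.
    by apply/(HN _ _ _ _ _ tl (indistinguishable_sym xy)).
  have [y xy] := forth (cp_surj cp1) A2_good tl ind x jK.
  by apply/(HN _ _ _ _ _ tl xy).
- rewrite geq_max => /andP[jK /IHp[N HN]]; exists (extension_bound N).
  move=> M d1 d2 e1 e2 tl ind.
  have {}tl := torsion_level_le (extension_bound_ge N) tl.
  split=> -[x Hx].
    have [y xy] := forth (cp_surj cp1) A2_good tl ind x jK.
    by exists y; apply/(HN _ _ _ _ _ tl xy).
  have [y xy] := forth (cp_surj cp2) A1_good (torsion_level_sym tl)
      (indistinguishable_sym ind) x jK.
  by exists y; apply/(HN _ _ _ _ _ tl (indistinguishable_sym xy)).
Qed.

Lemma has_order_int (A : zmodType) m (t : A) (k : int) : has_order m t ->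
  (t *~ k)%R = 0%R <-> (m %| `|k|)%N.
Proof.
move=> t_ord; rewrite -t_ord; case: k => k; first by [].
rewrite NegzE mulrNz abszN.
by split=> [/eqP|tk0]; [rewrite oppr_eq0 => /eqP | rewrite -pmulrn tk0 oppr0].
Qed.

Lemma central_product_equiv : H1 ≡g H2.
Proof.
move=> f sf; suff main e1 e2 : holds (@group_eval H1) e1 f <-> holds (@group_eval H2) e2 f.
  by split=> H e; [apply/(main (fun=> 1)) | apply/(main _ (fun=> 1))].
have const (G : groupType) (e : nat -> G) :
    holds (@group_eval G) e f <-> holds (@group_eval G) (fun=> 1) f.
  apply: (holds_eq_in (tv := group_term_vars)); last by move=> i; rewrite sf.
  exact: group_eval_eq_in.
rewrite (const _ e1) (const _ e2).
have [N HN] := indistinguishable_holds (leqnn (max_var f)).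
(* The factor [n] lets generators lie over [c1] and [c2]; the factorial makes every order up to [N]
   divide [M]. *)
pose M := (n * N`!)%N; have M_gt0 : (0 < M)%N by rewrite muln_gt0 n_gt0 fact_gt0.
have nM : (n %| M)%N by rewrite dvdn_mulr.
have [d1 gen1 dc1] := generates_torsion_lift A1_good M_gt0 nM (cp_order cp1).
have [d2 gen2 dc2] := generates_torsion_lift A2_good M_gt0 nM (cp_order cp2).
apply: (HN M d1 d2).
  by split=> // k kN; rewrite dvdn_mull // dvdn_fact.
(* At the trivial valuation a linear relation only involves the torsion generators, both of order
   [M]. *)
exists (fun=> 1), (fun=> 0%R), (fun=> 0%R); split=> [i _|i _|v _].
- by rewrite (cp_one cp1) (cp_zero cp1) mulg1.
- by rewrite (cp_one cp2) (cp_zero cp2) mulg1.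
rewrite /lincomb !big1 ?addr0; try by move=> i _; rewrite mul0rz.
by rewrite (has_order_int _ (proj1 gen1)) (has_order_int _ (proj1 gen2)).
Qed.
End TwoSides.
End CentralProduct.

(** * Centers *)

Local Open Scope group_scope.

Definition central (G : groupType) (z : G) : Prop := forall y, commute z y.

Lemma definable_central (C : context) (t : forall G : groupType, C G -> G) : definable_term t ->
  definable (C := C) (fun G c => central (t G c)).
Proof.
move=> dt; have {}dt := definable_weaken unit dt.
by apply: definable_forall1; apply: definable_eq; apply: definable_termM => //;
  exact: definable_var.
Qed.

Section AdditiveCenter.
Variable G : groupType.

(** A second name for the center, so that its additive structure is kept apart from the
    multiplicative one. *)
Definition additive_center : Type := center G.
HB.instance Definition _ := SubChoice.on additive_center.

Lemma center_commute (a : center G) y : commute (val a) y.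
Proof. by have /asboolP := valP a. Qed.

Fact center_mulC : @commutative (center G) (center G) *%g.
Proof. by move=> a b; apply: val_inj; apply: center_commute. Qed.

HB.instance Definition _ := GRing.isZmodule.Build additive_center
  (@mulgA (center G)) center_mulC (@mul1g (center G)) (@mulVg (center G)).

Lemma val_mulrn (a : additive_center) k : val (a *+ k)%R = val a ^+ k :> G.
Proof.
elim: k => [|k IH]; first by rewrite mulr0n.
by rewrite mulrS expgS -IH.
Qed.

Lemma central_center (z : G) : central z -> exists a : additive_center, val a = z.
Proof.
move=> cz; have zC : z \in @center_pred G by apply/asboolP.
by exists (Sub z zC : center G); rewrite SubK.
Qed.

(** For fixed [m] the exponents range over the finite type ['I_m], so this is a first-order
    property. *)
Definition center_generator m (c : G) : Prop :=
  central c /\ c ^+ m = 1 /\ (forall k : 'I_m, (0 < k)%N -> c ^+ k <> 1) /\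
  forall z, central z -> z ^+ m = 1 -> exists k : 'I_m, z = c ^+ k.

Definition center_divisible m : Prop :=
  forall z : G, central z -> exists w, central w /\ w ^+ m = z.

Definition good_center : Prop := forall m, (0 < m)%N ->
  center_divisible m /\ exists c, center_generator m c.

Lemma generates_center m (c : additive_center) : (0 < m)%N ->
  center_generator m (val c) -> generates_torsion m c.
Proof.
move=> m_gt0 [_ [cm [ck cgen]]]; split=> [k|a am].
  have -> : (c *+ k)%R = 0%R <-> val c ^+ k = 1.
    by rewrite -val_mulrn; split=> [->|c0] //; apply: val_inj.
  rewrite /dvdn {1}(divn_eq k m) expgnDr [(_ * m)%N]mulnC expgnA cm expg1n mul1g.
  set r := (k %% m)%N.
  have rm : (r < m)%N by rewrite ltn_mod.
  have [->//|r_gt0] := posnP r.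
  by split=> [/(ck (Ordinal rm) r_gt0)|/eqP r0]; lia.
have [|k ak] := cgen (val a) (center_commute a).
  by rewrite -val_mulrn am.
by exists k; apply: val_inj; rewrite [RHS]val_mulrn.
Qed.

Lemma good_center_dct : good_center -> divisible_cyclic_torsion additive_center.
Proof.
move=> Gc; split=> [m a m_gt0|m m_gt0]; have [Gdiv [c cgen]] := Gc m m_gt0.
  have [w [/central_center[b <-] ba]] := Gdiv (val a) (center_commute a).
  by exists b; apply: val_inj; rewrite [LHS]val_mulrn.
have [d dc] := central_center (proj1 cgen); exists d.
by apply: generates_center => //; rewrite dc.
Qed.
End AdditiveCenter.

Lemma good_center_transfer (G H : groupType) : G ≡g H -> good_center G -> good_center H.
Proof.
move=> GH Gc m m_gt0.
apply: (definable_transfer (P := fun G => center_divisible G m /\ exists c, center_generator m c))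
  GH _ (Gc m m_gt0).
by repeat first [apply: definable_central | definable_step].
Qed.

(** * Bounded generation by transvections *)

Section Elementary.
Local Open Scope ring_scope.

HB.instance Definition _ (R : nzRingType) n := Monoid.isLaw.Build 'M[R]_n 1%:M mulmx
  (@mulmxA R n n n n) (@mul1mx R n n) (@mulmx1 R n n).

Definition transvection (K : nzRingType) n (p : 'I_n * 'I_n) (a : K) : 'M[K]_n :=
  1%:M + a *: delta_mx p.1 p.2.

Definition elementary_product (K : nzRingType) n (s : seq ('I_n * 'I_n * K)) : 'M[K]_n :=
  \big[mulmx/1%:M]_(x <- s) transvection x.1 x.2.

Definition short_product (K : nzRingType) n c (A : 'M[K]_n) : Prop :=
  exists s : seq ('I_n * 'I_n * K),
    [/\ (size s <= c)%N, all (fun x => x.1.1 != x.1.2) s & A = elementary_product s].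

Variable K : fieldType.

Lemma delta_mulmx n (i j k l : 'I_n) : j != k ->
  delta_mx i j *m delta_mx k l = 0 :> 'M[K]_n.
Proof. by move=> jk; rewrite mul_delta_mx_cond (negPf jk) mulr0n. Qed.

Lemma transvectionD n (p : 'I_n * 'I_n) (a b : K) : p.1 != p.2 ->
  transvection p a *m transvection p b = transvection p (a + b).
Proof.
move=> p12; rewrite /transvection mulmxDl mul1mx mulmxDr mulmx1.
rewrite -scalemxAl -scalemxAr delta_mulmx 1?eq_sym // !scaler0 addr0.
by rewrite -addrA -scalerDl [b + a]addrC.
Qed.

Lemma transvection0 n (p : 'I_n * 'I_n) : transvection p (0 : K) = 1%:M.
Proof. by rewrite /transvection scale0r addr0. Qed.

Lemma det_transvection n (p : 'I_n * 'I_n) (a : K) : p.1 != p.2 -> \det (transvection p a) = 1.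
Proof.
wlog: p / (p.2 < p.1)%N => [IH p12|p21 _].
  case: (ltngtP p.2 p.1) => [/IH->//|p12'|/val_inj/eqP]; last by rewrite eq_sym (negPf p12).
  have -> : transvection p a = (transvection (p.2, p.1) a)^T.
    by rewrite /transvection linearD linearZ /= trmx1 trmx_delta.
  by rewrite det_tr IH //= eq_sym.
rewrite det_trig; last first.
  apply/is_trig_mxP => i j ij; rewrite !mxE -!val_eqE /= (ltn_eqF ij) add0r.
  by case: eqP => //= [ip|_]; [case: eqP => [jp|_] |]; rewrite ?mulr0 //; lia.
rewrite big1 // => i _; rewrite !mxE eqxx -!val_eqE /=.
by case: eqP => //= [ip|_]; [case: eqP => [jp|_] |]; rewrite ?mulr0 ?addr0 //; lia.
Qed.

Lemma short_productW n c d (A : 'M[K]_n) : (c <= d)%N -> short_product c A -> short_product d A.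
Proof. by move=> cd [s [sc sv ->]]; exists s; split=> //; apply: leq_trans cd. Qed.

Lemma short_product1 n : short_product 0 (1%:M : 'M[K]_n).
Proof. by exists [::]; rewrite /elementary_product big_nil. Qed.

Lemma short_product_mul n c d (A B : 'M[K]_n) :
  short_product c A -> short_product d B -> short_product (c + d) (A *m B).
Proof.
move=> [s [sc sv ->]] [t [td tv ->]]; exists (s ++ t).
by rewrite size_cat leq_add // all_cat sv tv /elementary_product big_cat.
Qed.

Lemma short_product_transvection n p (a : K) : p.1 != p.2 ->
  short_product 1 (transvection p a : 'M[K]_n).
Proof.
by move=> p12; exists [:: (p, a)]; rewrite /elementary_product big_seq1 /= p12.
Qed.

Lemma short_product_cancel n c p (a : K) (A : 'M[K]_n) : p.1 != p.2 ->
  short_product c (transvection p a *m A) -> short_product c.+1 A.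
Proof.
move=> p12 sA; have -> : A = transvection p (- a) *m (transvection p a *m A).
  by rewrite mulmxA transvectionD // addNr transvection0 mul1mx.
exact: (short_product_mul (short_product_transvection _ p12) sA).
Qed.

(** No column index of the family is a row index, so all products of the matrix units vanish and
    only the linear terms survive. *)
Lemma transvection_family n (I : Type) (r : seq I) (F : I -> 'I_n * 'I_n) (a : I -> K) :
  (forall i j, (F i).2 != (F j).1) ->
  elementary_product [seq (F i, a i) | i <- r] =
  1%:M + \sum_(i <- r) a i *: delta_mx (F i).1 (F i).2.
Proof.
move=> Fij; rewrite /elementary_product big_map /=.
elim: r => [|i r IH]; first by rewrite !big_nil addr0.
have F0 : a i *: delta_mx (F i).1 (F i).2 *m
    (\sum_(j <- r) a j *: delta_mx (F j).1 (F j).2) = 0 :> 'M[K]_n.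
  rewrite mulmx_sumr big1 // => j _.
  by rewrite -scalemxAl -scalemxAr delta_mulmx ?scaler0.
rewrite !big_cons IH /transvection mulmxDl mul1mx mulmxDr mulmx1 F0 addr0.
by rewrite addrAC addrA.
Qed.

Lemma short_product_col n (c : 'cV[K]_n) :
  short_product n (block_mx 1%:M 0 c 1%:M : 'M[K]_(1 + n)).
Proof.
exists [seq ((rshift 1 i, lshift n (0 : 'I_1)), c i 0) | i <- enum 'I_n]; split.
- by rewrite size_map size_enum_ord.
- by apply/allP => _ /mapP[i _ ->].
rewrite transvection_family; last by move=> i j; rewrite eq_lrshift.
rewrite (scalar_mx_block 1 n 1); apply/matrixP => i j; rewrite [RHS]mxE summxE.
case: (split_ordP i) => i' ->; case: (split_ordP j) => j' ->;
rewrite ?(block_mxEul, block_mxEur, block_mxEdl, block_mxEdr).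
- by rewrite big1 ?addr0 // => k _; rewrite !mxE eq_shift mulr0.
- by rewrite big1 ?addr0 // => k _; rewrite !mxE eq_shift mulr0.
- rewrite mxE add0r big_enum (bigD1 i') //= big1 => [|k ki].
    by rewrite !mxE !eqxx /= (ord1 j') eqxx addr0 mulr1.
  by rewrite !mxE eq_shift eq_sym (negPf ki) mulr0.
- by rewrite big1 ?addr0 // => k _; rewrite !mxE !eq_shift andbF mulr0.
Qed.

Lemma short_product_block n c (D : 'M[K]_n) : short_product c D ->
  short_product c (block_mx 1%:M 0 0 D : 'M[K]_(1 + n)).
Proof.
move=> [s [sc sv ->]]; exists [seq ((rshift 1 x.1.1, rshift 1 x.1.2), x.2) | x <- s].
rewrite size_map; split=> //; first by rewrite all_map; apply: sub_all sv.
rewrite /elementary_product big_map; elim: s {sc sv} => [|x s IH].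
  by rewrite !big_nil -scalar_mx_block.
rewrite !big_cons /= -IH.
have -> : transvection (rshift 1 x.1.1, rshift 1 x.1.2) x.2 =
    block_mx 1%:M 0 0 (transvection x.1 x.2).
  rewrite /transvection [in LHS]scalar_mx_block /=.
  have -> : delta_mx (rshift 1 x.1.1) (rshift 1 x.1.2) =
      block_mx 0 0 0 (delta_mx x.1.1 x.1.2) :> 'M[K]_(1 + n).
    apply/matrixP => i j.
    case: (split_ordP i) => i' ->; case: (split_ordP j) => j' ->;
    by rewrite ?(block_mxEul, block_mxEur, block_mxEdl, block_mxEdr) !mxE !eq_shift ?andbF.
  by rewrite scale_block_mx !scaler0 add_block_mx !addr0.
by rewrite mulmx_block !mul0mx !mulmx0 !mul1mx !addr0 add0r.
Qed.

Lemma short_product_tr n c (A : 'M[K]_n) : short_product c A -> short_product c A^T.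
Proof.
move=> [s [sc sv ->]]; exists (rev [seq ((x.1.2, x.1.1), x.2) | x <- s]).
rewrite size_rev size_map all_rev all_map; split=> //.
  by apply: sub_all sv => x /=; rewrite eq_sym.
rewrite /elementary_product; elim: s {sc sv} => [|x s IH].
  by rewrite !big_nil trmx1.
rewrite big_cons trmx_mul IH /= rev_cons -cats1 big_cat big_seq1 /=; congr (_ *m _).
by rewrite /transvection linearD linearZ /= trmx1 trmx_delta.
Qed.

(** Two factors produce a corner entry 1, [m] each clear the column and the row next to it, and the
    rest serves the remaining block. *)
Fixpoint SL_width (n : nat) : nat :=
  if n is m.+1 then (m + (SL_width m + m)).+2 else 0.

Lemma short_product_corner n (A : 'M[K]_(1 + n)) :
  (forall D : 'M[K]_n, \det D = 1 -> short_product (SL_width n) D) ->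
  A 0 0 = 1 -> \det A = 1 -> short_product (n + (SL_width n + n)) A.
Proof.
move=> IH A00 detA; set r := ursubmx A; set c := dlsubmx A.
pose D := drsubmx A - c *m r.
have AE : A = block_mx 1%:M 0 c 1%:M *m (block_mx 1%:M 0 0 D *m block_mx 1%:M r 0 1%:M).
  rewrite !mulmx_block !mul0mx !mulmx0 !mul1mx !mulmx1 !addr0 !add0r.
  rewrite addrC subrK -[LHS]submxK; congr block_mx.
  by apply/matrixP => i j; rewrite !ord1 !mxE eqxx -A00; congr (A _ _); apply: val_inj.
  by rewrite mulmx1.
have detD : \det D = 1.
  by rewrite -detA AE !det_mulmx !det_lblock det_ublock !det1 !mul1r mulr1.
rewrite AE; apply: short_product_mul; first exact: short_product_col.
apply: short_product_mul; first exact/short_product_block/IH.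
have -> : block_mx 1%:M r 0 1%:M = (block_mx 1%:M 0 r^T 1%:M)^T :> 'M[K]_(1 + n).
  by rewrite tr_block_mx trmxK trmx0 !trmx1.
exact/short_product_tr/short_product_col.
Qed.

Lemma SL_short_product n (A : 'M[K]_n) : \det A = 1 -> short_product (SL_width n) A.
Proof.
elim: n A => [|n IH] A detA.
  by rewrite (flatmx0 A) -(flatmx0 1%:M); exact: short_product1.
have pivot (B : 'M[K]_n.+1) i : i != 0 -> B i 0 != 0 -> \det B = 1 ->
    short_product (n + (SL_width n + n)).+1 B.
  move=> i0 Bi0 detB.
  (* Adding this multiple of row [i] to row 0 turns the corner entry into 1. *)
  apply: (@short_product_cancel _ _ (0, i) ((1 - B 0 0) / B i 0)); first by rewrite eq_sym.
  apply: (@short_product_corner n); first exact: IH.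
    rewrite mulmxDl mul1mx -scalemxAl !mxE (bigD1 i) //= big1 => [|k ki].
      by rewrite !mxE !eqxx mul1r addr0 divfK // addrC subrK.
    by rewrite !mxE eqxx (negPf ki) mul0r.
  by rewrite det_mulmx detB mulr1 det_transvection // eq_sym.
have [i /andP[i0 Ai0]|noi] := pickP (fun i : 'I_n.+1 => (i != 0) && (A i 0 != 0)).
  by apply: short_productW (pivot A i i0 Ai0 detA); rewrite /= leqnSn.
have A00 : A 0 0 != 0.
  apply/eqP => A00; move/eqP: detA; rewrite (expand_det_col A 0) big1.
    by rewrite eq_sym oner_eq0.
  move=> i _.
  have := noi i; have [->|_ /= /negbFE/eqP->] := eqVneq i 0; last by rewrite mul0r.
  by rewrite A00 mul0r.
case: n IH A detA pivot noi A00 => [|n] IH A detA pivot noi A00.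
  have -> : A = 1%:M.
    by apply/matrixP => i j; rewrite !ord1 mxE eqxx -detA det_mx11.
  by apply: short_productW (short_product1 _).
(* Below the corner the first column is zero; adding row 0 to row 1 creates the nonzero entry that
   [pivot] requires. *)
apply: (@short_product_cancel _ _ (1, 0) 1) => //; apply: (pivot _ 1) => //.
  rewrite mulmxDl mul1mx scale1r !mxE (bigD1 0) //= big1 => [|k k0].
    have := noi 1; rewrite /= => /negbFE/eqP->.
    by rewrite !mxE !eqxx mul1r addr0 add0r.
  by rewrite !mxE eqxx (negPf k0) mul0r.
by rewrite det_mulmx detA mulr1 det_transvection.
Qed.

(** A sentence needs a fixed number of parameters in a fixed pattern. Every round runs through all
    positions; a short product uses at most one factor per round and parameter 0 elsewhere. *)
Definition word_mx n (a : 'I_(SL_width n) * ('I_n * 'I_n) -> K) : 'M[K]_n :=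
  \big[mulmx/1%:M]_(k < SL_width n)
    \big[mulmx/1%:M]_(p : 'I_n * 'I_n | p.1 != p.2) transvection p (a (k, p)).

Lemma det_word_mx n (a : 'I_(SL_width n) * ('I_n * 'I_n) -> K) : \det (word_mx a) = 1.
Proof.
apply: (big_ind (fun A => \det A = 1)) => [|A B dA dB|k _]; rewrite ?det1 //.
  by rewrite det_mulmx dA dB mulr1.
apply: (big_ind (fun A => \det A = 1)) => [|A B dA dB|p p12]; rewrite ?det1 //.
  by rewrite det_mulmx dA dB mulr1.
exact: det_transvection.
Qed.

Lemma word_mx_surj n (A : 'M[K]_n) : \det A = 1 -> exists a, A = word_mx a.
Proof.
move=> /SL_short_product[s [sc sv ->]].
exists (fun kp : 'I_(SL_width n) * ('I_n * 'I_n) =>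
    if onth s kp.1 is Some x then (if x.1 == kp.2 then x.2 else 0) else 0).
rewrite /word_mx /elementary_product; move: (SL_width n) sc sv => c.
elim: c s => [|c IH] [|x s] //=.
- by move=> _ _; rewrite big_nil big_ord0.
- move=> _ _; rewrite big_nil big1 // => k _; rewrite big1 // => p _.
  by rewrite onth0n transvection0.
rewrite ltnS => sc /andP[xv sv]; rewrite big_cons big_ord_recl /= -IH //.
congr (_ *m _); rewrite (big_only1 x.1) ?eqxx // => p px _.
by rewrite eq_sym (negPf px) transvection0.
Qed.
End Elementary.

(** * Transvections with prescribed commutators *)

Section Algebra.
Local Open Scope ring_scope.

Lemma comm_1D (R : nzRingType) (x y : R) : x * y = y * x -> (1 + x) * (1 + y) = (1 + y) * (1 + x).
Proof. by move=> xy; rewrite !mulrDl !mulrDr !mul1r !mulr1 xy addrACA. Qed.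

(** The conjugate [D] of [B] by [1 + A] squares to zero like [B]. The relation gives D = B + K + BK,
    whose square is 2BK. *)
Lemma heisenberg_half (R : nzRingType) (A B K : R) :
  A * A = 0 -> B * B = 0 -> K * K = 0 -> K * B = B * K ->
  (1 + A) * (1 + B) = (1 + B) * (1 + K) * (1 + A) -> B * K *+ 2 = 0.
Proof.
move=> AA BB KK KB rel.
have A1 : (1 + A) * (1 - A) = 1.
  by rewrite mulrDl mul1r mulrBr mulr1 AA subr0 subrK.
have A2 : (1 - A) * (1 + A) = 1.
  by rewrite mulrDr mulr1 mulrBl mul1r AA subr0 subrK.
pose D := (1 + A) * B * (1 - A).
have DD : D * D = 0.
  by rewrite /D !mulrA -[_ * (1 - A) * _]mulrA A2 mulr1 -[_ * B * B]mulrA BB mulr0 mul0r.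
have DE : D = B + K + B * K.
  have : (1 + A) * (1 + B) * (1 - A) = (1 + B) * (1 + K).
    by rewrite rel -mulrA A1 mulr1.
  rewrite [(1 + A) * (1 + B)]mulrDr mulr1 mulrDl A1 -/D.
  rewrite [RHS]mulrDl mul1r mulrDr mulr1 -addrA => /addrI->.
  by rewrite addrA [K + B]addrC.
have t1 : B * K * B = 0 by rewrite -mulrA KB mulrA BB mul0r.
have t2 : B * (B * K) = 0 by rewrite mulrA BB mul0r.
have t3 : K * (B * K) = 0 by rewrite mulrA KB -mulrA KK mulr0.
have t4 : B * K * K = 0 by rewrite -mulrA KK mulr0.
have t5 : B * K * (B * K) = 0 by rewrite mulrA t1 mul0r.
by move: DD; rewrite DE !mulrDl !mulrDr t1 t2 t3 t4 t5 BB KK KB !addr0 add0r mulr2n.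
Qed.

Section Heisenberg.
Variables (R : nzRingType) (A B K : R).
Hypothesis R2 : forall x : R, x *+ 2 = 0 -> x = 0.
Hypotheses (AA : A * A = 0) (BB : B * B = 0) (KK : K * K = 0).
Hypotheses (KA : K * A = A * K) (KB : K * B = B * K).
Hypothesis rel : (1 + A) * (1 + B) = (1 + B) * (1 + A) * (1 + K).

(** Both products with [K] vanish by [heisenberg_half], used once as it stands and once with [A],
    [B] exchanged and [K] negated. The group relation then becomes linear in [A] and in [B], which
    allows the scaling in [heisenberg_scale]. *)
Lemma heisenberg : [/\ A * B = B * A + K, A * K = 0 & B * K = 0].
Proof.
have BK : B * K = 0.
  apply/R2/(heisenberg_half AA) => //; rewrite rel -!mulrA; congr (_ * _).
  exact/comm_1D.
have K1 : (1 + K) * (1 - K) = 1 by rewrite mulrDl mul1r mulrBr mulr1 KK subr0 subrK.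
have AK : A * K = 0.
  have KN : (- K) * (- K) = 0 by rewrite mulrNN.
  have := @heisenberg_half R B A (- K) BB AA KN.
  rewrite mulrN mulNr KA => /(_ erefl); rewrite mulNrn => H.
  apply/R2/eqP; rewrite -oppr_eq0; apply/eqP/H.
  rewrite -[RHS]mulrA (@comm_1D R (- K) B); last by rewrite mulNr mulrN KB.
  by rewrite mulrA rel -mulrA K1 mulr1.
split=> //; move: rel; rewrite [RHS]mulrDr mulr1.
have -> : (1 + B) * (1 + A) * K = K.
  by rewrite -mulrA [(1 + A) * K]mulrDl mul1r AK addr0 mulrDl mul1r BK addr0.
rewrite !mulrDl !mulrDr !mul1r !mulr1 [1 + A + _]addrACA -!addrA.
by do 3! move/addrI.
Qed.
End Heisenberg.

Lemma heisenberg_scale (F : comNzRingType) (R : algType F) (A B K : R) c d :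
  A * B = B * A + K -> A * K = 0 -> B * K = 0 ->
  (1 + c *: A) * (1 + d *: B) = (1 + d *: B) * (1 + c *: A) * (1 + (c * d) *: K).
Proof.
move=> AB AK BK; rewrite [RHS]mulrDr mulr1.
have -> : (1 + d *: B) * (1 + c *: A) * ((c * d) *: K) = (c * d) *: K.
  rewrite -mulrA [(1 + c *: A) * _]mulrDl mul1r -scalerAl -scalerAr AK !scaler0 addr0.
  by rewrite mulrDl mul1r -scalerAl -scalerAr BK !scaler0 addr0.
rewrite !mulrDl !mulrDr !mul1r !mulr1 -!scalerAl -!scalerAr !scalerA AB scalerDr.
by rewrite [d * c]mulrC [1 + d *: B + _]addrACA !addrA.
Qed.

Lemma sqr_lin (F : comNzRingType) (R : algType F) (M : R) a b :
  (a%:A + b *: M) * (a%:A + b *: M) = (a * a)%:A + (a * b *+ 2) *: M + (b * b) *: (M * M).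
Proof.
rewrite mulrDl !mulrDr -!scalerAl -!scalerAr !scalerA !mul1r mulr1.
by rewrite [b * a]mulrC mulr2n scalerDl !addrA.
Qed.
End Algebra.

(** * Commutants and double centralizers of matrices *)

Section Commutant.
Local Open Scope ring_scope.
Variables (F : fieldType) (n : nat).
Implicit Types A B M Y T : 'M[F]_n.

Lemma commute_transvections A :
  (forall p : 'I_n * 'I_n, p.1 != p.2 -> A *m transvection p 1 = transvection p 1 *m A) ->
  exists a, A = a%:M.
Proof.
move=> AE.
have AD i j : i != j -> A *m delta_mx i j = delta_mx i j *m A.
  move=> ij; have := AE (i, j) ij; rewrite /transvection scale1r mulmxDr mulmxDl mulmx1 mul1mx.
  by move/addrI.
have AD2 i j k l : i != j -> A k i * (l == j)%:R = (k == i)%:R * A j l.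
  move=> ij; have /matrixP/(_ k l) := AD i j ij; rewrite !mxE.
  rewrite (bigD1 i) //= big1 => [|h hi]; last by rewrite !mxE (negPf hi) mulr0.
  rewrite (bigD1 j) //= big1 => [|h hj]; last by rewrite !mxE (negPf hj) andbF mul0r.
  by rewrite !mxE !eqxx andbT !addr0 /= => ->.
have Aij i j : i != j -> A i j = 0.
  by move=> ij; have := AD2 j i i i; rewrite eq_sym ij eqxx mulr1 (negPf ij) mul0r => ->.
have Aii i j : A i i = A j j.
  by have [->//|ij] := eqVneq i j; have := AD2 i j i j ij; rewrite !eqxx mulr1 mul1r.
have [i0|no] := pickP (fun _ : 'I_n => true).
  exists (A i0 i0); apply/matrixP => k l; rewrite mxE.
  by have [<-|ij] := eqVneq k l; [rewrite mulr1n | rewrite mulr0n Aij].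
by exists 0; apply/matrixP => i; have := no i.
Qed.

Lemma sandwich A M : M != 0 -> (forall T, A *m T *m M = M *m T *m A) ->
  exists a, A = a *: M.
Proof.
move=> M0 AM; have [i [j Mij]] : exists i j, M i j != 0.
  apply: contrapT => no; move/eqP: M0; apply; apply/matrixP => i j; rewrite mxE.
  by apply/eqP/negPn/negP => Mij; apply: no; exists i, j.
exists (A i j / M i j); apply/matrixP => k l; rewrite mxE.
have E (X Y : 'M[F]_n) a b c d : (X *m delta_mx b c *m Y) a d = X a b * Y c d.
  rewrite -mulmxA mxE (bigD1 b) //= big1 => [|h hb]; rewrite mxE.
    by rewrite (bigD1 c) //= big1 ?mxE ?eqxx ?mul1r ?addr0 // => h hc;
      rewrite mxE (negPf hc) andbF mul0r.
  by rewrite big1 ?mulr0 // => m _; rewrite mxE (negPf hb) mul0r.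
(* Testing with a matrix unit compares entries: A_ij M_kl = M_ij A_kl. *)
have := congr1 (fun X : 'M[F]_n => X i l) (AM (delta_mx j k)); rewrite !E => H.
by rewrite mulrAC H mulrAC mulfV // mul1r.
Qed.

Hypothesis F_char0 : [pchar F] =i pred0.

Lemma nonroot (p : {poly F}) : p != 0 -> exists k : nat, ~~ root p k%:R.
Proof.
move=> p0; apply: contrapT => no.
have := @max_poly_roots F p [seq k%:R | k <- iota 0 (size p)] p0.
rewrite size_map size_iota ltnn; move=> H; suff : false by []; apply: H.
  apply/allP => _ /mapP[k _ ->]; apply/negPn/negP => rk; apply: no; by exists k.
rewrite map_inj_uniq ?iota_uniq //.
move=> i j; wlog ij : i j / (i <= j)%N.
  by move=> IH; case/orP: (leq_total i j) => ? e; [|symmetry]; apply: IH.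
move/eqP; rewrite eq_sym -subr_eq0 -natrB // ((pcharf0P F).1 F_char0) => ?; lia.
Qed.

Lemma unitmx_shift A : exists k : nat, (k%:R%:M + A) \in unitmx.
Proof.
have [k /negP kP] := nonroot (monic_neq0 (char_poly_monic (- A))).
exists k; move/negP: kP; rewrite -eigenvalue_root_char negbK kermx_eq0.
by rewrite row_free_unit -opprD [A + _]addrC -scaleN1r unitmxZ // unitrN1.
Qed.

(** Adding a scalar makes any commuting [Y] invertible, so [A] commutes with the whole commutant of
    [M]. Its elements M T M show that A M = a M, and then M T + T M show that A - a is a multiple of
    [M]. *)
Lemma double_centralizer M A : M != 0 -> M *m M = 0 ->
  (forall Y, Y \in unitmx -> Y *m M = M *m Y -> Y *m A = A *m Y) ->
  exists a b, A = a%:M + b *: M.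
Proof.
move=> M0 MM AU.
have AC Y : Y *m M = M *m Y -> Y *m A = A *m Y.
  move=> YM; have [k kY] := unitmx_shift Y.
  have := AU _ kY; rewrite !mulmxDl !mulmxDr !scalar_mxC YM => /(_ erefl).
  exact: addrI.
have MA : M *m A = A *m M by apply: AC.
have [a Aa] : exists a, A *m M = a *: M.
  apply: sandwich => // T.
  have : (M *m T *m M) *m A = A *m (M *m T *m M).
    by apply: AC; rewrite -mulmxA MM mulmx0 !mulmxA MM !mul0mx.
  by rewrite !mulmxA => <-; rewrite -mulmxA MA mulmxA.
have [b Ab] : exists b, A - a%:M = b *: M.
  apply: sandwich => // T.
  have : (M *m T + T *m M) *m A = A *m (M *m T + T *m M).
    apply: AC; rewrite mulmxDl mulmxDr -!mulmxA MM mulmx0 addr0.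
    by rewrite (mulmxA M M T) MM mul0mx add0r.
  rewrite mulmxDl mulmxDr -[T *m M *m A]mulmxA MA [A *m (M *m T)]mulmxA Aa.
  rewrite [A *m (T *m M)]mulmxA -scalemxAl -scalemxAr addrC => E.
  rewrite !mulmxBl mulmxBr mul_scalar_mx -scalemxAl mul_mx_scalar.
  apply/eqP; rewrite subr_eq addrAC eq_sym subr_eq [M *m T *m A + _]addrC [_ + a *: (M *m T)]addrC.
  by rewrite -!mulmxA in E *; rewrite E.
by exists a, b; rewrite -Ab addrC subrK.
Qed.
End Commutant.

(** * Polynomials in a matrix and quadratic unipotents *)

Section Quadratic.
Local Open Scope ring_scope.
Variables (F : closedFieldType) (m : nat).
Hypothesis F_char0 : [pchar F] =i pred0.
Local Notation n := m.+1.
Implicit Types X Y M : 'M[F]_n.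

(** Remove one linear factor X - a from the minimal polynomial, leaving q. Then y = q(X) is nonzero
    and killed by X - a, so multiplication by any polynomial in X acts on [y] through its value at
    a. *)
Lemma quadratic_element X : (forall a, X <> a%:M) ->
  exists y c, [/\ forall a, y <> a%:M, y *m y = c *: y &
    forall Y, Y *m X = X *m Y -> Y *m y = y *m Y].
Proof.
move=> Xns; pose f := mxminpoly X.
have sf : (1 < size f)%N by rewrite size_mxminpoly ltnS mxminpoly_nonconstant.
have [a fa] : exists a, root f a.
  by apply/closed_rootP; rewrite neq_ltn sf orbT.
have /factor_theorem[q fq] := fa.
have q0 : q != 0.
  by apply/eqP => q0; move: sf; rewrite fq q0 mul0r size_poly0.
pose y := horner_mx X q.
have y0 : y != 0.
  apply/eqP => /mxminpoly_min/(dvdp_leq q0); rewrite -/f fq.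
  by rewrite size_Mmonic ?monicXsubC // size_XsubC addn2 ltnn.
have fX : y * (X - a%:M) = 0.
  have := mx_root_minpoly X; rewrite -/f fq rmorphM /= rmorphB /= horner_mx_X horner_mx_C.
  by [].
have yX : (X - a%:M) * y = 0.
  have := mx_root_minpoly X; rewrite -/f fq mulrC rmorphM /= rmorphB /= horner_mx_X horner_mx_C.
  by [].
have yc : y * y = q.[a] *: y.
  have /factor_theorem[r qr] : root (q - (q.[a])%:P) a.
    by rewrite /root !hornerE subrr.
  have yE : y = horner_mx X r * (X - a%:M) + q.[a]%:M.
    rewrite /y -[X in horner_mx _ X](subrK q.[a]%:P q) qr rmorphD rmorphM rmorphB /=.
    by rewrite horner_mx_X !horner_mx_C.
  by rewrite [LHS](congr1 (fun z => z * y) yE) mulrDl -mulrA yX mulr0 add0r [LHS]mul_scalar_mx.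
exists y, q.[a]; split.
- move=> b yb; have b0 : b != 0.
    by apply/eqP => b0; move/eqP: y0; apply; rewrite yb b0 raddf0.
  apply: (Xns a); apply/eqP; rewrite -subr_eq0; apply/eqP.
  move: yX; rewrite yb [_ * _]mul_mx_scalar => /eqP.
  by rewrite scaler_eq0 (negPf b0) => /eqP.
- exact: yc.
- by move=> Y YX; apply: comm_mx_horner.
Qed.

Lemma lin_eq0 M a b : (forall c, M <> c%:M) -> a%:M + b *: M = 0 -> a = 0 /\ b = 0.
Proof.
move=> Mns /eqP; rewrite addr_eq0 => /eqP E; have b0 : b = 0.
  apply/eqP/negPn/negP => b0; apply: (Mns (- (a / b))).
  by apply: (scalerI b0); rewrite scale_scalar_mx mulrN mulrC divfK // raddfN /= E opprK.
split=> //; move: E; rewrite b0 scale0r oppr0 => /matrixP/(_ 0 0).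
by rewrite !mxE eqxx mulr1n.
Qed.

Lemma conj_mulmx M N Y : Y \in unitmx ->
  (invmx Y *m M *m Y) *m (invmx Y *m N *m Y) = invmx Y *m (M *m N) *m Y.
Proof. by move=> uY; rewrite !mulmxA mulmxK. Qed.

Lemma idempotent_unit M b : M *m M = M -> 1 + b != 0 -> 1%:M + b *: M \in unitmx.
Proof.
move=> MM b1; have : (1%:M + b *: M) *m (1%:M - (b / (1 + b)) *: M) = 1%:M.
  rewrite mulmxDl mul1mx mulmxBr mulmx1 -scalemxAl -scalemxAr MM scalerA.
  rewrite -[LHS]addrA -[RHS]addr0; congr (_ + _); rewrite addrC -!scaleNr -!scalerDl.
  by rewrite [X in X *: M](_ : _ = 0) ?scale0r //; field.
by case/mulmx1_unit.
Qed.

(** The eigenvalues of 1 + N lie in {1, 2}, whereas [M] has both eigenvalues 0 and 1, so the right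
    side has w and 3w. *)
Lemma idempotent_conj M N w : (forall a, M <> a%:M) -> M *m M = M -> N *m N = N -> w != 0 ->
  1%:M + N <> w *: (1%:M + 2%:R *: M).
Proof.
move=> Mns MM NN w0 E; have NE : N = (w - 1)%:M + (w *+ 2) *: M.
  move/(congr1 (fun A => A - 1%:M)): E; rewrite addrAC subrr add0r => ->.
  by rewrite scalerDr scale_scalar_mx mulr1 scalerA mulr_natr addrAC raddfB.
move: NN; rewrite NE -[(w - 1)%:M]scalemx1 => NN.
have := @sqr_lin F 'M[F]_n M (w - 1) (w *+ 2).
rewrite [LHS]NN [M * M]MM => /esym/eqP; rewrite -subr_eq0 => /eqP.
rewrite -[X in X - _]addrA -scalerDl opprD addrACA -scalerBl -scalerBl scalemx1.
move=> /(lin_eq0 Mns)[/eqP w1 /eqP w2].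
have nat0 := (pcharf0P F).1 F_char0.
have {w1}/eqP : (w - 1) * (w - 2%:R) = 0 by move/eqP: w1 => <-; ring.
have {w2} /eqP : w * (8%:R * w - 6%:R) = 0 by move/eqP: w2 => <-; ring.
rewrite !mulf_eq0 (negPf w0) /= !subr_eq0 => /eqP w6 /orP[]/eqP wE; move/eqP: w6; rewrite wE.
  by rewrite mulr1 -subr_eq0 -natrB // nat0.
by rewrite -natrM -subr_eq0 -natrB // nat0.
Qed.

(* If all the units [P] that commute with the commutant of a nonscalar [X] are conjugate to
   [X] up to scalars, then [X] is, up to a scalar, unipotent with minimal polynomial of
   degree 2: otherwise the commutant contains an idempotent [e], and [1 + e] cannot be
   conjugate to a multiple of [1 + 2 e]. *)
Lemma quadratic_unipotent X : (forall a, X <> a%:M) ->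
  (forall P, P \in unitmx -> (forall Y, Y *m X = X *m Y -> Y *m P = P *m Y) ->
     (forall a, P <> a%:M) ->
     exists a U, [/\ a != 0, U \in unitmx & P = a *: (invmx U *m X *m U)]) ->
  exists a M, [/\ a != 0, M != 0, M *m M = 0 & X = a *: (1%:M + M)].
Proof.
move=> Xns star; have [y [c [yns yy yC]]] := quadratic_element Xns.
have y1ns b a : b != 0 -> 1%:M + b *: y <> a%:M.
  move=> b0 E; have [] := @lin_eq0 y (1 - a) b yns.
    by rewrite raddfB /= addrAC E subrr.
  by move=> _ /eqP; apply/negP.
have y1C b Y : Y *m X = X *m Y -> Y *m (1%:M + b *: y) = (1%:M + b *: y) *m Y.
  by move=> /yC YX; rewrite mulmxDr mulmxDl mulmx1 mul1mx -scalemxAr -scalemxAl YX.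
have [c0|c0] := eqVneq c 0.
  have y2 : y *m y = 0 by rewrite yy c0 scale0r.
  have uP : 1%:M + 1 *: y \in unitmx.
    have : (1%:M + 1 *: y) *m (1%:M - y) = 1%:M.
      by rewrite scale1r mulmxDl mul1mx mulmxBr mulmx1 y2 subr0 subrK.
    by case/mulmx1_unit.
  have [a [U [a0 uU PE]]] := star _ uP (y1C 1) (y1ns 1 ^~ (oner_neq0 _)).
  exists a^-1, (U *m y *m invmx U); split; first by rewrite invr_eq0.
  - apply/eqP => UyU; apply: (yns 0); rewrite raddf0.
    by rewrite -[y](mulKmx uU) -[U *m y](mulmxKV uU) UyU mul0mx mulmx0.
  - by rewrite !mulmxA mulmxKV // -[U *m y *m y]mulmxA y2 mulmx0 mul0mx.
  have -> : 1%:M + U *m y *m invmx U = U *m (1%:M + 1 *: y) *m invmx U.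
    by rewrite scale1r mulmxDr mulmx1 mulmxDl mulmxV.
  rewrite PE -scalemxAr -scalemxAl scalerA mulVf // scale1r.
  by rewrite !mulmxA mulmxV // mul1mx mulmxK.
pose e := c^-1 *: y.
have ee : e *m e = e.
  by rewrite /e -scalemxAl -scalemxAr yy !scalerA -mulrA mulVf // mulr1.
have ens a : e <> a%:M.
  move=> E; apply: (yns (c * a)); rewrite -scale_scalar_mx -E /e scalerA mulfV //.
  by rewrite scale1r.
have nat0 := (pcharf0P F).1 F_char0.
have [|||a1 [U1 [a10 uU1 E1]]] := star (1%:M + 1 *: e).
- by apply: idempotent_unit; rewrite // -[1 + 1]/(2%:R) nat0.
- by rewrite /e scalerA; exact: y1C.
- by move=> a; rewrite /e scalerA; apply: y1ns; rewrite mulf_neq0 ?invr_neq0 ?oner_neq0.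
have [|||a2 [U2 [a20 uU2 E2]]] := star (1%:M + 2%:R *: e).
- by apply: idempotent_unit; rewrite // -[1 + 2%:R]/(1%:R + 2%:R) -natrD nat0.
- by rewrite /e scalerA; exact: y1C.
- by move=> a; rewrite /e scalerA; apply: y1ns; rewrite mulf_neq0 ?invr_neq0 ?nat0.
pose W := invmx U1 *m U2; have uW : W \in unitmx by rewrite unitmx_mul unitmx_inv uU1.
case: (@idempotent_conj e (invmx W *m e *m W) (a1 / a2) ens ee).
- by rewrite conj_mulmx // ee.
- by rewrite mulf_neq0 ?invr_neq0.
have -> : 1%:M + invmx W *m e *m W = invmx W *m (1%:M + 1 *: e) *m W.
  by rewrite scale1r mulmxDr mulmx1 mulmxDl mulVmx.
rewrite E1 E2 scalerA divfK // -scalemxAr -scalemxAl; congr (_ *: _).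
have WV : invmx W = invmx U2 *m U1.
  by rewrite -[RHS](mulmxK uW) /W !mulmxA mulmxK // mulVmx // mul1mx.
by rewrite WV /W !mulmxA !mulmxK.
Qed.
End Quadratic.

(** * Interpreting the field in the general linear group *)

Section Coordinates.
Variables (G : groupType) (x s t : G).

Definition dcent (g : G) : Prop := forall y, commute y x -> commute y g.

Definition fmul (a b : G) : G := [~ a ^ s, b ^ t].

Definition coord_dom (g : G) : Prop := dcent g /\ fmul g x = g.

(* In [GL n F] these conditions force [x], [x ^ s] and [x ^ t] to be transvections whose
   matrices satisfy the commutation relations of [E_02], [E_01] and [E_12], so that
   [coord_dom] is the root subgroup of [x], with the field multiplication [fmul]. *)
Definition frame : Prop :=
  [/\ ~ central x,
      forall g, dcent g -> ~ central g -> exists h z, central z /\ g = z * x ^ h,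
      exists h, x ^ h = x * x,
      fmul x x = x & commute x (x ^ s) /\ commute x (x ^ t)].

Record coordinates (R : nzRingType) (v : R -> G) : Prop := Coordinates {
  coord_inj : injective v;
  coord_im : forall g, coord_dom g <-> exists a, g = v a;
  coord_add : {morph v : a b / (a + b)%R >-> a * b};
  coord_mul : {morph v : a b / (a * b)%R >-> fmul a b};
  coord_one : v 1%R = x
}.

Lemma coord_zero (R : nzRingType) (v : R -> G) : coordinates v -> v 0%R = 1.
Proof. by move=> cv; apply: (mulgI (v 0%R)); rewrite -(coord_add cv) addr0 mulg1. Qed.

Lemma coord_opp (R : nzRingType) (v : R -> G) a : coordinates v -> v (- a)%R = (v a)^-1.
Proof. by move=> cv; apply: (mulgI (v a)); rewrite -(coord_add cv) subrr mulgV (coord_zero cv). Qed.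

Lemma commg_eq (a b k : G) : a * b = b * a * k -> [~ a, b] = k.
Proof. by rewrite commgC => /mulgI. Qed.

(** This explains the equation in [coord_dom]: the double centralizer of [x] contains the center,
    and multiplication by [x] strips off the central factor. *)
Lemma fmul_centrall z a b : central z -> fmul (z * a) b = fmul a b.
Proof.
move=> cz; rewrite /fmul conjMg.
have -> : z ^ s = z by rewrite /conjg (cz s) mulKg.
move: (a ^ s) (b ^ t) => {}a {}b; apply: commg_eq.
by rewrite -mulgA (commgC a); move: [~ a, b] => k; rewrite !mulgA cz.
Qed.
End Coordinates.

Section LinearGroup.
Variables (K : fieldType) (n : nat).
Implicit Types (g h : GL n K) (A : 'M[K]_n).

Definition gl A : GL n K := insubd (1 : GL n K) A.

Lemma val_gl A : A \in unitmx -> val (gl A) = A.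
Proof. exact: insubdK. Qed.

Lemma val_GL1 : val (1 : GL n K) = (1%:M)%R. Proof. by []. Qed.
Lemma val_GLM g h : val (g * h) = (val g *m val h)%R. Proof. by []. Qed.
Lemma val_GLV g : val g^-1 = invmx (val g). Proof. by []. Qed.
Lemma val_GLJ g h : val (g ^ h) = (invmx (val h) *m val g *m val h)%R.
Proof. by rewrite -mulmxA. Qed.

Lemma transvection_unit (p : 'I_n * 'I_n) a : p.1 != p.2 -> transvection p (a : K) \in unitmx.
Proof. by move=> p12; rewrite unitmxE det_transvection ?unitr1. Qed.

Lemma central_GLP g : central g <-> exists a, val g = (a%:M)%R.
Proof.
split=> [cg|[a ga] h]; last by apply: val_inj; rewrite !val_GLM ga scalar_mxC.
apply: commute_transvections => p p12.
by have := congr1 val (cg (gl (transvection p 1))); rewrite !val_GLM val_gl ?transvection_unit.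
Qed.
End LinearGroup.

Section FrameCoordinates.
Variables (F : closedFieldType) (m : nat).
Hypothesis F_char0 : [pchar F]%R =i pred0.
Local Notation n := m.+1.
Implicit Types x s t : GL n F.

(** The clause on the double centralizer gives x = a(1 + M). As [x] is conjugate to its square, [M]
    is conjugate to (a - 1) + 2aM; this squares to zero only if a = 1. *)
Lemma frame_quadratic x s t : frame x s t ->
  exists M : 'M[F]_n, [/\ M != 0, M *m M = 0 & val x = 1%:M + M]%R.
Proof.
move=> [x_nc x_star [h xh] _ _].
have Xns a : val x <> (a%:M)%R by move=> xa; apply: x_nc; apply/central_GLP; exists a.
have [|a [M [a0 M0 MM XE]]] := quadratic_unipotent F_char0 Xns.
  move=> P uP PC Pns; have [||k [z [/central_GLP[b zb] PE]]] := x_star (gl P).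
  - move=> y xy; apply: val_inj; rewrite !val_GLM val_gl //; apply: PC.
    exact: (congr1 val xy).
  - by move/central_GLP => [b]; rewrite val_gl //; exact: Pns.
  exists b, (val k); split; last first.
  - by have := congr1 val PE; rewrite val_gl // val_GLM zb mul_scalar_mx val_GLJ.
  - exact: valP k.
  - by apply/eqP => b0; have := valP z; rewrite /= zb b0 raddf0 unitmxE det0 unitr0.
have Mns b : M <> (b%:M)%R.
  move=> Mb; move/eqP: MM; rewrite Mb -scalar_mxM => /eqP/matrixP/(_ 0%R 0%R)/eqP.
  rewrite !mxE eqxx mulr1n mulf_eq0 orbb => /eqP b0.
  by move/eqP: M0; apply; rewrite Mb b0 raddf0.
exists M; split=> //; suff a1 : a = 1%R by rewrite XE a1 scale1r.
have uH : val h \in unitmx := valP h.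
pose M' := (invmx (val h) *m M *m val h)%R.
have M'E : M' = ((a - 1)%:M + (a *+ 2) *: M)%R.
  have := congr1 val xh; rewrite val_GLJ val_GLM XE.
  rewrite -scalemxAr -!scalemxAl -scalemxAr => /(scalerI a0).
  rewrite mulmxDr mulmx1 mulmxDl mulVmx // -/M' mulmxDl mul1mx mulmxDr mulmx1 MM addr0.
  move/(congr1 (fun A => A - 1%:M)%R); rewrite addrAC subrr add0r => ->.
  by rewrite -addrA -mulr2n scalerDr scale_scalar_mx mulr1 -scalerMnr scalerMnl addrAC raddfB.
have : (M' *m M' = 0)%R.
  by rewrite /M' conj_mulmx // MM mulmx0 mul0mx.
rewrite M'E -[((a - 1)%:M)%R]scalemx1 => M'M'.
have := @sqr_lin F 'M[F]_n M (a - 1)%R (a *+ 2)%R.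
rewrite [LHS]M'M' [(M * M)%R]MM scaler0 addr0 scalemx1 => /esym/(lin_eq0 Mns)[].
by move/eqP; rewrite mulf_eq0 orbb subr_eq0 => /eqP.
Qed.

Section RootSubgroup.
Variable M : 'M[F]_n.
Hypotheses (M0 : (M != 0)%R) (MM : (M *m M = 0)%R).

Definition root_elt (c : F) : GL n F := gl (1%:M + c *: M)%R.

Lemma val_root_elt c : val (root_elt c) = (1%:M + c *: M)%R.
Proof.
apply: val_gl; have : ((1%:M + c *: M) *m (1%:M - c *: M) = 1%:M)%R.
  by rewrite mulmxDl mul1mx mulmxBr mulmx1 -scalemxAl -scalemxAr MM !scaler0 subr0 subrK.
by case/mulmx1_unit.
Qed.

Lemma root_eltJ c g : val (root_elt c ^ g) = (1%:M + c *: (invmx (val g) *m M *m val g))%R.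
Proof.
rewrite val_GLJ val_root_elt mulmxDr mulmx1 mulmxDl mulVmx; last exact: valP g.
by rewrite -scalemxAr -scalemxAl.
Qed.

Lemma root_elt_inj : injective root_elt.
Proof.
move=> c d /(congr1 val); rewrite !val_root_elt => /addrI/eqP.
by rewrite -subr_eq0 -scalerBl scaler_eq0 (negPf M0) orbF subr_eq0 => /eqP.
Qed.

Lemma root_eltD : {morph root_elt : c d / (c + d)%R >-> c * d}.
Proof.
move=> c d; apply: val_inj; rewrite val_GLM !val_root_elt mulmxDl mul1mx mulmxDr mulmx1.
by rewrite -scalemxAl -scalemxAr MM !scaler0 addr0 scalerDl [(c *: M + _)%R]addrC addrA.
Qed.

Lemma root_elt_dcent c : dcent (root_elt 1) (root_elt c).
Proof.
move=> y /(congr1 val); rewrite !val_GLM !val_root_elt mulmxDl mulmxDr mul1mx mulmx1 scale1r.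
move=> /addrI yM; apply: val_inj; rewrite !val_GLM !val_root_elt.
by rewrite mulmxDl mulmxDr mul1mx mulmx1 -scalemxAl -scalemxAr yM.
Qed.

Lemma dcent_root_elt g : dcent (root_elt 1) g ->
  exists z c, central z /\ g = z * root_elt c.
Proof.
move=> gC; have [|a [b gE]] := double_centralizer F_char0 (A := val g) M0 MM.
  move=> Y uY YM; have := gC (gl Y) _; rewrite /commute => H.
  have {}H : gl Y * g = g * gl Y.
    apply: H; apply: val_inj; rewrite !val_GLM val_gl // val_root_elt scale1r.
    by rewrite mulmxDr mulmxDl mulmx1 mul1mx YM.
  by have := congr1 val H; rewrite !val_GLM val_gl.
have a0 : (a != 0)%R.
  apply/eqP => a0; have := valP g; rewrite /= gE a0 raddf0 add0r => ug.
  have : (1%:M = 0 :> 'M[F]_n)%R.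
    rewrite -(mulmxV ug) -[X in (X *m _)%R](mulmxK ug) -scalemxAl -scalemxAr MM !scaler0.
    by rewrite !mul0mx.
  by move/eqP; rewrite (negPf (matrix_nonzero1 F m)).
have ua : (a%:M : 'M[F]_n)%R \in unitmx by rewrite unitmxE det_scalar unitrX ?unitfE.
exists (gl a%:M)%R, (b / a)%R; split; first by apply/central_GLP; exists a; rewrite val_gl.
apply: val_inj; rewrite val_GLM val_gl // val_root_elt mul_scalar_mx scalerDr.
by rewrite scale_scalar_mx mulr1 scalerA mulrC divfK.
Qed.
End RootSubgroup.

(** The remaining clauses of [frame] make the conjugates of [M] by [s] and [t] satisfy [heisenberg].
    Hence the commutator of the conjugates of 1 + cM and 1 + dM is 1 + cdM. *)
Lemma frame_coordinates x s t : frame x s t -> exists M,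
  [/\ M != 0, M *m M = 0, val x = 1%:M + M & coordinates x s t (root_elt M)]%R.
Proof.
move=> fr; have [M [M0 MM xM]] := frame_quadratic fr.
have x1 : x = root_elt M 1 by apply: val_inj; rewrite val_root_elt // scale1r.
case: fr => _ _ _ xx [xs xt].
pose A := (invmx (val s) *m M *m val s)%R; pose B := (invmx (val t) *m M *m val t)%R.
have sq (g : GL n F) N : N = (invmx (val g) *m M *m val g)%R -> (N *m N = 0)%R.
  by move=> ->; rewrite conj_mulmx ?MM ?mulmx0 ?mul0mx //; exact: valP g.
have xg g : val (x ^ g) = (1%:M + (invmx (val g) *m M *m val g))%R.
  by rewrite {1}x1 root_eltJ // scale1r.
have comm_x N g : commute x g -> val g = (1%:M + N)%R -> (M *m N = N *m M)%R.
  move=> /(congr1 val); rewrite !val_GLM xM => + gN; rewrite gN.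
  rewrite [in LHS]mulmxDl [in RHS]mulmxDl !mul1mx [in LHS]mulmxDr [in RHS]mulmxDr !mulmx1.
  by rewrite [LHS]addrACA => /addrI/addrI.
have rel : ((1 + A) * (1 + B) = (1 + B) * (1 + A) * (1 + M :> 'M[F]_n))%R.
  have := commgC (x ^ s) (x ^ t); rewrite -/(fmul s t x x) xx.
  move: (xg s) (xg t); rewrite -/A -/B; move: (x ^ s) (x ^ t) => a b aE bE /(congr1 val).
  by rewrite !val_GLM aE bE xM.
have R2 (X : 'M[F]_n) : (X *+ 2 = 0)%R -> X = 0%R.
  move/eqP; rewrite -scaler_nat scaler_eq0 => /orP[|/eqP//].
  by rewrite ((pcharf0P F).1 F_char0).
have [AB AM BM] := heisenberg R2 (sq s A erefl) (sq t B erefl) MM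
  (comm_x A _ xs (xg s)) (comm_x B _ xt (xg t)) rel.
have vM c d : fmul s t (root_elt M c) (root_elt M d) = root_elt M (c * d)%R.
  have := root_eltJ MM c s; have := root_eltJ MM d t; rewrite -/A -/B /fmul.
  move: (root_elt M c ^ s) (root_elt M d ^ t) => a b bE aE.
  apply: commg_eq; apply: val_inj; rewrite !val_GLM aE bE val_root_elt //.
  exact: heisenberg_scale.
exists M; split=> //; split.
- exact: root_elt_inj.
- move=> g; split=> [[gC gx]|[c ->]]; last first.
    by split; rewrite {1}x1; [exact: root_elt_dcent | rewrite vM mulr1].
  have [z [c [cz gE]]] : exists z c, central z /\ g = z * root_elt M c.
    by apply: dcent_root_elt => //; rewrite -x1.
  by exists c; rewrite -gx gE fmul_centrall // x1 vM mulr1.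
- exact: root_eltD.
- by move=> c d; rewrite vM.
- by rewrite x1.
Qed.
End FrameCoordinates.

(** * Commutator relations of transvections and the standard frame *)

Section Transvections.
Variables (F : fieldType) (m : nat).
Local Notation n := m.+1.
Implicit Types (p q : 'I_n * 'I_n) (i j k : 'I_n) (a b : F).

Definition gl_trans (p : 'I_n * 'I_n) (c : F) : GL n F := gl (transvection p c).

Lemma val_gl_trans p c : p.1 != p.2 -> val (gl_trans p c) = transvection p c.
Proof. by move=> p12; rewrite val_gl ?transvection_unit. Qed.

Lemma commute_gl_trans p q a b : p.1 != p.2 -> q.1 != q.2 -> p.2 != q.1 -> q.2 != p.1 ->
  commute (gl_trans p a) (gl_trans q b).
Proof.
move=> p12 q12 pq qp; apply: val_inj; rewrite !val_GLM !val_gl_trans //.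
apply: comm_1D; rewrite -!scalerAl -!scalerAr [(_ * _)%R]delta_mulmx //.
by rewrite [(delta_mx _ _ * _)%R]delta_mulmx // !scaler0.
Qed.

Lemma gl_trans_comm i j k a b : i != j -> j != k -> i != k ->
  [~ gl_trans (i, j) a, gl_trans (j, k) b] = gl_trans (i, k) (a * b)%R.
Proof.
move=> ij jk ik; apply: commg_eq; apply: val_inj; rewrite !val_GLM !val_gl_trans //.
have ki : k != i by rewrite eq_sym.
have kj : k != j by rewrite eq_sym.
apply: (@heisenberg_scale F 'M[F]_n).
- by rewrite [LHS]mul_delta_mx [(_ * _)%R]delta_mulmx // add0r.
- by rewrite [LHS]delta_mulmx // eq_sym.
- by rewrite [LHS]delta_mulmx.
Qed.

End Transvections.

Section StandardFrame.
Variables (F : closedFieldType) (m : nat).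
Hypothesis F_char0 : [pchar F]%R =i pred0.
Local Notation n := m.+1.
Implicit Types (i j k l : 'I_n).

Lemma conj_gl (g h : GL n F) (H : 'M[F]_n) : H \in unitmx ->
  (val g *m H = H *m val h)%R -> g ^ gl H = h.
Proof.
by move=> uH gh; apply: val_inj; rewrite val_GLJ val_gl // -mulmxA gh mulKmx.
Qed.

Lemma gl_trans_conj p q : p.1 != p.2 -> q.1 != q.2 ->
  exists S : GL n F, forall c, gl_trans p c ^ S = gl_trans q c.
Proof.
case: p q => [i j] [k l] /= ij kl.
have [sg sgi sgj] : exists2 sg : {perm 'I_n}, sg i = k & sg j = l.
  (* The first transposition takes [i] to [k] and [j] to [j'], which differs from [k]; the second
     one therefore fixes [k] while taking [j'] to [l]. *)
  pose j' := tperm i k j.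
  have kj' : k != j' by rewrite -(tpermL i k) (inj_eq perm_inj).
  exists (tperm i k * tperm j' l); rewrite permM; last exact: tpermL.
  by rewrite tpermL tpermD // eq_sym.
have uS := unitmx_perm F sg; exists (gl (perm_mx sg)) => c; apply: conj_gl => //.
rewrite !val_gl_trans //.
rewrite /transvection mulmxDl mulmxDr mul1mx mulmx1; congr (_ + _)%R.
rewrite -scalemxAl -scalemxAr; congr (_ *: _)%R; apply/matrixP => a b; rewrite !mxE.
rewrite (bigD1 j) //= big1 => [|h hj]; last by rewrite !mxE (negPf hj) andbF mul0r.
rewrite (bigD1 k) //= big1 => [|h hk]; last by rewrite !mxE (negPf hk) /= mulr0.
rewrite !mxE !eqxx /= andbT !addr0 sgj -sgi (inj_eq perm_inj) -natrM -natrM mulnb mulnb.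
by rewrite [l == b]eq_sym.
Qed.

Lemma gl_trans_scale i j c : i != j -> c != 0%R ->
  exists h, gl_trans (i, j) (1 : F)%R ^ h = gl_trans (i, j) c.
Proof.
(* The conjugating matrix is diagonal with [c] at position [j] and 1 elsewhere. *)
move=> ij c0; have uH : (1%:M + (c - 1) *: delta_mx j j : 'M[F]_n)%R \in unitmx.
  by apply: idempotent_unit; rewrite ?mul_delta_mx // addrC subrK.
exists (gl (1%:M + (c - 1) *: delta_mx j j)%R); apply: conj_gl => //.
rewrite !val_gl_trans //.
rewrite /transvection [LHS]mulmxDl [RHS]mulmxDr [in LHS]mul1mx [in RHS]mulmx1; congr (_ + _)%R.
rewrite mulmxDl mulmxDr mulmx1 mul1mx -!scalemxAl -!scalemxAr !mul_delta_mx.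
rewrite delta_mulmx 1?eq_sym // !scaler0 addr0 scale1r.
by rewrite /= scale1r -[X in (X + _)%R]scale1r -scalerDl addrC subrK.
Qed.

Lemma delta_mx_neq0 i j : (delta_mx i j != 0 :> 'M[F]_n)%R.
Proof.
apply/eqP => /matrixP/(_ i j); rewrite !mxE !eqxx => /eqP.
by rewrite oner_eq0.
Qed.

Lemma root_elt_delta i j (c : F) : root_elt (delta_mx i j) c = gl_trans (i, j) c.
Proof. by []. Qed.

Lemma standard_frame i j k s t : i != j -> j != k -> i != k ->
  (forall c : F, gl_trans (i, k) c ^ s = gl_trans (i, j) c) ->
  (forall c : F, gl_trans (i, k) c ^ t = gl_trans (j, k) c) ->
  frame (gl_trans (i, k) (1 : F)%R) s t.
Proof.
move=> ij jk ik Es Et; have D0 := delta_mx_neq0 i k.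
have ki : k != i by rewrite eq_sym.
have DD : (delta_mx i k *m delta_mx i k = 0 :> 'M[F]_n)%R by rewrite delta_mulmx.
split.
- move=> /central_GLP[a]; rewrite val_gl_trans // => /matrixP/(_ i k).
  by rewrite !mxE (negPf ik) !eqxx mulr1 add0r => /eqP; rewrite oner_eq0.
- move=> g /(dcent_root_elt F_char0 D0 DD)[z [c [cz gE]]] g_nc.
  have c0 : c != 0%R.
    apply/eqP => c0; apply: g_nc; rewrite gE c0 root_elt_delta /gl_trans transvection0.
    have -> : gl 1%:M%R = 1 :> GL n F by apply: val_inj; rewrite val_gl ?unitmx1.
    by rewrite mulg1.
  by have [h hc] := gl_trans_scale ik c0; exists h, z; rewrite hc.
- have [|h hc] := @gl_trans_scale i k (2%:R)%R ik; first by rewrite ((pcharf0P F).1 F_char0).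
  by exists h; rewrite hc -!root_elt_delta -(root_eltD DD).
- by rewrite /fmul Es Et gl_trans_comm // mulr1.
by rewrite Es Et; split; apply: commute_gl_trans; rewrite //= eq_sym.
Qed.
End StandardFrame.

(** * Groups that look like general linear groups *)

Section MatrixLike.
Variables (G : groupType) (n : nat).
Local Notation index := ('I_(SL_width n) * ('I_n * 'I_n))%type.

(** The counterpart of [word_mx]: [S p] is meant to conjugate the root subgroup of [x] to the one at
    position [p]. *)
Definition group_word (S : 'I_n * 'I_n -> G) (a : index -> G) : G :=
  \prod_(k < SL_width n) \prod_(p : 'I_n * 'I_n | p.1 != p.2) a (k, p) ^ S p.

Section RawMatrices.
Variables x s t : G.

(** Matrix arithmetic on bare group elements: its entries are group terms, and it makes sense before
    any field structure has been established. *)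
Definition raw_one : 'I_n -> 'I_n -> G := fun i j => if i == j then x else 1.

Definition raw_mul (A B : 'I_n -> 'I_n -> G) : 'I_n -> 'I_n -> G :=
  fun i j => \prod_(k < n) fmul s t (A i k) (B k j).

Definition raw_transvection (p : 'I_n * 'I_n) (a : G) : 'I_n -> 'I_n -> G :=
  fun i j => raw_one i j * (if (i == p.1) && (j == p.2) then a else 1).

Definition raw_word (a : index -> G) : 'I_n -> 'I_n -> G :=
  \big[raw_mul/raw_one]_(k < SL_width n)
    \big[raw_mul/raw_one]_(p : 'I_n * 'I_n | p.1 != p.2) raw_transvection p (a (k, p)).

(** Associativity of addition and the law for zero come from the group; the multiplicative unit law
    is contained in [coord_dom]. *)
Definition field_axioms : Prop :=
  (forall a b, coord_dom x s t a -> coord_dom x s t b ->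
     coord_dom x s t (a * b) /\ coord_dom x s t (fmul s t a b) /\
     a * b = b * a /\ fmul s t a b = fmul s t b a) /\
  (forall a b c, coord_dom x s t a -> coord_dom x s t b -> coord_dom x s t c ->
     fmul s t a (fmul s t b c) = fmul s t (fmul s t a b) c /\
     fmul s t (a * b) c = fmul s t a c * fmul s t b c) /\
  (forall a, coord_dom x s t a -> coord_dom x s t a^-1 /\
     (a <> 1 -> exists b, coord_dom x s t b /\ fmul s t b a = x)) /\
  coord_dom x s t 1 /\ coord_dom x s t x /\ x <> 1.

(** Being an equivalence, it also says that words with the same matrix coincide and that words with
    different matrices differ: take one factor to be a word for the identity. *)
Definition words_multiply (S : 'I_n * 'I_n -> G) : Prop :=
  forall a b c : index -> G, (forall i, coord_dom x s t (a i)) ->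
  (forall i, coord_dom x s t (b i)) -> (forall i, coord_dom x s t (c i)) ->
  (group_word S a * group_word S b = group_word S c <->
   forall i j, raw_mul (raw_word a) (raw_word b) i j = raw_word c i j).

Definition words_contain_commutators (S : 'I_n * 'I_n -> G) : Prop :=
  forall y z, exists a : index -> G,
  (forall i, coord_dom x s t (a i)) /\ [~ y, z] = group_word S a.

Definition words_and_center_generate (S : 'I_n * 'I_n -> G) : Prop :=
  forall y, exists (a : index -> G) z,
  (forall i, coord_dom x s t (a i)) /\ central z /\ y = group_word S a * z.
End RawMatrices.

Definition matrix_like : Prop :=
  exists x s t (S : 'I_n * 'I_n -> G),
  frame x s t /\ field_axioms x s t /\ words_multiply x s t S /\
  words_contain_commutators x s t S /\ words_and_center_generate x s t S.

Lemma raw_word_coord (K : fieldType) x s t (v : K -> G) (a : index -> K) :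
  coordinates x s t v ->
  raw_word x s t (fun i => v (a i)) = fun i j => v (word_mx a i j).
Proof.
move=> cv; pose f (A : 'M[K]_n) : 'I_n -> 'I_n -> G := fun i j => v (A i j).
have f1 : f 1%:M%R = raw_one x.
  apply/funext => i; apply/funext => j; rewrite /f /raw_one mxE.
  by case: eqP => _; [exact: coord_one cv | rewrite -(coord_zero cv)].
have fM A B : f (A *m B)%R = raw_mul s t (f A) (f B).
  apply/funext => i; apply/funext => j; rewrite /f /raw_mul mxE.
  rewrite (big_morph v (coord_add cv) (coord_zero cv)); apply: eq_bigr => k _.
  exact: coord_mul cv _ _.
rewrite -/(f _) /word_mx (big_morph f fM f1) /raw_word; apply: eq_bigr => k _.
rewrite (big_morph f fM f1); apply: eq_bigr => p _.
apply/funext => i; apply/funext => j; rewrite /raw_transvection -f1 /f /transvection !mxE.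
rewrite (coord_add cv); congr (_ * _).
by case: ifP => _; rewrite ?mulr1 ?mulr0 ?(coord_zero cv).
Qed.

Lemma raw_mul_coord (K : fieldType) x s t (v : K -> G) (A B : 'M[K]_n) i j :
  coordinates x s t v ->
  raw_mul s t (fun i j => v (A i j)) (fun i j => v (B i j)) i j = v ((A *m B)%R i j).
Proof.
move=> cv; rewrite mxE (big_morph v (coord_add cv) (coord_zero cv)).
by apply: eq_bigr => k _; rewrite (coord_mul cv).
Qed.

Lemma coordinates_field_axioms (K : fieldType) x s t (v : K -> G) :
  coordinates x s t v -> field_axioms x s t.
Proof.
move=> cv; have im a : coord_dom x s t (v a) by apply/(coord_im cv); exists a.
split; last split; last split; last split; last split.
- move=> _ _ /(coord_im cv)[a ->] /(coord_im cv)[b ->].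
  rewrite -!(coord_add cv) -!(coord_mul cv); split=> //; split=> //.
  by rewrite addrC mulrC.
- move=> _ _ _ /(coord_im cv)[a ->] /(coord_im cv)[b ->] /(coord_im cv)[c ->].
  by rewrite -!(coord_mul cv) -!(coord_add cv) -!(coord_mul cv) mulrA mulrDl.
- move=> _ /(coord_im cv)[a ->]; rewrite -(coord_opp _ cv); split=> // a1.
  have a0 : a != 0%R by apply/eqP => a0; apply: a1; rewrite a0 (coord_zero cv).
  by exists (v a^-1%R); rewrite -(coord_mul cv) mulVf // (coord_one cv).
- by rewrite -(coord_zero cv); exact: im.
- by have := im 1%R; rewrite (coord_one cv).
- by rewrite -(coord_one cv) -(coord_zero cv) => /(coord_inj cv)/eqP; rewrite oner_eq0.
Qed.
End MatrixLike.

(** * First-order definability of [matrix_like] *)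

Section DefinableFrames.
Variable C : context.
Implicit Types t : forall G : groupType, C G -> G.

Lemma definable_dcent tx tg : definable_term tx -> definable_term tg ->
  definable (C := C) (fun G c => dcent (tx G c) (tg G c)).
Proof.
move=> /(definable_weaken unit) dx /(definable_weaken unit) dg.
by prove_definable.
Qed.

Lemma definable_fmul ts tt ta tb : definable_term ts -> definable_term tt ->
  definable_term ta -> definable_term tb ->
  definable_term (C := C) (fun G c => fmul (ts G c) (tt G c) (ta G c) (tb G c)).
Proof. by move=> ds dt da db; prove_definable. Qed.

Lemma definable_coord_dom tx ts tt tg : definable_term tx -> definable_term ts ->
  definable_term tt -> definable_term tg ->
  definable (C := C) (fun G c => coord_dom (tx G c) (ts G c) (tt G c) (tg G c)).
Proof.
move=> dx ds dt dg; apply: definable_and; first exact: definable_dcent.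
by apply: definable_eq => //; apply: definable_fmul.
Qed.
End DefinableFrames.

Section DefinableMatrices.
Variables (C : context) (n : nat).
Local Notation index := ('I_(SL_width n) * ('I_n * 'I_n))%type.

Lemma definable_frame (tx ts tt : forall G : groupType, C G -> G) :
  definable_term tx -> definable_term ts -> definable_term tt ->
  definable (C := C) (fun G c => frame (tx G c) (ts G c) (tt G c)).
Proof.
(* The clauses of [frame] are regrouped into binary conjunctions, which [definable_and] can
   handle. *)
move=> dx ds dt; pose P G c := ~ central (tx G c) /\
  (forall g, dcent (tx G c) g -> ~ central g ->
     exists h z, central z /\ g = z * tx G c ^ h) /\
  (exists h, tx G c ^ h = tx G c * tx G c) /\
  fmul (ts G c) (tt G c) (tx G c) (tx G c) = tx G c /\
  commute (tx G c) (tx G c ^ ts G c) /\ commute (tx G c) (tx G c ^ tt G c).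
apply: (@definable_ext C P) => [G c|]; first by split=> [[? [? [? [? ?]]]] | []].
have dx1 := definable_weaken unit dx; have dx2 := definable_weaken unit dx1.
have dx3 := definable_weaken unit dx2.
repeat first [apply: definable_central | apply: definable_dcent
  | apply: definable_fmul | definable_step].
Qed.

Lemma definable_group_word (tS : forall G : groupType, C G -> 'I_n * 'I_n -> G)
    (ta : forall G : groupType, C G -> index -> G) :
  (forall p, definable_term (fun G c => tS G c p)) ->
  (forall i, definable_term (fun G c => ta G c i)) ->
  definable_term (C := C) (fun G c => group_word (tS G c) (ta G c)).
Proof.
move=> dS da; apply: definable_term_prod => k; apply: definable_term_prod => p.
exact: definable_termJ.
Qed.

Definition definable_raw (A : forall G : groupType, C G -> 'I_n -> 'I_n -> G) : Prop :=
  forall i j, definable_term (fun G c => A G c i j).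

Section Params.
Variables tx ts tt : forall G : groupType, C G -> G.
Hypotheses (dx : definable_term tx) (ds : definable_term ts) (dt : definable_term tt).

Lemma definable_raw_one : definable_raw (fun G c => raw_one (tx c)).
Proof. by move=> i j; rewrite /raw_one; case: (i == j); prove_definable. Qed.

Lemma definable_raw_mul A B : definable_raw A -> definable_raw B ->
  definable_raw (fun G c => raw_mul (ts c) (tt c) (A G c) (B G c)).
Proof. by move=> dA dB i j; apply: definable_term_prod => k; apply: definable_fmul. Qed.

Lemma definable_raw_prod (I : Type) (r : seq I) (p : pred I) A :
  (forall k, definable_raw (A k)) ->
  definable_raw (fun G c =>
    \big[raw_mul (ts c) (tt c)/raw_one (tx c)]_(k <- r | p k) A k G c).
Proof.
move=> dA; elim: r => [|k r IH] i j.
  by have [f tf] := definable_raw_one i j; exists f => G e; rewrite big_nil tf.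
have [f tf] := definable_raw_mul (dA k) IH i j; have [g tg] := IH i j.
by exists (if p k then f else g) => G e; rewrite big_cons; case: (p k).
Qed.

Lemma definable_raw_word (ta : forall G : groupType, C G -> index -> G) :
  (forall i, definable_term (fun G c => ta G c i)) ->
  definable_raw (fun G c => raw_word (tx c) (ts c) (tt c) (ta G c)).
Proof.
move=> da; apply: definable_raw_prod => k; apply: definable_raw_prod => p i j.
apply: definable_termM; first exact: definable_raw_one.
by case: (_ && _); prove_definable.
Qed.
End Params.
End DefinableMatrices.

Lemma definable_matrix_like n : definable (C := empty_ctx) (fun G _ => matrix_like G n).
Proof.
repeat first [apply: definable_frame | apply: definable_central
  | apply: definable_coord_dom | apply: definable_fmul | apply: definable_group_word => ?
  | apply: definable_raw_mul | apply: definable_raw_word | definable_step | move=> ?].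
Qed.

Lemma closed_root (F : closedFieldType) n (a : F) : (0 < n)%N -> exists b, (b ^+ n = a)%R.
Proof.
move=> n_gt0; have [b] := @solve_monicpoly F n (fun i => if i == 0%N then a else 0%R) n_gt0.
rewrite (bigD1 (Ordinal n_gt0)) //= mulr1 big1 ?addr0 => [|i]; first by exists b.
by rewrite -val_eqE /= => /negPf->; rewrite mul0r.
Qed.

Section GLMatrixLike.
Variables (F : closedFieldType) (m : nat).
Hypothesis F_char0 : [pchar F]%R =i pred0.
Local Notation n := m.+1.

Lemma GL_split (g : GL n F) : exists h z : GL n F,
  [/\ (\det (val h) = 1)%R, central z & g = h * z].
Proof.
have [d dn] := @closed_root F n (\det (val g)) (ltn0Sn m).
have d0 : d != 0%R.
  apply/eqP => d0; have := valP g; rewrite /= unitmxE -dn d0 expr0n unitr0 //.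
have ud : (d%:M : 'M[F]_n)%R \in unitmx by rewrite unitmxE det_scalar unitrX ?unitfE.
have cd : central (gl d%:M : GL n F)%R by apply/central_GLP; exists d; rewrite val_gl.
exists (g * (gl (d%:M)%R)^-1), (gl (d%:M)%R); split=> //; last by rewrite mulgVK.
rewrite val_GLM val_GLV val_gl // det_mulmx det_inv det_scalar -dn divff //.
by rewrite expf_neq0.
Qed.

Lemma GL_matrix_like : (3 <= n)%N -> matrix_like (GL n F) n.
Proof.
move=> n3; pose i : 'I_n := Ordinal (ltn0Sn m).
pose j : 'I_n := Ordinal (ltnW n3); pose k : 'I_n := Ordinal n3.
have ij : i != j by []. have jk : j != k by []. have ik : i != k by [].
have [s sP] := @gl_trans_conj F m (i, k) (i, j) ik ij.
have [t tP] := @gl_trans_conj F m (i, k) (j, k) ik jk.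
have fr := standard_frame F_char0 ij jk ik sP tP.
have [M [_ _ xM cv]] := frame_coordinates F_char0 fr.
(* [M] is determined by [x], so these coordinates are the standard root subgroup. *)
have ME : M = delta_mx i k by move: xM; rewrite val_gl_trans // /transvection scale1r => /addrI.
rewrite {M xM}ME in cv.
have /choice[S SP] : forall p : 'I_n * 'I_n, exists g : GL n F, p.1 != p.2 ->
    forall c, gl_trans (i, k) c ^ g = gl_trans p c.
  move=> p; have [p12|p12] := boolP (p.1 != p.2); last by exists 1.
  by have [h hP] := @gl_trans_conj F m (i, k) p ik p12; exists h.
have wordE a : val (group_word S (fun l => root_elt (delta_mx i k) (a l))) = word_mx a.
  rewrite /group_word (big_morph _ (@val_GLM _ _) (@val_GL1 _ _)); apply: eq_bigr => l _.
  rewrite (big_morph _ (@val_GLM _ _) (@val_GL1 _ _)); apply: eq_bigr => p p12.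
  by rewrite root_elt_delta SP // val_gl_trans.
have dom a : (forall l, coord_dom (gl_trans (i, k) 1) s t (a l)) ->
    exists b, a = fun l => root_elt (delta_mx i k) (b l).
  move=> aD; have /choice[b bP] : forall l, exists c, a l = root_elt (delta_mx i k) c.
    by move=> l; apply/(coord_im cv).
  by exists b; apply/funext.
have inD c : coord_dom (gl_trans (i, k) 1) s t (root_elt (delta_mx i k) c).
  by apply/(coord_im cv); exists c.
have surj (g : GL n F) : (\det (val g) = 1)%R -> exists a,
    (forall l, coord_dom (gl_trans (i, k) 1) s t (a l)) /\ g = group_word S a.
  move=> /word_mx_surj[a aP]; exists (fun l => root_elt (delta_mx i k) (a l)); split=> //.
  by apply: val_inj; rewrite wordE.
exists (gl_trans (i, k) 1), s, t, S; split=> //; split; first exact: coordinates_field_axioms cv.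
split; last split.
- move=> _ _ _ /dom[a ->] /dom[b ->] /dom[c ->].
  rewrite !(raw_word_coord _ cv); split=> [abc i' j'|abc].
    by rewrite (raw_mul_coord _ _ _ _ cv) -!wordE -val_GLM abc.
  apply: val_inj; rewrite val_GLM !wordE; apply/matrixP => i' j'.
  by apply: (coord_inj cv); rewrite -(raw_mul_coord _ _ _ _ cv).
- move=> y z; apply: surj; rewrite !val_GLM !val_GLV !det_mulmx !det_inv.
  have uy : (\det (val y) != 0)%R by rewrite -unitfE -unitmxE; exact: valP y.
  have uz : (\det (val z) != 0)%R by rewrite -unitfE -unitmxE; exact: valP z.
  by field; rewrite uz.
- move=> y; have [h [z [/surj[a [aD ->]] cz ->]]] := GL_split y.
  by exists a, z.
Qed.
End GLMatrixLike.

(** * Reconstructing the field and the special linear group *)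

(** Bundling the axioms with the frame lets the type [coord_field R] carry its field structure
    through canonical instances. *)
Record field_frame (G : groupType) := FieldFrame {
  ff_x : G;
  ff_s : G;
  ff_t : G;
  ff_axioms : field_axioms ff_x ff_s ff_t
}.

Section CoordinateField.
Variables (G : groupType) (R : field_frame G).
Let x := ff_x R.
Let s := ff_s R.
Let t := ff_t R.

Definition coord_pred : {pred G} := fun g => `[< coord_dom x s t g >].

Lemma coord_predP g : reflect (coord_dom x s t g) (g \in coord_pred).
Proof. exact: asboolP. Qed.

Definition coord_field : Type := {g : G | g \in coord_pred}.
HB.instance Definition _ := SubChoice.on coord_field.
Implicit Types a b c : coord_field.

Lemma coordP a : coord_dom x s t (val a).
Proof. exact/coord_predP/valP. Qed.

Let axD a b := (ff_axioms R).1 _ _ (coordP a) (coordP b).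
Let axM a b c := (ff_axioms R).2.1 _ _ _ (coordP a) (coordP b) (coordP c).
Let axV a := (ff_axioms R).2.2.1 _ (coordP a).
Let ax0 := (ff_axioms R).2.2.2.1.
Let ax1 := (ff_axioms R).2.2.2.2.1.

Definition coord_val g (gD : coord_dom x s t g) : coord_field := Sub g (introT (coord_predP g) gD).

Definition cf_add a b := coord_val (proj1 (axD a b)).
Definition cf_mul a b := coord_val (proj1 (proj2 (axD a b))).
Definition cf_opp a := coord_val (proj1 (axV a)).
Definition cf_zero := coord_val ax0.
Definition cf_one := coord_val ax1.

Fact cf_addA : associative cf_add.
Proof. by move=> a b c; apply: val_inj; rewrite /= mulgA. Qed.
Fact cf_addC : commutative cf_add.
Proof. by move=> a b; apply: val_inj; case: (axD a b) => _ [_ []]. Qed.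
Fact cf_add0 : left_id cf_zero cf_add.
Proof. by move=> a; apply: val_inj; rewrite /= mul1g. Qed.
Fact cf_addN : left_inverse cf_zero cf_opp cf_add.
Proof. by move=> a; apply: val_inj; rewrite /= mulVg. Qed.

HB.instance Definition _ := GRing.isZmodule.Build coord_field cf_addA cf_addC cf_add0 cf_addN.

Fact cf_mulA : associative cf_mul.
Proof. by move=> a b c; apply: val_inj; case: (axM a b c). Qed.
Fact cf_mulC : commutative cf_mul.
Proof. by move=> a b; apply: val_inj; case: (axD a b) => _ [_ []]. Qed.
Fact cf_mul1 : left_id cf_one cf_mul.
Proof. by move=> a; rewrite cf_mulC; apply: val_inj; case: (coordP a). Qed.
Fact cf_mulD : left_distributive cf_mul +%R.
Proof. by move=> a b c; apply: val_inj; case: (axM a b c). Qed.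
Fact cf_one_neq0 : cf_one != 0%R.
Proof. by apply/eqP => /(congr1 val); case: (ff_axioms R) => _ [_ [_ [_ []]]]. Qed.

HB.instance Definition _ := GRing.Zmodule_isComNzRing.Build coord_field
  cf_mulA cf_mulC cf_mul1 cf_mulD cf_one_neq0.

Fact cf_inv_exists a : exists b : coord_field,
  (a != 0%R -> (b * a = 1)%R) /\ (a = 0%R -> b = 0%R).
Proof.
have [->|a0] := eqVneq a 0%R; first by exists 0%R.
have [|g [gD ga]] := proj2 (axV a).
  by move=> a1; move/eqP: a0; apply; apply: val_inj.
by exists (coord_val gD); split=> [_|a00]; [apply: val_inj | rewrite a00 eqxx in a0].
Qed.

Definition cf_inv a : coord_field := projT1 (cid (cf_inv_exists a)).

Fact cf_mulV a : a != 0%R -> (cf_inv a * a = 1)%R.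
Proof. by rewrite /cf_inv; case: cid => b /= []. Qed.
Fact cf_inv0 : cf_inv 0%R = 0%R.
Proof. by rewrite /cf_inv; case: cid => b /= [_ ->]. Qed.

HB.instance Definition _ := GRing.ComNzRing_isField.Build coord_field cf_mulV cf_inv0.

Lemma coord_field_coordinates : coordinates x s t (val : coord_field -> G).
Proof.
split=> //; first exact: val_inj.
move=> g; split=> [gD|[a ->]]; last exact: coordP.
by exists (coord_val gD).
Qed.
End CoordinateField.

Lemma group_isoI (G H : groupType) (f : G -> H) : {morph f : x y / x * y} ->
  injective f -> (forall y, exists x, f x = y) -> G ≅ H.
Proof.
move=> fM f_inj /choice[g gP].
pose fm : {multiplicative G -> H} := HB.pack f (isMultiplicative.Build G H f fM).
exists fm; exists g => // x; apply: f_inj; exact: gP.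
Qed.

Lemma commutator_derived (G : groupType) (y z : G) : [~ y, z] \in @derived_pred G.
Proof. by apply/asboolP => S _; apply. Qed.

Lemma derived_mul (G : groupType) (y z : G) :
  y \in @derived_pred G -> z \in @derived_pred G -> y * z \in @derived_pred G.
Proof. exact: (group_closedM (derived_closed G)). Qed.

Lemma derived_conj (G : groupType) (y z : G) :
  y \in @derived_pred G -> y ^ z \in @derived_pred G.
Proof.
move=> yD; have -> : y ^ z = y * [~ y, z] by rewrite commgEl mulVKg.
exact: derived_mul yD (commutator_derived _ _).
Qed.

(** The equation [fmul g x = g] in [coord_dom] exhibits every root element as a commutator. *)
Lemma group_word_derived (G : groupType) n (x s t : G) (S : 'I_n * 'I_n -> G) a :
  (forall l, coord_dom x s t (a l)) -> group_word S a \in @derived_pred G.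
Proof.
move=> aD; have D1 : 1 \in @derived_pred G by case: (derived_closed G).
apply: (big_ind (fun g => g \in @derived_pred G)) => [//||k _]; first exact: derived_mul.
apply: (big_ind (fun g => g \in @derived_pred G)) => [//||p _]; first exact: derived_mul.
by apply: derived_conj; case: (aD (k, p)) => _ <-; apply: commutator_derived.
Qed.

Section SpecialLinear.
Variables (G : groupType) (n : nat) (L : fieldType).
Variables (x s t : G) (S : 'I_n * 'I_n -> G) (v : L -> G).
Hypotheses (cv : coordinates x s t v) (mul : words_multiply x s t S).
Hypothesis comm : words_contain_commutators x s t S.

Let vD a : coord_dom x s t (v a).
Proof. by apply/(coord_im cv); exists a. Qed.

Lemma group_word_mul a b c :
  group_word S (v \o a) * group_word S (v \o b) = group_word S (v \o c) <->
  (word_mx a *m word_mx b = word_mx c)%R.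
Proof.
rewrite mul; try by move=> l; apply: vD.
rewrite !(raw_word_coord _ cv); split=> [abc|abc i j]; last first.
  by rewrite (raw_mul_coord _ _ _ _ cv) abc.
apply/matrixP => i j; apply: (coord_inj cv).
by rewrite -(raw_mul_coord _ _ _ _ cv).
Qed.

(** Sending a matrix to any word for it is well defined, multiplicative and injective by
    [group_word_mul]. The image lies in the derived subgroup and is a subgroup containing all
    commutators, so it is all of it. *)
Lemma derived_iso_SL : derived G ≅ SL n L.
Proof.
have /choice[w wP] : forall A : SL n L, exists a, val (val A) = word_mx a.
  by move=> A; apply: word_mx_surj; apply/eqP; exact: valP A.
pose f A := group_word S (v \o w A).
have fM : {morph f : A B / A * B} by move=> A B; apply/esym/group_word_mul; rewrite -!wP.
have f1 : f 1 = 1 by apply: (mulgI (f 1)); rewrite -fM !mulg1.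
have fV A : f A^-1 = (f A)^-1 by apply: (mulgI (f A)); rewrite -fM !mulgV f1.
have f_inj : injective f.
  move=> A B AB; do 2!apply: val_inj; rewrite wP [RHS]wP.
  have : (word_mx (w A) *m word_mx (w 1%g) = word_mx (w B))%R.
    by apply/group_word_mul; rewrite -/(f A) -/(f 1) -/(f B) f1 mulg1.
  by rewrite -(wP 1) mulmx1.
have fE a A : val (val A) = word_mx a -> group_word S (v \o a) = f A.
  move=> aA; rewrite -[LHS]mulg1 -f1; apply/group_word_mul.
  by rewrite -(wP 1) mulmx1 -aA wP.
have f_derived A : f A \in @derived_pred G.
  by apply: (@group_word_derived _ _ x s t) => l; apply: vD.
have f_surj g : g \in @derived_pred G -> exists A, f A = g.
  move/asboolP/(_ (fun g => `[< exists A, f A = g >])) => H; apply/asboolP/H.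
    split; first by apply/asboolP; exists 1.
    by move=> _ _ /asboolP[A <-] /asboolP[B <-]; apply/asboolP; exists (A * B^-1); rewrite fM fV.
  move=> y z; apply/asboolP; have [a [aD ->]] := comm y z.
  have /choice[b bP] : forall l, exists c, a l = v c by move=> l; apply/(coord_im cv).
  have uA : word_mx b \in unitmx by rewrite unitmxE det_word_mx unitr1.
  have sA : (gl (word_mx b) : GL n L) \in @SL_pred n L.
    by rewrite unfold_in /SL_pred val_gl // det_word_mx.
  exists (Sub (gl (word_mx b)) sA); rewrite -(fE b) ?SubK ?val_gl //.
  by congr group_word; apply/funext => l; rewrite bP.
have /choice[h hP] : forall g : derived G, exists A, f A = val g.
  by move=> g; apply: f_surj; exact: valP g.
apply: (@group_isoI _ _ h).
- by move=> y z; apply: f_inj; rewrite hP fM !hP.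
- by move=> y z yz; apply: val_inj; rewrite -!hP yz.
- by move=> A; exists (Sub (f A) (f_derived A)); apply: f_inj; rewrite hP SubK.
Qed.
End SpecialLinear.

(** * Translating ring formulas into group formulas *)

Section RingToGroup.

(* Variables 0, 1, 2 hold the frame, variable 3 is bound in [coord_dom_formula], and the
   ring variable [i] becomes the group variable [4 + i]. *)
Definition conj_term (t u : group_term) : group_term := GMul (GInv u) (GMul t u).

Definition fmul_term (t u : group_term) : group_term :=
  let a := conj_term t (GVar 1) in let b := conj_term u (GVar 2) in
  GMul (GInv a) (conj_term a b).

Fixpoint ring_to_group_term (t : ring_term) : group_term :=
  match t with
  | RVar i => GVar (4 + i)
  | RZero => GOne
  | ROne => GVar 0
  | RAdd t u => GMul (ring_to_group_term t) (ring_to_group_term u)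
  | ROpp t => GInv (ring_to_group_term t)
  | RMul t u => fmul_term (ring_to_group_term t) (ring_to_group_term u)
  end.

Definition commute_formula i j : formula group_term :=
  Equals (GMul (GVar i) (GVar j)) (GMul (GVar j) (GVar i)).

Definition coord_dom_formula k : formula group_term :=
  Conj (Forall 3 (Impl (commute_formula 3 0) (commute_formula 3 k)))
       (Equals (fmul_term (GVar k) (GVar 0)) (GVar k)).

Fixpoint ring_to_group (f : formula ring_term) : formula group_term :=
  match f with
  | Falsum => Falsum
  | Equals t u => Equals (ring_to_group_term t) (ring_to_group_term u)
  | Conj f g => Conj (ring_to_group f) (ring_to_group g)
  | Disj f g => Disj (ring_to_group f) (ring_to_group g)
  | Impl f g => Impl (ring_to_group f) (ring_to_group g)
  | Forall i f => Forall (4 + i) (Impl (coord_dom_formula (4 + i)) (ring_to_group f))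
  | Exists i f => Exists (4 + i) (Conj (coord_dom_formula (4 + i)) (ring_to_group f))
  end.

Lemma holds_coord_dom (G : groupType) (E : nat -> G) i :
  holds (@group_eval G) E (coord_dom_formula (4 + i)) <->
  coord_dom (E 0%N) (E 1%N) (E 2%N) (E (4 + i)%N).
Proof. by []. Qed.

Variables (G : groupType) (x s t : G) (R : nzRingType) (v : R -> G).
Hypothesis cv : coordinates x s t v.

Lemma ring_to_group_termE (e : nat -> R) (E : nat -> G) u :
  E 0%N = x -> E 1%N = s -> E 2%N = t ->
  {in ring_term_vars u, forall i, E (4 + i)%N = v (e i)} ->
  group_eval E (ring_to_group_term u) = v (ring_eval e u).
Proof.
move=> E0 E1 E2; elim: u => [i|||u IHu w IHw|u IHu|u IHu w IHw] /= eE.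
- by apply: eE; rewrite inE.
- by rewrite (coord_zero cv).
- by rewrite (coord_one cv).
- rewrite IHu ?IHw ?(coord_add cv) // => j jt; apply: eE; by rewrite mem_cat jt ?orbT.
- by rewrite IHu ?(coord_opp _ cv).
- rewrite E1 E2 IHu ?IHw ?(coord_mul cv) // => j jt; apply: eE; by rewrite mem_cat jt ?orbT.
Qed.

Lemma ring_to_groupE f (e : nat -> R) (E : nat -> G) :
  E 0%N = x -> E 1%N = s -> E 2%N = t ->
  {in free_vars ring_term_vars f, forall i, E (4 + i)%N = v (e i)} ->
  holds (@ring_eval R) e f <-> holds (@group_eval G) E (ring_to_group f).
Proof.
elim: f e E => [|u w|f IHf g IHg|f IHf g IHg|f IHf g IHg|i f IHf|i f IHf] e E E0 E1 E2 /= eE.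
- by [].
- have eEu : {in ring_term_vars u, forall i, E (4 + i)%N = v (e i)}.
    by move=> j ju; apply: eE; rewrite mem_cat ju.
  have eEw : {in ring_term_vars w, forall i, E (4 + i)%N = v (e i)}.
    by move=> j ju; apply: eE; rewrite mem_cat ju orbT.
  rewrite (ring_to_group_termE E0 E1 E2 eEu) (ring_to_group_termE E0 E1 E2 eEw).
  by split=> [->|/(coord_inj cv)].
1-3: have {}IHf : holds (@ring_eval R) e f <-> holds (@group_eval G) E (ring_to_group f)
  by apply: IHf => // j jf; apply: eE; rewrite mem_cat jf.
1-3: have {}IHg : holds (@ring_eval R) e g <-> holds (@group_eval G) E (ring_to_group g)
  by apply: IHg => // j jf; apply: eE; rewrite mem_cat jf orbT.
1-3: by rewrite IHf IHg.
- have domE g : coord_dom x s t g <->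
      holds (@group_eval G) [eta E with (4 + i)%N |-> g] (coord_dom_formula (4 + i)).
    by rewrite holds_coord_dom /= eqxx E0 E1 E2.
  have IH (a : R) : holds (@ring_eval R) [eta e with i |-> a] f <->
      holds (@group_eval G) [eta E with (4 + i)%N |-> v a] (ring_to_group f).
    apply: IHf => // j jf; rewrite /= eqn_add2l; case: eqP => // /eqP ji.
    by apply: eE; rewrite mem_filter ji.
  split=> [H g /domE/(coord_im cv)[a ->]|H a]; first exact/IH/H.
  by apply/IH/H/domE/(coord_im cv); exists a.
- have domE g : coord_dom x s t g <->
      holds (@group_eval G) [eta E with (4 + i)%N |-> g] (coord_dom_formula (4 + i)).
    by rewrite holds_coord_dom /= eqxx E0 E1 E2.
  have IH (a : R) : holds (@ring_eval R) [eta e with i |-> a] f <->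
      holds (@group_eval G) [eta E with (4 + i)%N |-> v a] (ring_to_group f).
    apply: IHf => // j jf; rewrite /= eqn_add2l; case: eqP => // /eqP ji.
    by apply: eE; rewrite mem_filter ji.
  split=> [[a H]|[g [/domE/(coord_im cv)[a ->] H]]]; last by exists a; apply/IH.
  exists (v a); split; last exact/IH.
  by apply/domE/(coord_im cv); exists a.
Qed.
End RingToGroup.

Lemma ring_eval_eq_in (R : nzRingType) (e1 e2 : nat -> R) t :
  {in ring_term_vars t, e1 =1 e2} -> ring_eval e1 t = ring_eval e2 t.
Proof.
elim: t => [i|||t IHt u IHu|t IHt|t IHt u IHu] //= e12; last 2 first.
- by rewrite IHt.
- by rewrite IHt 1?IHu // => j jt; apply: e12; rewrite mem_cat jt ?orbT.
- by apply: e12; rewrite inE.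
- by rewrite IHt 1?IHu // => j jt; apply: e12; rewrite mem_cat jt ?orbT.
Qed.

Lemma holds_ring_sentence (R : nzRingType) f (e1 e2 : nat -> R) :
  sentence ring_term_vars f -> holds (@ring_eval R) e1 f -> holds (@ring_eval R) e2 f.
Proof.
move=> sf; apply (holds_eq_in (tv := ring_term_vars)); last by move=> i; rewrite sf.
exact: ring_eval_eq_in.
Qed.

(** One implication suffices because it applies to the negation of a sentence as well. *)
Lemma ring_elem_equivI (R S : nzRingType) :
  (forall f, sentence ring_term_vars f ->
     (forall e, holds (@ring_eval S) e f) -> forall e, holds (@ring_eval R) e f) -> R ≡r S.
Proof.
move=> SR f sf; split; last exact: SR.
move=> Rf e; apply: contrapT => nf.
have sn : sentence ring_term_vars (Impl f Falsum) by rewrite /sentence /= sf.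
apply: (SR _ sn _ (fun=> 0%R)) (Rf _) => e' /= fe'.
by apply: nf; apply: holds_ring_sentence fe'.
Qed.

Lemma frame_formula : exists f, forall (G : groupType) (E : nat -> G),
  holds (@group_eval G) E f <-> frame (E 0%N) (E 1%N) (E 2%N).
Proof.
pose C := ctx_add (ctx_add (ctx_add empty_ctx unit) unit) unit.
have [f fP] : definable (C := C) (fun G c => frame (c.1.1.2 tt) (c.1.2 tt) (c.2 tt)).
  by repeat first [apply: definable_frame | definable_step].
exists f => G E; rewrite fP /=.
have tt0 : nat_of_ord (enum_rank tt) = 0%N.
  by have := ltn_ord (enum_rank tt); rewrite {2}card_unit; case: (nat_of_ord _).
by rewrite !tt0 !card_unit.
Qed.

(** The frame stays in free variables. That a frame satisfies the translated sentence is valid in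
    [GL m.+1 F], since each frame there coordinatizes [F]; this passes to [H] and is evaluated at
    the given frame. *)
Lemma coordinates_ring_equiv (F : closedFieldType) m (H : groupType) x s t
    (L : nzRingType) (v : L -> H) :
  [pchar F]%R =i pred0 -> H ≡g GL m.+1 F -> frame x s t -> coordinates x s t v -> L ≡r F.
Proof.
move=> F_char0 HG fr cv; apply: ring_elem_equivI => f sf Ff e.
have [ff ffP] := frame_formula.
have : forall E, holds (@group_eval (GL m.+1 F)) E (Impl ff (ring_to_group f)).
  move=> E /= /ffP/(frame_coordinates F_char0)[M [_ _ _ cM]].
  have fvf : {in free_vars ring_term_vars f, forall i, E (4 + i)%N = root_elt M 0%R}.
    by move=> i; rewrite sf.
  by apply/(ring_to_groupE cM erefl erefl erefl fvf).
move/(elem_equivP HG _).2 => HE.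
pose E i := match i with 0 => x | 1 => s | 2 => t | _ => 1 end.
have fvf : {in free_vars ring_term_vars f, forall i, E (4 + i)%N = v (e i)}.
  by move=> i; rewrite sf.
have E0 : E 0%N = x by []. have E1 : E 1%N = s by []. have E2 : E 2%N = t by [].
by apply/(ring_to_groupE cv E0 E1 E2 fvf)/(HE E)/ffP.
Qed.

(** * Translating group formulas into ring formulas *)

Section GroupToRing.
Variable n : nat.
Local Notation entry := (bool * ('I_n * 'I_n))%type.

(* A group variable is translated into the entries of a matrix and of its inverse, the
   boolean being [true] for the latter. *)
Definition entry_var (i : nat) (q : entry) : nat := (i * #|{: entry}| + enum_rank q)%N.

Definition mul_terms (A B : 'I_n -> 'I_n -> ring_term) : 'I_n -> 'I_n -> ring_term :=
  fun a b => foldr RAdd RZero [seq RMul (A a k) (B k b) | k <- enum 'I_n].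

Definition one_terms : 'I_n -> 'I_n -> ring_term := fun a b => if a == b then ROne else RZero.

(** With [w] true these are the entries of the inverse of the value: products reverse, and an
    inversion merely flips the flag instead of requiring a division. *)
Fixpoint group_to_ring_term (t : group_term) (w : bool) : 'I_n -> 'I_n -> ring_term :=
  match t with
  | GVar i => fun a b => RVar (entry_var i (w, (a, b)))
  | GOne => one_terms
  | GMul t u =>
      if w then mul_terms (group_to_ring_term u w) (group_to_ring_term t w)
      else mul_terms (group_to_ring_term t w) (group_to_ring_term u w)
  | GInv t => group_to_ring_term t (~~ w)
  end.

Definition eq_terms (A B : 'I_n -> 'I_n -> ring_term) : formula ring_term :=
  foldr (fun p => Conj (Equals (A p.1 p.2) (B p.1 p.2))) (Impl Falsum Falsum)
    (enum {: 'I_n * 'I_n}).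

Definition inverse_formula (i : nat) : formula ring_term :=
  eq_terms (mul_terms (group_to_ring_term (GVar i) false) (group_to_ring_term (GVar i) true))
    one_terms.

Fixpoint group_to_ring (f : formula group_term) : formula ring_term :=
  match f with
  | Falsum => Falsum
  | Equals t u => eq_terms (group_to_ring_term t false) (group_to_ring_term u false)
  | Conj f g => Conj (group_to_ring f) (group_to_ring g)
  | Disj f g => Disj (group_to_ring f) (group_to_ring g)
  | Impl f g => Impl (group_to_ring f) (group_to_ring g)
  | Forall i f => foldr (@Forall _) (Impl (inverse_formula i) (group_to_ring f))
      (iota (i * #|{: entry}|) #|{: entry}|)
  | Exists i f => foldr (@Exists _) (Conj (inverse_formula i) (group_to_ring f))
      (iota (i * #|{: entry}|) #|{: entry}|)
  end.

Variable K : fieldType.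
Implicit Types (E : nat -> K) (e : nat -> GL n K).

Definition eval_terms E (A : 'I_n -> 'I_n -> ring_term) : 'M[K]_n :=
  (\matrix_(a, b) ring_eval E (A a b))%R.

Lemma eval_mul_terms E A B :
  eval_terms E (mul_terms A B) = (eval_terms E A *m eval_terms E B)%R.
Proof.
apply/matrixP => a b; rewrite !mxE /mul_terms -big_enum.
elim: (enum 'I_n) => [|k r IH] /=; first by rewrite big_nil.
by rewrite big_cons IH !mxE.
Qed.

Lemma eval_one_terms E : eval_terms E one_terms = 1%:M%R.
Proof. by apply/matrixP => a b; rewrite !mxE /one_terms; case: eqP. Qed.

Lemma holds_eq_terms E A B :
  holds (@ring_eval K) E (eq_terms A B) <-> eval_terms E A = eval_terms E B.
Proof.
have -> : holds (@ring_eval K) E (eq_terms A B) <->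
    forall p, p \in enum {: 'I_n * 'I_n} ->
      ring_eval E (A p.1 p.2) = ring_eval E (B p.1 p.2).
  rewrite /eq_terms; elim: (enum _) => [|p r IH] /=; first by split.
  rewrite IH; split=> [[pE rE] q|rE]; first by rewrite inE => /predU1P[->|/rE].
  by split=> [|q qr]; apply: rE; rewrite inE ?eqxx ?qr ?orbT.
split=> [AB|/matrixP AB p _]; last by have := AB p.1 p.2; rewrite !mxE.
by apply/matrixP => a b; rewrite !mxE; apply: (AB (a, b)); rewrite mem_enum.
Qed.

Definition codes E e (i : nat) : Prop :=
  eval_terms E (group_to_ring_term (GVar i) false) = val (e i) /\
  eval_terms E (group_to_ring_term (GVar i) true) = invmx (val (e i)).

Lemma group_to_ring_termE E e t : {in group_term_vars t, forall i, codes E e i} ->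
  eval_terms E (group_to_ring_term t false) = val (group_eval e t) /\
  eval_terms E (group_to_ring_term t true) = invmx (val (group_eval e t)).
Proof.
elim: t => [i||t IHt u IHu|t IHt] eE.
- by apply: eE; rewrite inE.
- by rewrite !eval_one_terms /= invmx1.
- have [tX tY] : eval_terms E (group_to_ring_term t false) = val (group_eval e t) /\
      eval_terms E (group_to_ring_term t true) = invmx (val (group_eval e t)).
    by apply: IHt => j jt; apply: eE; rewrite mem_cat jt.
  have [uX uY] : eval_terms E (group_to_ring_term u false) = val (group_eval e u) /\
      eval_terms E (group_to_ring_term u true) = invmx (val (group_eval e u)).
    by apply: IHu => j ju; apply: eE; rewrite mem_cat ju orbT.
  rewrite /= !eval_mul_terms tX tY uX uY; split=> //.
  by apply/esym; exact: (congr1 val (invgM (group_eval e t) (group_eval e u))).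
- have [tX tY] := IHt eE; rewrite /= tX tY; split=> //.
  by rewrite invmxK.
Qed.

Lemma codes_update E e i g v j : codes E e j \/ j = i ->
  eval_terms (update E (i * #|{: entry}|) #|{: entry}| v)
    (group_to_ring_term (GVar i) false) = val g ->
  eval_terms (update E (i * #|{: entry}|) #|{: entry}| v)
    (group_to_ring_term (GVar i) true) = invmx (val g) ->
  codes (update E (i * #|{: entry}|) #|{: entry}| v) [eta e with i |-> g] j.
Proof.
move=> ej X Y; rewrite /codes /=; have [->//|ji] := eqVneq j i.
have E_eq w :
    eval_terms (update E (i * #|{: entry}|) #|{: entry}| v) (group_to_ring_term (GVar j) w) =
    eval_terms E (group_to_ring_term (GVar j) w).
  apply/matrixP => a b; rewrite !mxE /= /update /entry_var.
  have := ltn_ord (enum_rank (w, (a, b))); case: ifP => //.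
  move: ji; move: (nat_of_ord _) => r; move: #|_| => d ji /andP[i1 i2] rd; exfalso.
  case: (ltngtP j i) ji => // ij _; have := leq_mul ij (leqnn d); rewrite mulSn; lia.
by case: ej => [[eX eY]|/eqP]; [rewrite /= in E_eq; rewrite !E_eq | rewrite (negPf ji)].
Qed.

Lemma update_entry E i v (q : entry) :
  update E (i * #|{: entry}|) #|{: entry}| v (entry_var i q) = v (enum_rank q).
Proof. by rewrite /update /entry_var leq_addr ltn_add2l ltn_ord addKn. Qed.

Lemma codes_exists E i (g : GL n K) : exists v,
  eval_terms (update E (i * #|{: entry}|) #|{: entry}| v) (group_to_ring_term (GVar i) false)
    = val g /\
  eval_terms (update E (i * #|{: entry}|) #|{: entry}| v) (group_to_ring_term (GVar i) true)
    = invmx (val g).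
Proof.
have [v vE] := block_surj 0%R
  (fun q : entry => if q.1 then invmx (val g) q.2.1 q.2.2 else val g q.2.1 q.2.2).
have {}vE q : v (enum_rank q) = if q.1 then invmx (val g) q.2.1 q.2.2 else val g q.2.1 q.2.2.
  by rewrite -[LHS]/((fun q => v (enum_rank q)) q) vE.
by exists v; split; apply/matrixP => a b; rewrite mxE /= update_entry vE.
Qed.

Lemma holds_inverse_formula E i : holds (@ring_eval K) E (inverse_formula i) ->
  exists g : GL n K, eval_terms E (group_to_ring_term (GVar i) false) = val g /\
    eval_terms E (group_to_ring_term (GVar i) true) = invmx (val g).
Proof.
move=> /holds_eq_terms; rewrite eval_mul_terms eval_one_terms => XY.
have [uX _] := mulmx1_unit XY; exists (gl (eval_terms E (group_to_ring_term (GVar i) false))).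
by rewrite val_gl //; split=> //; rewrite -[LHS](mulKmx uX) XY mulmx1.
Qed.

Lemma inverse_formula_holds E i (g : GL n K) :
  eval_terms E (group_to_ring_term (GVar i) false) = val g ->
  eval_terms E (group_to_ring_term (GVar i) true) = invmx (val g) ->
  holds (@ring_eval K) E (inverse_formula i).
Proof.
move=> X Y; apply/holds_eq_terms; rewrite eval_mul_terms eval_one_terms X Y.
by rewrite mulmxV //; exact: valP g.
Qed.

Lemma group_to_ringE f E e : {in free_vars group_term_vars f, forall i, codes E e i} ->
  holds (@group_eval (GL n K)) e f <-> holds (@ring_eval K) E (group_to_ring f).
Proof.
elim: f E e => [|t u|f IHf g IHg|f IHf g IHg|f IHf g IHg|i f IHf|i f IHf] E e eE //.
- have [tX _] : eval_terms E (group_to_ring_term t false) = val (group_eval e t) /\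
      eval_terms E (group_to_ring_term t true) = invmx (val (group_eval e t)).
    by apply: group_to_ring_termE => j jt; apply: eE; rewrite mem_cat jt.
  have [uX _] : eval_terms E (group_to_ring_term u false) = val (group_eval e u) /\
      eval_terms E (group_to_ring_term u true) = invmx (val (group_eval e u)).
    by apply: group_to_ring_termE => j ju; apply: eE; rewrite mem_cat ju orbT.
  by rewrite holds_eq_terms tX uX; split=> [/= ->|/val_inj].
1-3: have {}IHf : holds (@group_eval (GL n K)) e f <-> holds (@ring_eval K) E (group_to_ring f)
  by apply: IHf => // j jf; apply: eE; rewrite mem_cat jf.
1-3: have {}IHg : holds (@group_eval (GL n K)) e g <-> holds (@ring_eval K) E (group_to_ring g)
  by apply: IHg => // j jf; apply: eE; rewrite mem_cat jf orbT.
1-3: by rewrite /= IHf IHg.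
- have IH g v := IHf (update E (i * #|{: entry}|) #|{: entry}| v) [eta e with i |-> g].
  have free j : j \in free_vars group_term_vars f -> codes E e j \/ j = i.
    by move=> jf; have [->|ji] := eqVneq j i; [right | left; apply: eE; rewrite mem_filter ji].
  rewrite [holds _ _ (group_to_ring _)]holds_Forall_block; split=> [H v /holds_inverse_formula|H g].
    by move=> [g [X Y]]; apply/(IH g v); [move=> j /free ej; exact: codes_update | exact: H].
  have [v [X Y]] := codes_exists E i g.
  apply/(IH g v); first by move=> j /free ej; exact: codes_update.
  exact/H/(inverse_formula_holds X Y).
- have IH g v := IHf (update E (i * #|{: entry}|) #|{: entry}| v) [eta e with i |-> g].
  have free j : j \in free_vars group_term_vars f -> codes E e j \/ j = i.
    by move=> jf; have [->|ji] := eqVneq j i; [right | left; apply: eE; rewrite mem_filter ji].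
  rewrite [holds _ _ (group_to_ring _)]holds_Exists_block; split=> [[g H]|].
    have [v [X Y]] := codes_exists E i g; exists v; split.
      exact: inverse_formula_holds X Y.
    by apply/(IH g v); first by move=> j /free ej; exact: codes_update.
  move=> [v [/holds_inverse_formula[g [X Y]] H]]; exists g.
  by apply/(IH g v); first by move=> j /free ej; exact: codes_update.
Qed.
End GroupToRing.

Lemma GL_elem_equiv n (K L : fieldType) : K ≡r L -> GL n K ≡g GL n L.
Proof.
move=> KL f sf; have fv (M : fieldType) (E : nat -> M) e :
    {in free_vars group_term_vars f, forall i, codes (n := n) E e i} by move=> i; rewrite sf.
split=> [Kf e|Lf e].
  apply/(group_to_ringE (fv L (fun=> 0%R) e)); apply/(elem_equivP KL _).1 => E.
  exact/(group_to_ringE (fv K E (fun=> 1)))/Kf.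
apply/(group_to_ringE (fv K (fun=> 0%R) e)); apply/(elem_equivP KL _).2 => E.
exact/(group_to_ringE (fv L E (fun=> 1)))/Lf.
Qed.

(** * Centers and quotients *)

Local Open Scope quotient_scope.

Lemma closed_prim_root (F : closedFieldType) m : [pchar F]%R =i pred0 -> (0 < m)%N ->
  exists z : F, (m.-primitive_root z)%R.
Proof.
move=> F_char0 m_gt0; have [r] := closed_field_poly_normal ('X^m - 1 : {poly F})%R.
rewrite (monicP (monic_Xn_sub_1 F m_gt0)) scale1r => rE.
have Ur : uniq r.
  by rewrite -separable_prod_XsubC -rE separable_Xn_sub_1 // ((pcharf0P F).1 F_char0) -lt0n.
have sz : (m <= size r)%N.
  by rewrite -ltnS -(size_prod_XsubC r id) -rE size_Xn_sub_1.
have /hasP[z _ zP] : has (m.-primitive_root)%R r.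
  apply: has_prim_root => //; apply/allP => z zr.
  by rewrite /root_of_unity rE root_prod_XsubC.
by exists z.
Qed.

(** A center parametrized by the nonzero scalars inherits divisibility from roots and cyclic torsion
    from primitive roots of unity. The value of [f] at 0 is arbitrary. *)
Lemma good_center_scalars (F : closedFieldType) (G : groupType) (f : F -> G) :
  [pchar F]%R =i pred0 ->
  (forall a b, a != 0%R -> b != 0%R -> f (a * b)%R = f a * f b) -> f 1%R = 1 ->
  (forall a b, a != 0%R -> b != 0%R -> f a = f b -> a = b) ->
  (forall z, central z <-> exists2 a, a != 0%R & z = f a) -> good_center G.
Proof.
move=> F_char0 fM f1 f_inj fc m m_gt0.
have fX a k : a != 0%R -> f (a ^+ k)%R = f a ^+ k.
  move=> a0; elim: k => [|k IH]; first by rewrite expr0 f1.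
  by rewrite exprS fM ?expf_neq0 // IH expgS.
split=> [_ /fc[a a0 ->]|].
  have [b bm] := closed_root a m_gt0; have b0 : b != 0%R.
    by apply: contraNneq a0 => b0; rewrite -bm b0 expr0n gtn_eqF.
  by exists (f b); rewrite -fX // bm; split=> //; apply/fc; exists b.
have [z zP] := closed_prim_root F_char0 m_gt0.
have z0 : z != 0%R by rewrite (prim_root_eq0 zP) -lt0n.
exists (f z); split; first by apply/fc; exists z.
rewrite -fX // (prim_expr_order zP) f1; split=> //; split.
  move=> k k_gt0; rewrite -fX // -f1 => /f_inj; rewrite expf_neq0 // oner_neq0.
  move=> /(_ isT isT)/eqP; rewrite -(prim_order_dvd zP) => /(dvdn_leq k_gt0).
  by rewrite leqNgt ltn_ord.
move=> _ /fc[a a0 ->]; rewrite -fX // -f1 => /f_inj; rewrite expf_neq0 // oner_neq0.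
move=> /(_ isT isT) /(prim_rootP zP)[k ->]; exists k; exact: fX.
Qed.

Lemma good_center_GL (F : closedFieldType) m : [pchar F]%R =i pred0 -> good_center (GL m.+1 F).
Proof.
move=> F_char0; have us (a : F) : a != 0%R -> (a%:M : 'M[F]_m.+1)%R \in unitmx.
  by move=> a0; rewrite unitmxE det_scalar unitrX ?unitfE.
apply: (@good_center_scalars F _ (fun a => gl (a%:M)%R)) => //.
- move=> a b a0 b0; apply: val_inj; rewrite val_GLM !val_gl ?us ?mulf_neq0 //.
  exact: scalar_mxM.
- by apply: val_inj; rewrite val_gl ?us ?oner_neq0.
- move=> a b a0 b0 /(congr1 val); rewrite !val_gl ?us // => /matrixP/(_ 0%R 0%R).
  by rewrite !mxE eqxx !mulr1n.
move=> z; rewrite central_GLP; split=> [[a za]|[a a0 ->]]; last by exists a; rewrite val_gl ?us.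
have a0 : a != 0%R.
  by apply/eqP => a0; have := valP z; rewrite /= za a0 raddf0 unitmxE det0 unitr0.
by exists a => //; apply: val_inj; rewrite val_gl ?us.
Qed.

Lemma units_central (F : fieldType) (z : units F) : central z.
Proof. by move=> y; apply: val_inj; rewrite /= mulrC. Qed.

Lemma good_center_units (F : closedFieldType) : [pchar F]%R =i pred0 -> good_center (units F).
Proof.
move=> F_char0; have vu (a : F) : a != 0%R -> val (insubd (1 : units F) a) = a.
  by move=> a0; rewrite insubdK // unfold_in unitfE.
apply: (@good_center_scalars F (units F) (fun a : F => insubd (1 : units F) a)) => //.
- by move=> a b a0 b0; apply: val_inj; rewrite /= !vu ?mulf_neq0.
- by apply: val_inj; rewrite vu ?oner_neq0.
- by move=> a b a0 b0 /(congr1 val); rewrite !vu.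
move=> z; split=> [_|_]; last exact: units_central.
have z0 : val z != 0%R by rewrite -unitfE; exact: valP z.
by exists (val z) => //; apply: val_inj; rewrite vu.
Qed.

Lemma good_center_center (G : groupType) : good_center (center G) -> good_center G.
Proof.
have cc (a : center G) : central a by move=> b; apply: center_mulC.
have valX (a : center G) k : val (a ^+ k) = val a ^+ k.
  by elim: k => [|k IH] //; rewrite !expgS -IH.
move=> Gc m m_gt0; have [Gd [c [_ [cm [ck cg]]]]] := Gc m m_gt0; split.
  move=> z /central_center[a <-]; have [w [_ <-]] := Gd a (cc a).
  by exists (val w); rewrite valX; split=> //; apply: center_commute.
exists (val c); split; first exact: center_commute.
split; first by rewrite -valX cm.
split=> [k k_gt0|z /central_center[a <-]].
  by rewrite -valX => ckE; apply: (ck k k_gt0); apply: val_inj.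
rewrite -[_ ^+ m]valX => am; have [|k ->] := cg a (cc a); first exact: val_inj.
by exists k; rewrite valX.
Qed.

Lemma pi_kernelE (H : groupType) (a b : derived H * center H) :
  let Q := quotient_group (kernel (@mul_derived_center H)) in
  \pi_Q a = \pi_Q b <-> mul_derived_center a = mul_derived_center b.
Proof.
set N := kernel _ => Q; have mulM := @mul_derived_center_is_multiplicative H.
have relE : coset_rel N a b <-> mul_derived_center a = mul_derived_center b.
  have -> : mul_derived_center b = mul_derived_center a * mul_derived_center (a^-1 * b).
    by rewrite -mulM mulVKg.
  have -> : coset_rel N a b = (mul_derived_center (a^-1 * b) == 1) by [].
  split=> [/eqP->|ab]; first by rewrite mulg1.
  by apply/eqP/(mulgI (mul_derived_center a)); rewrite -ab mulg1.
by rewrite -relE; split=> [/eqmodP|ab]; last apply/eqmodP.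
Qed.

Lemma quotient_iso (H : groupType) :
  (forall y : H, exists (h : derived H) (z : center H), y = val h * val z) ->
  H ≅ quotient_group (kernel (@mul_derived_center H)).
Proof.
move=> split_H; set N := kernel _.
have /choice[p pP] : forall y : H, exists p : derived H * center H, mul_derived_center p = y.
  by move=> y; have [h [z ->]] := split_H y; exists (h, z).
apply: (@group_isoI _ _ (fun y => \pi_(quotient_group N) (p y))).
- move=> y z; rewrite -[RHS]/(quotient_mul _ _) quotient_mulE; apply/pi_kernelE.
  by rewrite pP (mul_derived_center_is_multiplicative (p y)) !pP.
- by move=> y z /pi_kernelE; rewrite !pP.
- elim/quotW=> a; exists (mul_derived_center a); apply/pi_kernelE; exact: pP.
Qed.

(** * Perfect derived subgroups and the resulting central products *)

Section SLFacts.
Variables (K : fieldType) (m : nat).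
Local Notation n := m.+1.
Implicit Types A B : SL n K.

Lemma SL_det A : (\det (val (val A)) = 1)%R.
Proof. by apply/eqP; exact: valP A. Qed.

Lemma SL_of (g : GL n K) : (\det (val g) = 1)%R -> exists A : SL n K, val A = g.
Proof.
move=> dg; have gS : g \in @SL_pred n K by rewrite unfold_in /SL_pred dg.
by exists (Sub g gS); rewrite SubK.
Qed.

Lemma SL_trans p (c : K) : p.1 != p.2 -> exists A : SL n K, val A = gl_trans p c.
Proof. by move=> p12; apply: SL_of; rewrite val_gl_trans // det_transvection. Qed.

(** With a third index [j] available, the transvection at [(i, k)] is a commutator of those at
    [(i, j)] and [(j, k)]. *)
Lemma SL_perfect : (3 <= n)%N -> forall A, A \in @derived_pred (SL n K).
Proof.
move=> n3 A; have DM := @derived_mul (SL n K).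
have D1 : 1 \in @derived_pred (SL n K) by case: (derived_closed (SL n K)).
suff word_derived (a : _ -> K) (B : SL n K) :
    val (val B) = word_mx a -> B \in @derived_pred (SL n K).
  by have [a aP] := word_mx_surj (SL_det A); apply: word_derived aP.
have trans_derived p c (C : SL n K) :
    p.1 != p.2 -> val C = gl_trans p c -> C \in @derived_pred (SL n K).
  case: p => i k /= ik CE.
  have [j /andP[ji jk]] : exists j : 'I_n, (j != i) && (j != k).
    apply/existsP; rewrite -[X in is_true X]negbK negb_exists; apply/negP => /forallP all2.
    have : (#|'I_n| <= #|[set i; k]|)%N.
      by apply/subset_leq_card/subsetP => j _; have := all2 j; rewrite !inE negb_and !negbK.
    by rewrite card_ord cards2 ik; lia.
  have ij : i != j by rewrite eq_sym.
  have [X XE] := @SL_trans (i, j) c ij; have [Y YE] := @SL_trans (j, k) 1%R jk.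
  have -> : C = [~ X, Y].
    apply: val_inj; rewrite -[RHS]/([~ val X, val Y]) XE YE.
    by rewrite (gl_trans_comm c 1 ij jk ik) mulr1.
  exact: commutator_derived.
move=> Ba; pose P (M : 'M[K]_n) :=
  exists2 C : SL n K, C \in @derived_pred (SL n K) & val (val C) = M.
suff [C CD CE] : P (word_mx a).
  by have -> : B = C by do 2!apply: val_inj; rewrite Ba CE.
have P1 : P 1%:M%R by exists 1.
have PM M N : P M -> P N -> P (M *m N)%R.
  by move=> [C CD <-] [D DD <-]; exists (C * D); first exact: DM.
apply: (big_ind P) => // k _; apply: (big_ind P) => // p p12.
have [C CE] := @SL_trans p (a (k, p)) p12; exists C; last by rewrite CE val_gl_trans.
exact: trans_derived p12 CE.
Qed.
End SLFacts.

Lemma perfect_iso (G H : groupType) : G ≅ H -> (forall x : H, x \in @derived_pred H) ->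
  forall x : G, x \in @derived_pred G.
Proof.
move=> [f [g fK gK]] Hperf x; apply/asboolP => S [S1 SF] SC.
have gM : {morph g : y z / y * z}.
  by move=> y z; apply: (can_inj fK); rewrite gmulfM !gK.
have g1 : g 1 = 1 by apply: (mulgI (g 1)); rewrite -gM !mulg1.
have gV y : g y^-1 = (g y)^-1 by apply: (mulgI (g y)); rewrite -gM !mulgV g1.
have := asboolW (Hperf (f x)) (fun y => g y \in S).
rewrite unfold_in fK; apply.
  split=> [|y z]; rewrite !unfold_in ?g1 // gM gV; exact: SF.
by move=> y z; rewrite unfold_in /commg /conjg !gM !gV; exact: SC.
Qed.

(** The isomorphism yields an injective endomorphism [phi] of [H] with image H' Z(H). By perfectness
    each element of H' is the image of some [x] in H'. If [phi y] is h z and [phi x] is h, then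
    [phi] maps [x^-1 * y] to the central z; by injectivity [x^-1 * y] is central, so [y] lies in H'
    Z(H). *)
Lemma perfect_quotient_iso (H : groupType) :
  H ≅ quotient_group (kernel (@mul_derived_center H)) ->
  (forall h : derived H, h \in @derived_pred (derived H)) ->
  forall y : H, exists (h : derived H) (z : center H), y = val h * val z.
Proof.
move=> [f [g fK gK]] perf; set N := kernel _ in f g fK gK.
pose phi y : H := mul_derived_center (repr (f y)).
have mulM := @mul_derived_center_is_multiplicative H.
have reprE a : mul_derived_center (repr (\pi_(quotient_group N) a)) = mul_derived_center a.
  by apply/pi_kernelE; rewrite reprK.
have phiM : {morph phi : y z / y * z}.
  by move=> y z; rewrite /phi gmulfM [f y * f z]/(quotient_mul _ _) reprE mulM.
have phi_inj : injective phi.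
  by move=> y z /pi_kernelE; rewrite !reprK => /(can_inj fK).
have phi_surj (h : derived H) (z : center H) : exists x, phi x = val h * val z.
  by exists (g (\pi_(quotient_group N) (h, z))); rewrite /phi gK reprE.
have phi1 : phi 1 = 1 by apply: (mulgI (phi 1)); rewrite -phiM !mulg1.
have phiV y : phi y^-1 = (phi y)^-1 by apply: (mulgI (phi y)); rewrite -phiM !mulgV phi1.
have phi_derived (h : derived H) : exists2 y, y \in @derived_pred H & phi y = val h.
  have := asboolW (perf h) (fun d => `[< exists2 y, y \in @derived_pred H & phi y = val d >]).
  rewrite unfold_in => H1; apply/asboolP/H1.
    have [D1 DF] := derived_closed H; split; first by apply/asboolP; exists 1.
    move=> d1 d2 /asboolP[y1 y1D y1E] /asboolP[y2 y2D y2E]; apply/asboolP.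
    by exists (y1 * y2^-1); [exact: DF | rewrite phiM phiV y1E y2E].
  move=> d1 d2; apply/asboolP.
  have [y1 y1E] := phi_surj d1 1; have [y2 y2E] := phi_surj d2 1.
  exists [~ y1, y2]; first exact: commutator_derived.
  by rewrite /commg /conjg !phiM !phiV y1E y2E !mulg1.
move=> y; have [h [z yE]] : exists h z, phi y = val (h : derived H) * val (z : center H).
  by exists (repr (f y)).1, (repr (f y)).2.
have [x xD xE] := phi_derived h.
have xyE : phi (x^-1 * y) = val z by rewrite phiM phiV xE yE mulKg.
have /central_center[w wE] : central (x^-1 * y).
  by move=> u; apply: phi_inj; rewrite !phiM -phiM xyE; exact: center_commute.
by exists (Sub x xD), w; rewrite SubK wE mulVKg.
Qed.

Lemma GL0_1 (K : fieldType) (g : GL 0 K) : g = 1.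
Proof. by apply: val_inj; rewrite [val g]flatmx0 [RHS]flatmx0. Qed.

(** Abelian groups are central products with a trivial group, here [GL 0 rat], so the same back and
    forth applies. *)
Lemma center_equiv_units (H : groupType) (F : fieldType) :
  good_center H -> good_center (units F) -> center H ≡g units F.
Proof.
move=> Hc Fc.
have cp1 : central_product (1 : GL 0 rat) 1
    (fun=> 1 : center H) (id : additive_center H -> center H) 0%R.
  split=> //.
  - by move=> x y; rewrite mulg1.
  - by move=> _ a; apply: center_mulC.
  - by move=> a; exists 1, a; rewrite mul1g.
  - by move=> k; rewrite mul0rn dvd1n.
  move=> x a; rewrite mul1g; split=> [->|[k [_ ->]]]; last by rewrite mul0rn oppr0.
  by exists 0; split; [exact: GL0_1 | rewrite mulr0n oppr0].
have cp2 : central_product (1 : GL 0 rat) 1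
    (fun=> 1 : units F) (val : additive_center (units F) -> units F) 0%R.
  split=> //.
  - by move=> x y; rewrite mulg1.
  - by move=> _ a; apply: units_central.
  - by move=> a; have [b <-] := central_center (units_central a); exists 1, b; rewrite mul1g.
  - by move=> k; rewrite mul0rn dvd1n.
  move=> x a; rewrite mul1g; split=> [a1|[k [_ ->]]]; last by rewrite mul0rn oppr0.
  by exists 0; split; [exact: GL0_1 | rewrite mulr0n oppr0; apply: val_inj].
exact: (central_product_equiv _ cp1 cp2 (good_center_dct Hc) (good_center_dct Fc)).
Qed.

(** * Central products of the special linear group with a center *)

Section SLCentralProduct.
Variables (L : fieldType) (m : nat).
Local Notation n := m.+1.
Variable zeta : SL n L.
Hypothesis zeta_gen : center_generator n (val zeta : GL n L).

(** Commuting with all transvections makes [A] scalar, and determinant 1 makes it [n]-torsion in the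
    center of the general linear group, which [zeta] generates. *)
Lemma central_SL (A : SL n L) : central A -> exists k, A = zeta ^+ k.
Proof.
move=> cA; have [a AE] : exists a, val (val A) = (a%:M)%R.
  apply: commute_transvections => p p12; have [C CE] := SL_trans (1 : L)%R p12.
  by have := congr1 (fun B => val (val B)) (cA C); rewrite /= CE val_gl_trans.
have cAG : central (val A : GL n L) by apply/central_GLP; exists a.
have [|k kE] := zeta_gen.2.2.2 (val A) cAG.
  apply: val_inj; have X k : val ((val A : GL n L) ^+ k) = ((a ^+ k)%:M)%R.
    elim: k => [|k IH]; first by rewrite expr0.
    by rewrite expgS val_GLM IH AE exprS scalar_mxM.
  by rewrite X; have := SL_det A; rewrite AE det_scalar => ->.
exists k; apply: val_inj; rewrite kE; elim: (nat_of_ord k) => // j IH.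
by rewrite !expgS IH.
Qed.

Lemma zeta_order k : zeta ^+ k = 1 <-> (n %| k)%N.
Proof.
have [c cE] := central_center zeta_gen.1; have := zeta_gen; rewrite -cE => gc.
rewrite -(proj1 (generates_center (ltn0Sn m) gc) k).
have vX : val (zeta ^+ k) = val (c *+ k)%R :> GL n L.
  rewrite val_mulrn cE; elim: k => // j IH; by rewrite !expgS -IH.
split=> [z1|c0]; apply: val_inj; [rewrite -vX z1 | rewrite vX c0]; by [].
Qed.

Lemma SL_central_product (H : groupType) (f : SL n L -> H) :
  {morph f : x y / x * y} -> injective f ->
  (forall y, exists x z, central z /\ y = f x * z) ->
  exists c, central_product zeta n f (val : additive_center H -> H) c.
Proof.
move=> fM f_inj f_surj.
have f1 : f 1 = 1 by apply: (mulgI (f 1)); rewrite -fM !mulg1.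
have fV A : f A^-1 = (f A)^-1 by apply: (mulgI (f A)); rewrite -fM !mulgV f1.
have fX A k : f (A ^+ k) = f A ^+ k by elim: k => // k IH; rewrite !expgS fM IH.
have czeta : central (f zeta).
  move=> y; have [x [z [cz ->]]] := f_surj y.
  apply: commuteM; last by apply: commute_sym; apply: cz.
  rewrite /commute -!fM; congr f; apply: val_inj; exact: (zeta_gen.1 (val x)).
have [c cE] := central_center czeta; exists c; split=> //.
- by move=> x a; apply/commute_sym/center_commute.
- by move=> y; have [x [z [/central_center[a <-] ->]]] := f_surj y; exists x, a.
- move=> k; rewrite -zeta_order; split=> [c0|z1].
    by apply: f_inj; rewrite fX f1 -cE -val_mulrn c0.
  by apply: val_inj; rewrite val_mulrn cE -fX z1 f1.
move=> x a; split=> [xa|[k [-> ->]]]; last first.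
  by rewrite fX -cE -val_mulrn; apply: mulgV.
have fx : f x = (val a)^-1 by rewrite -[LHS](mulgK (val a)) xa mul1g.
have [|k xk] := @central_SL x.
  move=> y; apply: f_inj; rewrite !fM fx.
  by apply/commute_sym/commuteV/commute_sym/center_commute.
exists k; split=> //; apply: val_inj; rewrite -[RHS]/((val (c *+ k)%R)^-1).
by rewrite val_mulrn cE -fX -xk fx invgK.
Qed.
End SLCentralProduct.

Lemma SL_GL_equiv (L : fieldType) m (H : groupType) : good_center (GL m.+1 L) ->
  good_center H -> derived H ≅ SL m.+1 L ->
  (forall y : H, exists (h : derived H) (z : center H), y = val h * val z) -> H ≡g GL m.+1 L.
Proof.
move=> Lc Hc [g [f gK fK]] split_H.
have [c gc] := (Lc m.+1 (ltn0Sn m)).2.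
have scalar_pow (z : GL m.+1 L) a k : val z = (a%:M)%R -> val (z ^+ k) = ((a ^+ k)%:M)%R.
  move=> za; elim: k => [|k IH]; first by rewrite expr0.
  by rewrite expgS val_GLM IH za exprS scalar_mxM.
have [a cE] := (central_GLP c).1 gc.1.
have [zeta zetaE] : exists A : SL m.+1 L, val A = c.
  apply: SL_of; rewrite cE det_scalar.
  have := congr1 val gc.2.1; rewrite (scalar_pow _ _ _ cE) => /matrixP/(_ 0%R 0%R).
  by rewrite !mxE !mulr1n.
rewrite -zetaE in gc.
have fM : {morph f : A B / A * B}.
  by move=> A B; apply: (can_inj gK); rewrite gmulfM !fK.
have [|||c1 cp1] := SL_central_product gc (f := fun A => val (f A)).
- by move=> A B; rewrite fM.
- by move=> A B /val_inj/(can_inj fK).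
- move=> y; have [h [z ->]] := split_H y; exists (g h), (val z); rewrite gK.
  by split=> //; exact: center_commute.
have [|||c2 cp2] := SL_central_product gc (f := fun A : SL m.+1 L => val A).
- by [].
- exact: val_inj.
(* [L] is an arbitrary field here, so the root of the determinant comes from divisibility of the
   center, applied to the scalar matrix of the determinant. *)
- move=> y; pose d : GL m.+1 L := gl ((\det (val y))%:M)%R.
  have d0 : (\det (val y) != 0)%R by rewrite -unitfE -unitmxE; exact: valP y.
  have dE : val d = ((\det (val y))%:M)%R.
    by rewrite val_gl // unitmxE det_scalar unitrX ?unitfE.
  have [|w [/central_GLP[b wE] wd]] := (Lc m.+1 (ltn0Sn m)).1 d.
    by apply/central_GLP; eexists; exact: dE.
  have bn : (b ^+ m.+1 = \det (val y))%R.
    have := congr1 val wd; rewrite (scalar_pow _ _ _ wE) dE => /matrixP/(_ 0%R 0%R).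
    by rewrite !mxE !mulr1n.
  have [|A AE] := @SL_of L m (y * w^-1).
    by rewrite val_GLM val_GLV wE det_mulmx det_inv det_scalar bn divff.
  by exists A, w; rewrite AE mulgVK; split=> //; apply/central_GLP; exists b.
exact: (central_product_equiv _ cp1 cp2 (good_center_dct Hc) (good_center_dct Lc)).
Qed.

(* Complex numbers and the two implications for the general linear group *)
From mathcomp Require Import Rstruct complex.

Lemma complex_char0 : [pchar Rdefinitions.R[i]]%R =i pred0.
Proof. exact: pchar_num. Qed.

Theorem theorem6p1 (n : nat) (hn : (3 <= n)%N) (F : closedFieldType)
    (F_char0 : [pchar F]%R =i pred0) (H : groupType) :
  H ≡g GL n F <->
  [/\ H ≅ quotient_group (kernel (@mul_derived_center H)),
      exists L : fieldType, L ≡r F /\ derived H ≅ SL n L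
    & center H ≡g units Rdefinitions.R[i]].
Proof.
case: n hn => // m n3.
have Cc := good_center_units complex_char0.
have Fc := good_center_GL m F_char0.
split=> [HF|[HQ [L [LF HL]] HZ]].
  have Hc : good_center H := good_center_transfer (group_elem_equiv_sym HF) Fc.
  have [x [s [t [S [fr [ax [mul [comm gen]]]]]]]] : matrix_like H m.+1 :=
    definable_transfer (P := fun G => matrix_like G m.+1)
      (group_elem_equiv_sym HF) (definable_matrix_like m.+1) (GL_matrix_like F_char0 n3).
  have cv := coord_field_coordinates (FieldFrame ax).
  split.
  - apply: quotient_iso => y; have [a [z [aD [/central_center[c <-] ->]]]] := gen y.
    by exists (Sub (group_word S a) (group_word_derived S aD)), c; rewrite SubK.
  - exists (coord_field (FieldFrame ax)); split.
      exact: coordinates_ring_equiv F_char0 HF fr cv.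
    exact: derived_iso_SL cv mul comm.
  - exact: center_equiv_units Hc Cc.
have Hc : good_center H.
  exact/good_center_center/(good_center_transfer (group_elem_equiv_sym HZ))/Cc.
(* The comparison goes through [GL m.+1 L], which shares the factor SL_n(L) with [H] and inherits
   the good center from [GL m.+1 F]. *)
have GLF : GL m.+1 L ≡g GL m.+1 F := GL_elem_equiv m.+1 LF.
apply: (group_elem_equiv_trans _ GLF); apply: SL_GL_equiv => //.
  exact: good_center_transfer (group_elem_equiv_sym GLF) Fc.
apply: perfect_quotient_iso HQ _; apply: (perfect_iso HL); exact: SL_perfect.
Qed.
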